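(* Let $p:\mathbb{E}\to\mathbb{B}$ be a fibred type-theoretic fibration category with a univalent fibration $w:\tilde W\to W$ in $\mathbb{E}$ above $u:\tilde U\to U$, $\mathbb{A}$ a type-theoretic fibration category with a univalent fibration $v:\tilde V\to V$, and $F:\mathbb{A}\to\mathbb{B}$ a functor preserving fibrations, pullbacks of fibrations and acyclic cofibrations. Suppose $Fv$ is a pullback of $u$ along a morphism $h:FV\to U$ with upper morphism $k:F\tilde V\to\tilde U$. Then $(v,h^*w):(\tilde V,k^*\tilde W)\to(V,h^*W)$ is a univalent fibration in $F^*\mathbb{E}$, where $h^*w:k^*\tilde W\to h^*W$ is the morphism above $Fv$ induced by $w$ (the pullback of $w$ along the cartesian morphism $h^*W\to W$).
   Context: A morphism $i:A\to B$ has the left lifting property with respect to $q:C\to D$ if for all $f:A\to C$, $g:B\to D$ with $qf=gi$ there is $h:B\to C$ with $hi=f$ and $qh=g$. A type-theoretic fibration category is a category $\mathbb{C}$ with a terminal object $1$ and a subcategory whose morphisms are called fibrations, such that (an acyclic cofibration being a morphism with the left lifting property with respect to all fibrations): (i) all isomorphisms and all morphisms with codomain $1$ are fibrations; (ii) pullbacks of fibrations along arbitrary morphisms exist and are fibrations; (iii) every morphism factors as an acyclic cofibration followed by a fibration; (iv) for any fibrations $f:A\to B$ and $g:B\to C$ there is a fibration $\Pi_gf:\Pi_gA\to C$, called a dependent product of $f$ along $g$, with a natural bijection $(\mathbb{C}/C)(h,\Pi_gf)\cong(\mathbb{C}/B)(g^*h,f)$ for all $h:X\to C$. A type-theoretic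 functor preserves terminal objects, fibrations, pullbacks of fibrations, acyclic cofibrations and dependent products. A fibred category is a Grothendieck fibration; $f$ is above $s$ if $pf=s$. A fibred type-theoretic fibration category is a fibred category $p:\mathbb{E}\to\mathbb{B}$ such that: (1) $\mathbb{E}$ and $\mathbb{B}$ are type-theoretic fibration categories and $p$ is a type-theoretic functor; (2) every cartesian morphism above a fibration is a fibration; (3) if $g:A\to C$ is a fibration in $\mathbb{E}$, $pg=t\circ s$ with $s:pA\to J$ a fibration and $t:J\to pC$, then the induced morphism $A\to t^*C$ above $s$ is a fibration; (4) every cartesian morphism above an acyclic cofibration is an acyclic cofibration. The change of base $F^*\mathbb{E}\to\mathbb{A}$ has as objects of $F^*\mathbb{E}$ pairs $(I,A)$ with $I\in\mathbb{A}$, $A\in\mathbb{E}$, $pA=FI$, and as morphisms $(I,A)\to(J,B)$ pairs $(s,f)$ with $s:I\to J$ in $\mathbb{A}$ and $f:A\to B$ above $Fs$. For $F$ as in the claim it is a fibred type-theoretic fibration category in which $(s,f)$ is a fibration iff $s$ and $f$ are fibrations. In a type-theoretic fibration category, a path object of a fibration $A\to\Gamma$ is a factorization $A\to P_\Gamma A\to A\times_\Gamma A$ of the diagonal into an acyclic cofibration followed by a fibration; every fibration is assumed to have a fixed path object. Morphisms $f,g:A\to B$ are homotopic, $f\sim g$, if there is a morphism $A\to P_1B$ into some path object of $B\to 1$ whose projections are $f$ and $g$. A morphism $f:A\to B$ is a homotopy equivalence if there is $g:B\to A$ with $gf\sim1$ and $fg\sim1$. For a fibration $u:\tilde U\to U$,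 let $E(u)\to U\times U$ be the fibration interpreting the type $a:U,b:U\vdash\tilde U(a)\simeq\tilde U(b)$, where $A\simeq B\equiv\Sigma_{f:A\to B}(\Sigma_{g:B\to A}\Pi_{x:A}\,g(fx)=x)\times(\Sigma_{h:B\to A}\Pi_{y:B}\,f(hy)=y)$. It is characterized by: for $\langle a,b\rangle:X\to U\times U$, morphisms $X\to E(u)$ over $U\times U$ correspond naturally to quintuples $(f:a^*\tilde U\to b^*\tilde U,\ g:b^*\tilde U\to a^*\tilde U,\ \sigma:a^*\tilde U\to P_U\tilde U,\ h:b^*\tilde U\to a^*\tilde U,\ \tau:b^*\tilde U\to P_U\tilde U)$ with $f,g,h$ over $X$, such that the composite of $\sigma$ with $P_U\tilde U\to\tilde U\times_U\tilde U$ equals $\langle gf,1\rangle$ followed by the canonical map $a^*\tilde U\times_Xa^*\tilde U\to\tilde U\times_U\tilde U$, and the composite of $\tau$ with $P_U\tilde U\to\tilde U\times_U\tilde U$ equals $\langle fh,1\rangle$ followed by $b^*\tilde U\times_Xb^*\tilde U\to\tilde U\times_U\tilde U$. Let $e(u):U\to E(u)$ be the morphism over the diagonal $U\to U\times U$ corresponding to the identity function (with reflexivity homotopies). The fibration $u$ is univalent if $e(u)$ is a homotopy equivalence.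
   Formalization: The claim does not say which path objects F*E carries and fails for arbitrary ones; here the fixed path object of (v,h*w) must consist of that of v (up to isomorphism) and a cartesian reindexing of that of w, compatibly with reflexivity and end points; such a choice is shown to exist. *)

(* Defs.v *)
From Stdlib Require Import ProofIrrelevance.

(** * Categories and functors *)

Record Category : Type := {
  Ob :> Type;
  Hom : Ob -> Ob -> Type;
  idm : forall A : Ob, Hom A A;
  comp : forall {A B C : Ob}, Hom B C -> Hom A B -> Hom A C;
  comp_id_l : forall (A B : Ob) (f : Hom A B), comp (idm B) f = f;
  comp_id_r : forall (A B : Ob) (f : Hom A B), comp f (idm A) = f;
  comp_assoc : forall (A B C D : Ob) (h : Hom C D) (g : Hom B C) (f : Hom A B),
    comp h (comp g f) = comp (comp h g) f
}.

Arguments Hom {c} A B.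
Arguments idm {c} A.
Arguments comp {c A B C} g f.

Notation "g ∘ f" := (comp g f) (at level 40, left associativity).

Record Functor (C D : Category) : Type := {
  fob :> C -> D;
  fmap : forall {X Y : C}, Hom X Y -> Hom (fob X) (fob Y);
  fmap_id : forall X : C, fmap (idm X) = idm (fob X);
  fmap_comp : forall (X Y Z : C) (g : Hom Y Z) (f : Hom X Y),
    fmap (g ∘ f) = fmap g ∘ fmap f
}.

Arguments fob {C D} F _ : rename.
Arguments fmap {C D} F {X Y} _ : rename.

(* The identity morphism along an equality of objects.  "[pf = s] modulo
   [pA = I] and [pB = J]" is written [idto eB ∘ fmap p f = s ∘ idto eA]. *)
Definition idto {C : Category} {A B : C} (e : A = B) : Hom A B :=
  match e in _ = B' return Hom A B' with eq_refl => idm A end.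

Definition IsIso {C : Category} {A B : C} (f : Hom A B) : Prop :=
  exists g : Hom B A, g ∘ f = idm A /\ f ∘ g = idm B.

Definition IsTerminal {C : Category} (T : C) : Prop :=
  forall X : C, exists f : Hom X T, forall g : Hom X T, g = f.

Definition IsProduct {C : Category} {A B P : C} (p0 : Hom P A) (p1 : Hom P B) : Prop :=
  forall (X : C) (a : Hom X A) (b : Hom X B),
    exists m : Hom X P, (p0 ∘ m = a /\ p1 ∘ m = b) /\
      forall m' : Hom X P, p0 ∘ m' = a -> p1 ∘ m' = b -> m' = m.

Definition IsPullback {C : Category} {A B X P : C} (u : Hom A B) (a : Hom X B)
    (top : Hom P A) (base : Hom P X) : Prop :=
  u ∘ top = a ∘ base /\
  forall (Y : C) (y : Hom Y A) (x : Hom Y X), u ∘ y = a ∘ x ->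
    exists m : Hom Y P, (top ∘ m = y /\ base ∘ m = x) /\
      forall m' : Hom Y P, top ∘ m' = y -> base ∘ m' = x -> m' = m.

(* A pullback [a^*A -> X] of [u : A -> B] along [a : X -> B].  Pullbacks are not
   chosen globally; notions involving [a^*A] quantify over all such squares. *)
Record PB {C : Category} {A B X : C} (u : Hom A B) (a : Hom X B) : Type := {
  pb_ob :> C;
  pb_top : Hom pb_ob A;
  pb_base : Hom pb_ob X;
  pb_is : IsPullback u a pb_top pb_base
}.

Arguments pb_ob {C A B X u a} p.
Arguments pb_top {C A B X u a} p.
Arguments pb_base {C A B X u a} p.
Arguments pb_is {C A B X u a} p.

Definition map_pb {C D : Category} (F : Functor C D) {A B X : C}
    {u : Hom A B} {a : Hom X B} (S : PB u a)
    (H : IsPullback (fmap F u) (fmap F a) (fmap F (pb_top S)) (fmap F (pb_base S))) :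
    PB (fmap F u) (fmap F a) :=
  {| pb_ob := F S; pb_top := fmap F (pb_top S); pb_base := fmap F (pb_base S);
     pb_is := H |}.

(* [k] is the canonical morphism [(a ∘ y)^*A -> a^*A]. *)
Definition IsPBMap {C : Category} {A B X X' : C} {u : Hom A B} {a : Hom X B}
    (y : Hom X' X) (S : PB u a) (S' : PB u (a ∘ y)) (k : Hom S' S) : Prop :=
  pb_top S ∘ k = pb_top S' /\ pb_base S ∘ k = y ∘ pb_base S'.

Lemma id_square_pullback {C : Category} {A B : C} (u : Hom A B) :
  IsPullback u (idm B) (idm A) u.
Proof.
  split; [now rewrite comp_id_l, comp_id_r |].
  intros Y y x H; exists y; repeat split.
  - apply comp_id_l.
  - now rewrite H, comp_id_l.
  - intros m' H1 _; now rewrite <- H1, comp_id_l.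
Qed.

Definition id_square {C : Category} {A B : C} (u : Hom A B) : PB u (idm B) :=
  {| pb_ob := A; pb_top := idm A; pb_base := u; pb_is := id_square_pullback u |}.

(** * Type-theoretic fibration categories *)

Record FibCat : Type := {
  fc_cat :> Category;
  fib : forall {A B : fc_cat}, Hom A B -> Prop
}.

Arguments fib {f A B} _.

Definition LLP {C : Category} {A B X Y : C} (i : Hom A B) (q : Hom X Y) : Prop :=
  forall (f : Hom A X) (g : Hom B Y), q ∘ f = g ∘ i ->
    exists h : Hom B X, h ∘ i = f /\ q ∘ h = g.

Definition AcyclicCofib {C : FibCat} {A B : C} (i : Hom A B) : Prop :=
  forall (X Y : C) (q : Hom X Y), fib q -> LLP i q.

(* The natural bijection [(C/Z)(h, dp) ≅ (C/Y)(g^*h, f)] exhibiting [dp : P -> Z] as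
   a dependent product of [f : A -> Y] along [g : Y -> Z].  For [S] a pullback of
   [g] along [h], the morphism [g^*h] is [pb_top S : S -> Y]. *)
Record DepProd {C : FibCat} {A Y Z P : C} (f : Hom A Y) (g : Hom Y Z) (dp : Hom P Z) :
    Type := {
  dp_fib : fib dp;
  dp_tr : forall {X : C} (h : Hom X Z) (S : PB g h) (m : Hom X P),
    dp ∘ m = h -> Hom S A;
  dp_over : forall (X : C) (h : Hom X Z) (S : PB g h) (m : Hom X P) (e : dp ∘ m = h),
    f ∘ dp_tr h S m e = pb_top S;
  dp_inj : forall (X : C) (h : Hom X Z) (S : PB g h) (m m' : Hom X P)
    (e : dp ∘ m = h) (e' : dp ∘ m' = h), dp_tr h S m e = dp_tr h S m' e' -> m = m';
  dp_surj : forall (X : C) (h : Hom X Z) (S : PB g h) (n : Hom S A),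
    f ∘ n = pb_top S -> exists (m : Hom X P) (e : dp ∘ m = h), dp_tr h S m e = n;
  dp_nat : forall (X X' : C) (y : Hom X' X) (h : Hom X Z)
    (S : PB g h) (S' : PB g (h ∘ y)) (k : Hom S' S) (m : Hom X P)
    (e : dp ∘ m = h) (e' : dp ∘ (m ∘ y) = h ∘ y),
    IsPBMap y S S' k -> dp_tr (h ∘ y) S' (m ∘ y) e' = dp_tr h S m e ∘ k
}.

Arguments dp_tr {C A Y Z P f g dp} d {X} h S m e.

(* A path object of [u : A -> G]: a factorization of the diagonal
   [A -> A ×_G A].  A choice of the fibre product is part of the data. *)
Record PathObject {C : FibCat} {A G : C} (u : Hom A G) : Type := {
  po_sq : PB u u;
  po_ob : C;
  po_refl : Hom A po_ob;
  po_bd : Hom po_ob po_sq;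
  po_refl_ac : AcyclicCofib po_refl;
  po_bd_fib : fib po_bd;
  po_diag0 : pb_top po_sq ∘ (po_bd ∘ po_refl) = idm A;
  po_diag1 : pb_base po_sq ∘ (po_bd ∘ po_refl) = idm A
}.

Arguments po_sq {C A G u} p.
Arguments po_ob {C A G u} p.
Arguments po_refl {C A G u} p.
Arguments po_bd {C A G u} p.

Definition po_src {C : FibCat} {A G : C} {u : Hom A G} (P : PathObject u) :
  Hom (po_ob P) A := pb_top (po_sq P) ∘ po_bd P.

Definition po_tgt {C : FibCat} {A G : C} {u : Hom A G} (P : PathObject u) :
  Hom (po_ob P) A := pb_base (po_sq P) ∘ po_bd P.

Definition FixedPaths (C : FibCat) : Type :=
  forall (A G : C) (u : Hom A G), fib u -> PathObject u.

Record IsTTFC (C : FibCat) : Prop := {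
  tt_terminal : exists T : C, IsTerminal T;
  tt_fib_comp : forall (X Y Z : C) (g : Hom Y Z) (f : Hom X Y),
    fib g -> fib f -> fib (g ∘ f);
  tt_fib_iso : forall (X Y : C) (f : Hom X Y), IsIso f -> fib f;
  tt_fib_terminal : forall (X T : C) (f : Hom X T), IsTerminal T -> fib f;
  tt_pb_exists : forall (A B X : C) (u : Hom A B) (a : Hom X B),
    fib u -> inhabited (PB u a);
  tt_pb_fib : forall (A B X : C) (u : Hom A B) (a : Hom X B) (S : PB u a),
    fib u -> fib (pb_base S);
  tt_factor : forall (X Y : C) (f : Hom X Y),
    exists (Z : C) (i : Hom X Z) (q : Hom Z Y),
      AcyclicCofib i /\ fib q /\ f = q ∘ i;
  tt_depprod : forall (A Y Z : C) (f : Hom A Y) (g : Hom Y Z), fib f -> fib g ->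
    exists (P : C) (dp : Hom P Z), inhabited (DepProd f g dp)
}.

Record TTFC : Type := {
  tt_cat :> FibCat;
  tt_ax : IsTTFC tt_cat;
  tt_paths : FixedPaths tt_cat
}.

Arguments tt_paths t : clear implicits.

(** * Functors between them *)

Definition PreservesFib {C D : FibCat} (F : Functor C D) : Prop :=
  forall (X Y : C) (f : Hom X Y), fib f -> fib (fmap F f).

Definition PreservesAcyclicCofib {C D : FibCat} (F : Functor C D) : Prop :=
  forall (X Y : C) (i : Hom X Y), AcyclicCofib i -> AcyclicCofib (fmap F i).

Definition PreservesPBofFib {C D : FibCat} (F : Functor C D) : Prop :=
  forall (A B X : C) (u : Hom A B) (a : Hom X B) (S : PB u a), fib u ->
    IsPullback (fmap F u) (fmap F a) (fmap F (pb_top S)) (fmap F (pb_base S)).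

(* The image of a dependent product is one, with bijection compatible with [F]. *)
Definition PreservesDepProd {C D : FibCat} (F : Functor C D) : Prop :=
  forall (A Y Z P : C) (f : Hom A Y) (g : Hom Y Z) (dp : Hom P Z)
    (d : DepProd f g dp), fib f -> fib g ->
  exists d' : DepProd (fmap F f) (fmap F g) (fmap F dp),
    forall (X : C) (h : Hom X Z) (S : PB g h)
      (HS : IsPullback (fmap F g) (fmap F h) (fmap F (pb_top S)) (fmap F (pb_base S)))
      (m : Hom X P) (e : dp ∘ m = h) (e' : fmap F dp ∘ fmap F m = fmap F h),
      dp_tr d' (fmap F h) (map_pb F S HS) (fmap F m) e' = fmap F (dp_tr d h S m e).

Record IsTTFunctor {C D : FibCat} (F : Functor C D) : Prop := {
  ttf_terminal : forall T : C, IsTerminal T -> IsTerminal (F T);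
  ttf_fib : PreservesFib F;
  ttf_pb : PreservesPBofFib F;
  ttf_ac : PreservesAcyclicCofib F;
  ttf_depprod : PreservesDepProd F
}.

(** * Fibred categories *)

Definition Cartesian {E B : Category} (p : Functor E B) {X Y : E} (f : Hom X Y) : Prop :=
  forall (Z : E) (g : Hom Z Y) (s : Hom (p Z) (p X)), fmap p f ∘ s = fmap p g ->
    exists h : Hom Z X, (f ∘ h = g /\ fmap p h = s) /\
      forall h' : Hom Z X, f ∘ h' = g -> fmap p h' = s -> h' = h.

(* [c : X -> Y] is a cartesian lift of [s : I -> pY]; that is, [X] is [s^*Y]. *)
Definition IsCartLift {E B : Category} (p : Functor E B) {I : B} {X Y : E}
    (s : Hom I (p Y)) (e : p X = I) (c : Hom X Y) : Prop :=
  Cartesian p c /\ fmap p c = s ∘ idto e.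

Definition IsFibredCategory {E B : Category} (p : Functor E B) : Prop :=
  forall (I : B) (Y : E) (s : Hom I (p Y)),
    exists (X : E) (e : p X = I) (c : Hom X Y), IsCartLift p s e c.

Record IsFibredTTFC {E B : TTFC} (p : Functor E B) : Prop := {
  fib_fibred : IsFibredCategory p;
  fib_ttf : IsTTFunctor p;
  fib_cart_fib : forall (X Y : E) (f : Hom X Y),
    Cartesian p f -> fib (fmap p f) -> fib f;
  fib_induced : forall (A C : E) (g : Hom A C) (J : B)
    (s : Hom (p A) J) (t : Hom J (p C)),
    fib g -> fmap p g = t ∘ s -> fib s ->
    forall (D : E) (e : p D = J) (c : Hom D C) (k : Hom A D), IsCartLift p t e c ->
      c ∘ k = g -> idto e ∘ fmap p k = s -> fib k;
  fib_cart_ac : forall (X Y : E) (f : Hom X Y),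
    Cartesian p f -> AcyclicCofib (fmap p f) -> AcyclicCofib f
}.

(** * Change of base *)

Section ChangeOfBase.
Context {A E B : Category} (p : Functor E B) (F : Functor A B).

Record cb_ob : Type := CbOb {
  cb_base : A;
  cb_tot : E;
  cb_eq : p cb_tot = F cb_base
}.

Record cb_hom (X Y : cb_ob) : Type := CbHom {
  cb_fst : Hom (cb_base X) (cb_base Y);
  cb_snd : Hom (cb_tot X) (cb_tot Y);
  cb_above : idto (cb_eq Y) ∘ fmap p cb_snd = fmap F cb_fst ∘ idto (cb_eq X)
}.

Arguments CbHom {X Y} cb_fst cb_snd cb_above.
Arguments cb_fst {X Y} c.
Arguments cb_snd {X Y} c.

Lemma cb_hom_eq (X Y : cb_ob) (f g : cb_hom X Y) :
  cb_fst f = cb_fst g -> cb_snd f = cb_snd g -> f = g.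
Proof.
  destruct f as [f1 f2 f3], g as [g1 g2 g3]; simpl; intros -> ->.
  now rewrite (proof_irrelevance _ f3 g3).
Qed.

Lemma cb_id_above (X : cb_ob) :
  idto (cb_eq X) ∘ fmap p (idm (cb_tot X)) = fmap F (idm (cb_base X)) ∘ idto (cb_eq X).
Proof. now rewrite !fmap_id, comp_id_l, comp_id_r. Qed.

Lemma cb_comp_above (X Y Z : cb_ob) (g : cb_hom Y Z) (f : cb_hom X Y) :
  idto (cb_eq Z) ∘ fmap p (cb_snd g ∘ cb_snd f)
  = fmap F (cb_fst g ∘ cb_fst f) ∘ idto (cb_eq X).
Proof.
  rewrite !fmap_comp, comp_assoc, (cb_above _ _ g), <- comp_assoc, (cb_above _ _ f).
  apply comp_assoc.
Qed.

Definition cb_cat : Category.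
Proof.
  refine {| Ob := cb_ob; Hom := cb_hom;
            idm := fun X => CbHom (idm _) (idm _) (cb_id_above X);
            comp := fun X Y Z g f =>
              CbHom (cb_fst g ∘ cb_fst f) (cb_snd g ∘ cb_snd f)
                    (cb_comp_above X Y Z g f) |};
    intros; apply cb_hom_eq; simpl;
    first [apply comp_id_l | apply comp_id_r | apply comp_assoc].
Defined.

End ChangeOfBase.

Arguments CbOb {A E B p F} cb_base cb_tot cb_eq.
Arguments cb_base {A E B p F} c.
Arguments cb_tot {A E B p F} c.
Arguments cb_eq {A E B p F} c.
Arguments CbHom {A E B p F X Y} cb_fst cb_snd cb_above.
Arguments cb_fst {A E B p F X Y} c.
Arguments cb_snd {A E B p F X Y} c.

Definition ChangeOfBase {A E : FibCat} {B : Category}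
    (p : Functor E B) (F : Functor A B) : FibCat :=
  {| fc_cat := cb_cat p F; fib := fun X Y f => fib (cb_fst f) /\ fib (cb_snd f) |}.

(** * Homotopy and univalence *)

Definition Homotopic {C : FibCat} {A B : C} (f g : Hom A B) : Prop :=
  exists (T : C) (t : Hom B T) (P : PathObject t) (m : Hom A (po_ob P)),
    IsTerminal T /\ po_src P ∘ m = f /\ po_tgt P ∘ m = g.

Definition HomotopyEquiv {C : FibCat} {A B : C} (f : Hom A B) : Prop :=
  exists g : Hom B A, Homotopic (g ∘ f) (idm A) /\ Homotopic (f ∘ g) (idm B).

Section EquivalenceObject.
Context {C : FibCat} {T U : C} {u : Hom T U} (P : PathObject u).

(* The equations on [q_s] and [q_t] are equations between morphisms into the
   fibre product [T ×_U T], stated on its two projections. *)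
Record Quint {X : C} {a b : Hom X U} (Sa : PB u a) (Sb : PB u b) : Type := MkQuint {
  q_f : Hom Sa Sb;
  q_g : Hom Sb Sa;
  q_s : Hom Sa (po_ob P);
  q_h : Hom Sb Sa;
  q_t : Hom Sb (po_ob P);
  q_f_over : pb_base Sb ∘ q_f = pb_base Sa;
  q_g_over : pb_base Sa ∘ q_g = pb_base Sb;
  q_h_over : pb_base Sa ∘ q_h = pb_base Sb;
  q_s_src : po_src P ∘ q_s = pb_top Sa ∘ (q_g ∘ q_f);
  q_s_tgt : po_tgt P ∘ q_s = pb_top Sa;
  q_t_src : po_src P ∘ q_t = pb_top Sb ∘ (q_f ∘ q_h);
  q_t_tgt : po_tgt P ∘ q_t = pb_top Sb
}.

Arguments q_f {X a b Sa Sb} q.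
Arguments q_g {X a b Sa Sb} q.
Arguments q_s {X a b Sa Sb} q.
Arguments q_h {X a b Sa Sb} q.
Arguments q_t {X a b Sa Sb} q.

(* [q'] is the restriction of [q] along [y : X' -> X]; [ka] and [kb] are the
   canonical morphisms between the pullbacks of [u]. *)
Definition IsRestriction {X X' : C} {a b : Hom X U} {a' b' : Hom X' U}
    {Sa : PB u a} {Sb : PB u b} {Sa' : PB u a'} {Sb' : PB u b'}
    (ka : Hom Sa' Sa) (kb : Hom Sb' Sb) (q : Quint Sa Sb) (q' : Quint Sa' Sb') : Prop :=
  kb ∘ q_f q' = q_f q ∘ ka /\
  ka ∘ q_g q' = q_g q ∘ kb /\
  q_s q' = q_s q ∘ ka /\
  ka ∘ q_h q' = q_h q ∘ kb /\
  q_t q' = q_t q ∘ kb.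

(* [E(u) -> U × U] with the natural bijection between morphisms into it over
   [U × U] and quintuples; this determines it up to isomorphism. *)
Record EquivObj : Type := {
  eo_prod : C;
  eo_p0 : Hom eo_prod U;
  eo_p1 : Hom eo_prod U;
  eo_is_prod : IsProduct eo_p0 eo_p1;
  eo_ob : C;
  eo_proj : Hom eo_ob eo_prod;
  eo_fib : fib eo_proj;
  eo_tr : forall {X : C} {a b : Hom X U} (Sa : PB u a) (Sb : PB u b) (m : Hom X eo_ob),
    eo_p0 ∘ (eo_proj ∘ m) = a -> eo_p1 ∘ (eo_proj ∘ m) = b -> Quint Sa Sb;
  eo_inj : forall (X : C) (a b : Hom X U) (Sa : PB u a) (Sb : PB u b)
    (m m' : Hom X eo_ob) (e0 : eo_p0 ∘ (eo_proj ∘ m) = a) (e1 : eo_p1 ∘ (eo_proj ∘ m) = b)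
    (e0' : eo_p0 ∘ (eo_proj ∘ m') = a) (e1' : eo_p1 ∘ (eo_proj ∘ m') = b),
    eo_tr Sa Sb m e0 e1 = eo_tr Sa Sb m' e0' e1' -> m = m';
  eo_surj : forall (X : C) (a b : Hom X U) (Sa : PB u a) (Sb : PB u b) (q : Quint Sa Sb),
    exists (m : Hom X eo_ob) (e0 : eo_p0 ∘ (eo_proj ∘ m) = a)
      (e1 : eo_p1 ∘ (eo_proj ∘ m) = b), eo_tr Sa Sb m e0 e1 = q;
  eo_nat : forall (X X' : C) (y : Hom X' X) (a b : Hom X U) (Sa : PB u a) (Sb : PB u b)
    (Sa' : PB u (a ∘ y)) (Sb' : PB u (b ∘ y)) (ka : Hom Sa' Sa) (kb : Hom Sb' Sb)
    (m : Hom X eo_ob) (e0 : eo_p0 ∘ (eo_proj ∘ m) = a) (e1 : eo_p1 ∘ (eo_proj ∘ m) = b)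
    (e0' : eo_p0 ∘ (eo_proj ∘ (m ∘ y)) = a ∘ y)
    (e1' : eo_p1 ∘ (eo_proj ∘ (m ∘ y)) = b ∘ y),
    IsPBMap y Sa Sa' ka -> IsPBMap y Sb Sb' kb ->
    IsRestriction ka kb (eo_tr Sa Sb m e0 e1) (eo_tr Sa' Sb' (m ∘ y) e0' e1')
}.

(* The identity function, over the diagonal [(1, 1) : U -> U × U]; [T] itself is
   the pullback of [u] along the identity. *)
Definition id_quint : Quint (id_square u) (id_square u).
Proof.
  refine {| q_f := idm T : Hom (id_square u) (id_square u); q_g := idm T;
            q_s := po_refl P : Hom (id_square u) _; q_h := idm T; q_t := po_refl P |};
    simpl; rewrite ?comp_id_l, ?comp_id_r; try reflexivity;
    unfold po_src, po_tgt; rewrite <- comp_assoc;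
    first [apply po_diag0 | apply po_diag1].
Defined.

Definition UnivalentFor : Prop :=
  exists (E : EquivObj) (e : Hom U (eo_ob E))
    (e0 : eo_p0 E ∘ (eo_proj E ∘ e) = idm U) (e1 : eo_p1 E ∘ (eo_proj E ∘ e) = idm U),
    eo_tr E (id_square u) (id_square u) e e0 e1 = id_quint /\ HomotopyEquiv e.

End EquivalenceObject.

Definition UnivalentFibration {C : FibCat} (Q : FixedPaths C) {T U : C} (u : Hom T U) :
    Prop :=
  exists Hu : fib u, UnivalentFor (Q T U u Hu).

(* Univalence of [z] refers to a path object of [z].  Path objects of one fibration
   are only homotopy equivalent, and univalence need not transfer along such an
   equivalence when function extensionality is not assumed, so the path object of a
   morphism [z = (v, _)] of [F^*E] has to be related to those of [v] and [w].
   [R] is induced from [PV] and [PW] if its component in [A] is [PV] up to isomorphism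
   and its component in [E] is a reindexing of [PW]; [c0] is the cartesian morphism
   to the domain of [w]. *)
Definition IsInducedPath {A E : FibCat} {B : Category} {p : Functor E B}
    {F : Functor A B} {V' : A} {X' : E} {eX : p X' = F V'} {Y : cb_ob p F}
    {z : Hom (c := ChangeOfBase p F) (CbOb V' X' eX) Y} (R : PathObject z)
    {V : A} {v : Hom V' V} (PV : PathObject v)
    {W' W : E} {w : Hom W' W} (PW : PathObject w) (c0 : Hom X' W') : Prop :=
  (exists i : Hom (cb_base (po_ob R)) (po_ob PV),
     IsIso i /\
     i ∘ cb_fst (po_refl R) = po_refl PV /\
     po_src PV ∘ i = cb_fst (po_src R) /\
     po_tgt PV ∘ i = cb_fst (po_tgt R)) /\
  (exists c : Hom (cb_tot (po_ob R)) (po_ob PW),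
     Cartesian p c /\
     c ∘ cb_snd (po_refl R) = po_refl PW ∘ c0 /\
     po_src PW ∘ c = c0 ∘ cb_snd (po_src R) /\
     po_tgt PW ∘ c = c0 ∘ cb_snd (po_tgt R)).

(* Main.v *)
From Stdlib Require Import ProofIrrelevance IndefiniteDescription Classical.
From Corelib Require Import ssreflect.
Require Import Defs.

(** The homotopy equivalences [e(v)] and [e(w)] are sections of the fibrations
    [E(v) -> V] and [E(w) -> W], so both of these are fibrewise contractible: factor the section
    as an acyclic cofibration followed by a fibration, and use that a fibration with a
    homotopy section has a section.

    Since [p] preserves dependent products, [p(E(w))] classifies equivalences for [p(w)].  The
    image under [F] of the universal equivalence over [E(v)] is thus classified by some
    [χ : F(E(v)) -> p(E(w))], and [(E(v), χ^*E(w))] classifies the equivalences of the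
    induced fibration: both components of the classifying map are determined, and they match
    because [p(E(w))] has the uniqueness property.

    It remains to contract [(E(v), χ^*E(w))] onto its section.  In the base the contraction of
    [E(v)] serves; its image in [B] generally differs from the image under [p] of the
    contraction of [E(w)].  But any path in [p(E(w))] lifts to a path between
    any two given points of [E(w)] over its endpoints that lie over the same point of [W]
    ([dependent_path]), because the vertical part of [E(w) -> W] is contractible. *)

(** [F^*E] enters only as a category with fibrations, without dependent products of its own, and [F]
    need not preserve those of [A]. So the equivalence object of the induced fibration is not
    computed as an iterated product: it is recognized by a universal quintuple, a generic element
    expressed by commuting diagrams that carries its own pullbacks. In this form the property can be
    moved along functors. An arbitrary [E(w)] is isomorphic to one built from dependent products,
    and this is how preservation by [p] reaches it.

    The vertical part of [q : E(w) -> W] is the map [α] from [E(w)] to the reindexing of [W] along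
    [p(q)]. Its fibres are contractible because the contraction of [q] has an image under [p]: this
    image is a path in the base along which the value of the section is transported into each fibre.
    Transport itself rests on acyclic cofibrations being stable under pullback along fibrations,
    which is where dependent products are used a second time. *)

Set Bullet Behavior "None".

(** * Pullback squares and isomorphisms in a plain category *)

Section CategoryLemmas.
Context {C : Category}.

Lemma comp_pre {X Y Z W : C} {g : Hom Y Z} {f : Hom X Y} {k : Hom X Z} (x : Hom W X) :
  g ∘ f = k -> g ∘ (f ∘ x) = k ∘ x.
Proof. by move=> <-; rewrite comp_assoc. Qed.

Lemma comp_pre3 {X Y Z Z' W : C} {g' : Hom Z Z'} {g : Hom Y Z} {f : Hom X Y}
    {k : Hom X Z'} (x : Hom W X) :
  g' ∘ (g ∘ f) = k -> g' ∘ (g ∘ (f ∘ x)) = k ∘ x.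
Proof. by move=> <-; rewrite !comp_assoc. Qed.

Lemma iso_idm (X : C) : IsIso (idm X).
Proof. by exists (idm X); rewrite comp_id_l. Qed.

Lemma iso_comp {X Y Z : C} (g : Hom Y Z) (f : Hom X Y) :
  IsIso g -> IsIso f -> IsIso (g ∘ f).
Proof.
  move=> [g' [g1 g2]] [f' [f1 f2]]; exists (f' ∘ g'); split; rewrite -!comp_assoc.
  - by rewrite (comp_pre _ g1) comp_id_l.
  - by rewrite (comp_pre _ f2) comp_id_l.
Qed.

Lemma iso_idto {X Y : C} (e : X = Y) : IsIso (idto e).
Proof. by case: _ / e; apply: iso_idm. Qed.

Lemma idto_symK {X Y : C} (e : X = Y) : idto (eq_sym e) ∘ idto e = idm X.
Proof. by case: _ / e; rewrite /= comp_id_l. Qed.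

Lemma idto_Ksym {X Y : C} (e : X = Y) : idto e ∘ idto (eq_sym e) = idm Y.
Proof. by case: _ / e; rewrite /= comp_id_l. Qed.

Lemma pb_comm {T U X S : C} {u : Hom T U} {a : Hom X U} {t : Hom S T} {b : Hom S X} :
  IsPullback u a t b -> u ∘ t = a ∘ b.
Proof. by case. Qed.

Lemma pb_lift {T U X S : C} {u : Hom T U} {a : Hom X U} {t : Hom S T} {b : Hom S X} :
  IsPullback u a t b -> forall {Y : C} (y : Hom Y T) (x : Hom Y X), u ∘ y = a ∘ x ->
  exists m : Hom Y S, t ∘ m = y /\ b ∘ m = x.
Proof. by case=> _ H Y y x /H [m [Hm _]]; exists m. Qed.

Lemma pb_monic {T U X S : C} {u : Hom T U} {a : Hom X U} {t : Hom S T} {b : Hom S X} :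
  IsPullback u a t b -> forall {Y : C} (m m' : Hom Y S),
  t ∘ m = t ∘ m' -> b ∘ m = b ∘ m' -> m = m'.
Proof.
  case=> c H Y m m' e1 e2; case: (H Y (t ∘ m') (b ∘ m')).
  - by rewrite !comp_assoc c.
  - by move=> n [_ Hn]; rewrite (Hn m) // (Hn m').
Qed.

Lemma pb_intro {T U X S : C} (u : Hom T U) (a : Hom X U) (t : Hom S T) (b : Hom S X) :
  u ∘ t = a ∘ b ->
  (forall (Y : C) (m m' : Hom Y S), t ∘ m = t ∘ m' -> b ∘ m = b ∘ m' -> m = m') ->
  (forall (Y : C) (y : Hom Y T) (x : Hom Y X), u ∘ y = a ∘ x ->
    exists m : Hom Y S, t ∘ m = y /\ b ∘ m = x) ->
  IsPullback u a t b.
Proof.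
  move=> c H1 H2; split=> // Y y x /H2 [m [e1 e2]]; exists m; split=> // m' f1 f2.
  by apply: H1; [rewrite f1 e1 | rewrite f2 e2].
Qed.

Lemma pb_sym {T U X S : C} {u : Hom T U} {a : Hom X U} {t : Hom S T} {b : Hom S X} :
  IsPullback u a t b -> IsPullback a u b t.
Proof.
  move=> H; apply: pb_intro.
  - by rewrite (pb_comm H).
  - by move=> Y m m' e1 e2; apply: (pb_monic H).
  - by move=> Y y x e; case: (pb_lift H x y (eq_sym e)) => m [e1 e2]; exists m.
Qed.

Lemma pb_paste {T U X S X' S' : C} {u : Hom T U} {a : Hom X U} {t : Hom S T}
    {b : Hom S X} {c : Hom X' X} {t' : Hom S' S} {b' : Hom S' X'} :
  IsPullback u a t b -> IsPullback b c t' b' -> IsPullback u (a ∘ c) (t ∘ t') b'.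
Proof.
  move=> H1 H2; apply: pb_intro.
  - by rewrite comp_assoc (pb_comm H1) -comp_assoc (pb_comm H2) comp_assoc.
  - move=> Y m m' e1 e2; apply: (pb_monic H2) => //; apply: (pb_monic H1).
    + by rewrite !comp_assoc.
    + by rewrite !comp_assoc (pb_comm H2) -!comp_assoc e2.
  - move=> Y y x e; rewrite -comp_assoc in e.
    case: (pb_lift H1 _ _ e) => n [e1 e2].
    case: (pb_lift H2 _ _ e2) => m [e3 e4]; exists m; split=> //.
    by rewrite -comp_assoc e3.
Qed.

Lemma pb_unpaste {T U X S X' S' : C} {u : Hom T U} {a : Hom X U} {t : Hom S T}
    {b : Hom S X} {c : Hom X' X} {t' : Hom S' S} {b' : Hom S' X'} :
  IsPullback u a t b -> IsPullback u (a ∘ c) (t ∘ t') b' -> b ∘ t' = c ∘ b' ->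
  IsPullback b c t' b'.
Proof.
  move=> H1 H2 e; apply: pb_intro => //.
  - move=> Y m m' e1 e2; apply: (pb_monic H2) => //.
    by rewrite -!comp_assoc e1.
  - move=> Y y x e'.
    case: (pb_lift H2 (t ∘ y) x).
    + by rewrite comp_assoc (pb_comm H1) -!comp_assoc e'.
    + move=> m [e1 e2]; exists m; split=> //; apply: (pb_monic H1).
      * by rewrite comp_assoc.
      * by rewrite comp_assoc e -comp_assoc e2.
Qed.

Lemma pb_of_isos {T U X S : C} (u : Hom T U) (a : Hom X U) (t : Hom S T) (b : Hom S X) :
  IsIso u -> IsIso b -> u ∘ t = a ∘ b -> IsPullback u a t b.
Proof.
  move=> [u' [u1 u2]] [b' [b1 b2]] e; apply: pb_intro => //.
  - move=> Y m m' _ /(f_equal (fun x => b' ∘ x)).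
    by rewrite !comp_assoc b1 !comp_id_l.
  - move=> Y y x e'; exists (b' ∘ x); split; last by rewrite comp_assoc b2 comp_id_l.
    have e2 : t = u' ∘ (a ∘ b) by rewrite -e comp_assoc u1 comp_id_l.
    rewrite e2 -!comp_assoc; rewrite (comp_pre _ b2) comp_id_l -e'.
    by rewrite comp_assoc u1 comp_id_l.
Qed.

Lemma pb_transfer {T U X S S' : C} {u : Hom T U} {a : Hom X U} {t : Hom S T}
    {b : Hom S X} {t' : Hom S' T} {b' : Hom S' X} (k : Hom S' S) :
  IsPullback u a t b -> IsIso k -> t ∘ k = t' -> b ∘ k = b' -> IsPullback u a t' b'.
Proof.
  move=> H [l [e1 e2]] <- <-; apply: pb_intro.
  - by rewrite !comp_assoc (pb_comm H).
  - move=> Y m m' f1 f2; have : k ∘ m = k ∘ m'.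
      by apply: (pb_monic H); rewrite !comp_assoc.
    by move/(f_equal (fun x => l ∘ x)); rewrite !comp_assoc e1 !comp_id_l.
  - move=> Y y x /(pb_lift H) [m [f1 f2]]; exists (l ∘ m).
    by rewrite -!comp_assoc !(comp_pre _ e2) !comp_id_l.
Qed.

Lemma pb_unique_iso {T U X S S' : C} {u : Hom T U} {a : Hom X U} {t : Hom S T}
    {b : Hom S X} {t' : Hom S' T} {b' : Hom S' X} :
  IsPullback u a t b -> IsPullback u a t' b' ->
  exists k : Hom S' S, IsIso k /\ t ∘ k = t' /\ b ∘ k = b'.
Proof.
  move=> H H'.
  case: (pb_lift H _ _ (pb_comm H')) => k [k1 k2].
  case: (pb_lift H' _ _ (pb_comm H)) => l [l1 l2].
  exists k; split=> //; exists l; split.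
  - by apply: (pb_monic H'); rewrite comp_id_r comp_assoc ?l1 ?l2.
  - by apply: (pb_monic H); rewrite comp_id_r comp_assoc ?k1 ?k2.
Qed.

End CategoryLemmas.

Lemma fmap_eq2 {C D : Category} (F : Functor C D) {X Y Z Y' : C} {g : Hom Y Z}
    {f : Hom X Y} {g' : Hom Y' Z} {f' : Hom X Y'} :
  g ∘ f = g' ∘ f' -> fmap F g ∘ fmap F f = fmap F g' ∘ fmap F f'.
Proof. by rewrite -!fmap_comp => ->. Qed.

Lemma fmap_eq1 {C D : Category} (F : Functor C D) {X Y Z : C} {g : Hom Y Z}
    {f : Hom X Y} {k : Hom X Z} : g ∘ f = k -> fmap F g ∘ fmap F f = fmap F k.
Proof. by rewrite -fmap_comp => ->. Qed.

(** * Acyclic cofibrations and homotopies *)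

(* The universal element of a dependent product: [n] is the section over the
   generic point [dp] of which every section over a [Z]-object is a restriction. *)
Definition UDP {C : Category} {A Y Z P S : C} (f : Hom A Y) (g : Hom Y Z) (dp : Hom P Z)
    (st : Hom S Y) (sb : Hom S P) (n : Hom S A) : Prop :=
  IsPullback g dp st sb /\ f ∘ n = st /\
  forall (X S' : C) (x : Hom X Z) (st' : Hom S' Y) (sb' : Hom S' X) (n' : Hom S' A),
    IsPullback g x st' sb' -> f ∘ n' = st' ->
    exists m : Hom X P,
      (dp ∘ m = x /\ exists k : Hom S' S, st ∘ k = st' /\ sb ∘ k = m ∘ sb' /\ n ∘ k = n') /\
      forall m' : Hom X P, dp ∘ m' = x ->
        (exists k : Hom S' S, st ∘ k = st' /\ sb ∘ k = m' ∘ sb' /\ n ∘ k = n') -> m' = m.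

Lemma dp_tr_eq {C : FibCat} {A Y Z P : C} {f : Hom A Y} {g : Hom Y Z} {dp : Hom P Z}
    (d : DepProd f g dp) {X : C} (h : Hom X Z) (S : PB g h) (m m' : Hom X P) e e' :
  m = m' -> dp_tr d h S m e = dp_tr d h S m' e'.
Proof. by move=> E; subst m'; rewrite (proof_irrelevance _ e e'). Qed.

(** Transposing the identity of [P] gives the generic section. By naturality every transpose is a
    restriction of it, so surjectivity and injectivity of the transposition become existence and
    uniqueness of the classifying map. *)
Lemma udp_of_depprod {C : FibCat} {A Y Z P : C} {f : Hom A Y} {g : Hom Y Z}
    {dp : Hom P Z} (d : DepProd f g dp) (S : PB g dp) (e : dp ∘ idm P = dp) :
  UDP f g dp (pb_top S) (pb_base S) (dp_tr d dp S (idm P) e).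
Proof.
  split; [exact: pb_is | split; [exact: dp_over |]].
  move=> X S' x st' sb' n' H Hn; set T := Build_PB _ _ _ _ _ _ S' st' sb' H.
  have key (m : Hom X P) (em : dp ∘ m = x) (k : Hom S' S) :
      pb_top S ∘ k = st' -> pb_base S ∘ k = m ∘ sb' ->
      dp_tr d x T m em = dp_tr d dp S (idm P) e ∘ k.
    move=> k1 k2; subst x; have e' : dp ∘ (idm P ∘ m) = dp ∘ m by rewrite comp_id_l.
    rewrite -(dp_nat _ _ _ d P X m dp S T k (idm P) e e') //.
    by apply: dp_tr_eq; rewrite comp_id_l.
  have [m [em Em]] := dp_surj _ _ _ d X x T n' Hn.
  have ex (m' : Hom X P) : dp ∘ m' = x ->
      exists k : Hom S' S, pb_top S ∘ k = st' /\ pb_base S ∘ k = m' ∘ sb'.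
    by move=> e'; apply: (pb_lift (pb_is S)); rewrite (pb_comm H) -e' comp_assoc.
  exists m; split.
  - split=> //; have [k [k1 k2]] := ex m em; exists k; do 2!split=> //.
    by rewrite -(key m em k k1 k2).
  - move=> m' em' [k [k1 [k2 k3]]].
    by apply: (dp_inj _ _ _ d X x T m' m em' em); rewrite Em (key m' em' k).
Qed.

(** Compatibility of the two transpositions, read at the identity of [P], says that the image of the
    generic section is again the transpose of an identity. *)
Lemma udp_preserved {C D : FibCat} (F : Functor C D) {A Y Z P : C} {f : Hom A Y}
    {g : Hom Y Z} {dp : Hom P Z} (d : DepProd f g dp) (S : PB g dp)
    (e : dp ∘ idm P = dp) :
  IsTTFunctor F -> fib f -> fib g ->
  UDP (fmap F f) (fmap F g) (fmap F dp) (fmap F (pb_top S)) (fmap F (pb_base S))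
      (fmap F (dp_tr d dp S (idm P) e)).
Proof.
  move=> HF Hf Hg; have [d' Hd'] := ttf_depprod _ HF _ _ _ _ _ _ _ d Hf Hg.
  have HS := ttf_pb _ HF _ _ _ _ _ S Hg.
  have e1 : fmap F dp ∘ fmap F (idm P) = fmap F dp by rewrite -fmap_comp comp_id_r.
  have e2 : fmap F dp ∘ idm (F P) = fmap F dp by rewrite comp_id_r.
  rewrite -(Hd' P dp S HS (idm P) e e1).
  have -> : dp_tr d' (fmap F dp) (map_pb F S HS) (fmap F (idm P)) e1
          = dp_tr d' (fmap F dp) (map_pb F S HS) (idm (F P)) e2.
    by apply: dp_tr_eq; rewrite fmap_id.
  exact: (udp_of_depprod d' (map_pb F S HS) e2).
Qed.

(** * The axioms of a type-theoretic fibration category for unbundled squares *)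

Section TTFCLemmas.
Context {C : TTFC}.

Lemma pb_ex {T U X : C} (u : Hom T U) (a : Hom X U) : fib u ->
  exists (S : C) (t : Hom S T) (b : Hom S X), IsPullback u a t b /\ fib b.
Proof.
  move=> Hu; have [S] := tt_pb_exists _ (tt_ax C) _ _ _ u a Hu.
  exists S, (pb_top S), (pb_base S); split; first exact: pb_is.
  exact: (tt_pb_fib _ (tt_ax C)).
Qed.

Lemma pb_fib {T U X S : C} {u : Hom T U} {a : Hom X U} {t : Hom S T} {b : Hom S X} :
  IsPullback u a t b -> fib u -> fib b.
Proof.
  move=> H; exact: (tt_pb_fib _ (tt_ax C) _ _ _ u a (Build_PB _ _ _ _ _ _ S t b H)).
Qed.

Lemma pb_fib' {T U X S : C} {u : Hom T U} {a : Hom X U} {t : Hom S T} {b : Hom S X} :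
  IsPullback u a t b -> fib a -> fib t.
Proof. by move=> /pb_sym; apply: pb_fib. Qed.

Lemma fib_comp {X Y Z : C} (g : Hom Y Z) (f : Hom X Y) : fib g -> fib f -> fib (g ∘ f).
Proof. exact: (tt_fib_comp _ (tt_ax C)). Qed.

Lemma fib_iso {X Y : C} (f : Hom X Y) : IsIso f -> fib f.
Proof. exact: (tt_fib_iso _ (tt_ax C)). Qed.

Lemma fib_to_terminal {X T : C} (f : Hom X T) : IsTerminal T -> fib f.
Proof. exact: (tt_fib_terminal _ (tt_ax C)). Qed.

Lemma terminal_ex : exists T : C, IsTerminal T.
Proof. exact: (tt_terminal _ (tt_ax C)). Qed.

Lemma factor_ex {X Y : C} (f : Hom X Y) :
  exists (Z : C) (i : Hom X Z) (q : Hom Z Y), AcyclicCofib i /\ fib q /\ f = q ∘ i.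
Proof. exact: (tt_factor _ (tt_ax C)). Qed.

End TTFCLemmas.

Section AcyclicCofibrations.
Context {C : FibCat}.

Lemma ac_comp {X Y Z : C} (g : Hom Y Z) (f : Hom X Y) :
  AcyclicCofib g -> AcyclicCofib f -> AcyclicCofib (g ∘ f).
Proof.
  move=> Hg Hf U V q Hq a b e.
  have [l [l1 l2]] := Hf _ _ q Hq a (b ∘ g) (eq_trans e (comp_assoc _ _ _ _ _ _ _ _)).
  have [m [m1 m2]] := Hg _ _ q Hq l b l2.
  by exists m; split=> //; rewrite comp_assoc m1.
Qed.

Lemma ac_iso {X Y : C} (f : Hom X Y) : IsIso f -> AcyclicCofib f.
Proof.
  move=> [g [e1 e2]] U V q Hq a b e; exists (a ∘ g); split.
  - by rewrite -comp_assoc e1 comp_id_r.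
  - by rewrite comp_assoc e -comp_assoc e2 comp_id_r.
Qed.

Lemma po_src_refl {A G : C} {u : Hom A G} (P : PathObject u) :
  po_src P ∘ po_refl P = idm A.
Proof. by rewrite /po_src -comp_assoc po_diag0. Qed.

Lemma po_tgt_refl {A G : C} {u : Hom A G} (P : PathObject u) :
  po_tgt P ∘ po_refl P = idm A.
Proof. by rewrite /po_tgt -comp_assoc po_diag1. Qed.

Lemma po_src_tgt {A G : C} {u : Hom A G} (P : PathObject u) :
  u ∘ po_src P = u ∘ po_tgt P.
Proof. by rewrite /po_src /po_tgt !comp_assoc (pb_comm (pb_is (po_sq P))). Qed.

(** Identity elimination for paths: the constant path on [r] is extended along [i] by filling
    against the boundary fibration. *)
Lemma po_ac_lift {A G X Y : C} {u : Hom A G} (P : PathObject u) (i : Hom X Y)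
    (r : Hom X A) (f g : Hom Y A) : AcyclicCofib i ->
  f ∘ i = r -> g ∘ i = r -> u ∘ f = u ∘ g ->
  exists m : Hom Y (po_ob P), po_src P ∘ m = f /\ po_tgt P ∘ m = g.
Proof.
  move=> Hi e1 e2 e3.
  have [b [b1 b2]] := pb_lift (pb_is (po_sq P)) f g e3.
  case: (Hi _ _ (po_bd P) (po_bd_fib _ P) (po_refl P ∘ r) b).
  - apply: (pb_monic (pb_is (po_sq P))); rewrite ?comp_assoc ?b1 ?b2 -!comp_assoc
      -[X in _ = X](comp_id_l) ?e1 ?e2 ?(comp_pre3 _ (po_diag0 _ P))
      ?(comp_pre3 _ (po_diag1 _ P)) ?comp_id_l //.
  - move=> m [_ m2]; exists m; rewrite /po_src /po_tgt -!comp_assoc m2 //.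
Qed.

End AcyclicCofibrations.

Section TTFCHomotopy.
Context {C : TTFC}.

(** Every object is fibrant, so the identity of [X] extends along [f]. *)
Lemma ac_retraction {X Y : C} (f : Hom X Y) : AcyclicCofib f ->
  exists r : Hom Y X, r ∘ f = idm X.
Proof.
  move=> Hf; have [T HT] := @terminal_ex C.
  have [tX HX] := HT X; have [tY HY] := HT Y.
  have [r [Hr _]] := Hf _ _ tX (fib_to_terminal tX HT) (idm X) tY
    (eq_trans (HX _) (eq_sym (HX _))).
  by exists r.
Qed.

(* The retraction of [g] exhibits [f] as a retract of [g ∘ f]. *)
Lemma ac_cancel {X Y Z : C} (g : Hom Y Z) (f : Hom X Y) :
  AcyclicCofib g -> AcyclicCofib (g ∘ f) -> AcyclicCofib f.
Proof.
  move=> Hg Hgf U V q Hq a b e; have [r Hr] := ac_retraction g Hg.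
  case: (Hgf _ _ q Hq a (b ∘ r)).
  - by rewrite e -comp_assoc (comp_pre _ Hr) comp_id_l.
  - move=> l [l1 l2]; exists (l ∘ g); split; first by rewrite -comp_assoc.
    by rewrite comp_assoc l2 -comp_assoc Hr comp_id_r.
Qed.

(** The functor is quantified after the data, so that one and the same generic section serves in [C]
    and, through its image, in [D]. *)
Lemma udp_ex {A Y Z : C} (f : Hom A Y) (g : Hom Y Z) : fib f -> fib g ->
  exists (P S : C) (dp : Hom P Z) (st : Hom S Y) (sb : Hom S P) (n : Hom S A),
    fib dp /\ UDP f g dp st sb n /\
    forall (D : FibCat) (F : Functor C D), IsTTFunctor F ->
      UDP (fmap F f) (fmap F g) (fmap F dp) (fmap F st) (fmap F sb) (fmap F n).
Proof.
  move=> Hf Hg; have [P [dp [d]]] := tt_depprod _ (tt_ax C) _ _ _ f g Hf Hg.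
  have [S] := tt_pb_exists _ (tt_ax C) _ _ _ g dp Hg.
  have e := comp_id_r _ _ _ dp.
  exists P, S, dp, (pb_top S), (pb_base S), (dp_tr d dp S (idm P) e).
  split; [exact: dp_fib d | split; [exact: udp_of_depprod |]].
  by move=> D F HF; apply: udp_preserved.
Qed.

(** A lifting problem of [i'] against [q] becomes one against the pullback [f] of [q] over [Y']. The
    dependent product along [g] turns this into a lifting problem of [i] against the fibration
    [dp]. *)
Lemma ac_pullback {X Y X' Y' : C} {i : Hom X Y} {g : Hom Y' Y} {i' : Hom X' Y'}
    {g' : Hom X' X} :
  IsPullback g i i' g' -> fib g -> AcyclicCofib i -> AcyclicCofib i'.
Proof.
  move=> HX Hg Hi U V q Hq a b e.
  have [Q [t [f [HQ Hf]]]] := pb_ex q b Hq.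
  have [a' [a1 a2]] := pb_lift HQ a i' e.
  have [P [S [dp [st [sb [n [Hdp [[HS [Hn HU]] _]]]]]]]] := udp_ex f g Hf Hg.
  have [m [[m1 [k [k1 [k2 k3]]]] _]] := HU X X' i i' g' a' HX a2.
  have [l [l1 l2]] := Hi _ _ dp Hdp m (idm Y) (eq_trans m1 (eq_sym (comp_id_l _ _ _ _))).
  have [j [j1 j2]] : exists j : Hom Y' S, st ∘ j = idm Y' /\ sb ∘ j = l ∘ g.
    by apply: (pb_lift HS); rewrite comp_assoc l2 comp_id_l comp_id_r.
  have jk : j ∘ i' = k.
    apply: (pb_monic HS).
    - by rewrite comp_assoc j1 comp_id_l.
    - by rewrite comp_assoc j2 -comp_assoc (pb_comm HX) comp_assoc l1.
  exists (t ∘ (n ∘ j)); split.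
  - by rewrite -!comp_assoc jk k3.
  - by rewrite comp_assoc (pb_comm HQ) -comp_assoc (comp_pre _ Hn) j1 comp_id_r.
Qed.

(* Transport in the fibration [d] along the paths [P] in its base. *)
Lemma transport_ex {N G P NP : C} (d : Hom N G) (i : Hom G P) (s t : Hom P G)
    (top : Hom NP N) (base : Hom NP P) :
  fib d -> AcyclicCofib i -> s ∘ i = idm G -> t ∘ i = idm G ->
  IsPullback d s top base ->
  exists L : Hom NP N, d ∘ L = t ∘ base /\
    forall (X : C) (j : Hom X NP) (x : Hom X N),
      top ∘ j = x -> base ∘ j = i ∘ (d ∘ x) -> L ∘ j = x.
Proof.
  move=> Hd Hi Hs Ht HP.
  have [j [j1 j2]] : exists j : Hom N NP, top ∘ j = idm N /\ base ∘ j = i ∘ d.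
    by apply: (pb_lift HP); rewrite (comp_pre _ Hs) comp_id_l comp_id_r.
  (* [j] attaches the constant path to a point. It is the pullback of [i] along the fibration
     [base], so transport may be prescribed on it. *)
  have Hj : AcyclicCofib j.
    apply: (ac_pullback (g := base) (i := i) (g' := d)) => //; last exact: (pb_fib HP).
    by apply: (pb_unpaste HP) => //; rewrite j1 Hs; apply: id_square_pullback.
  have [L [L1 L2]] : exists L, L ∘ j = idm N /\ d ∘ L = t ∘ base.
    by apply: Hj => //; rewrite -comp_assoc j2 (comp_pre _ Ht) comp_id_l comp_id_r.
  exists L; split=> // X j' x e1 e2.
  suff -> : j' = j ∘ x by rewrite comp_assoc L1 comp_id_l.
  apply: (pb_monic HP).
  - by rewrite e1 (comp_pre _ j1) comp_id_l.
  - by rewrite e2 (comp_pre _ j2) comp_assoc.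
Qed.

(** Transporting [g x] in the fibration [r] along the path from [r (g x)] to [x] makes the section
    strict. *)
Lemma section_of_homotopy {N X : C} (r : Hom N X) (g : Hom X N) :
  fib r -> Homotopic (r ∘ g) (idm X) -> exists s : Hom X N, r ∘ s = idm X.
Proof.
  move=> Hr [T [t [P [m [_ [m1 m2]]]]]].
  have [NP [top [base [HP _]]]] := pb_ex r (po_src P) Hr.
  have [L [L1 _]] := transport_ex r (po_refl P) (po_src P) (po_tgt P) top base Hr
    (po_refl_ac _ P) (po_src_refl P) (po_tgt_refl P) HP.
  have [j [j1 j2]] := pb_lift HP g m (eq_sym m1).
  by exists (L ∘ j); rewrite comp_assoc L1 -comp_assoc j2.
Qed.

(* Factor [s = r ∘ i]; the fibration [r] inherits a homotopy section from [s], hence has a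
   strict one, along which the diagonal filler of [i] against [P] is pulled back. *)
Lemma fibrewise_contraction {X Y : C} (q : Hom X Y) (s : Hom Y X) (k : Hom X Y)
    (P : PathObject q) :
  q ∘ s = idm Y -> Homotopic (s ∘ k) (idm X) ->
  exists K : Hom X (po_ob P), po_src P ∘ K = s ∘ q /\ po_tgt P ∘ K = idm X.
Proof.
  move=> qs Hk; have [N [i [r [Hi [Hr E]]]]] := factor_ex s.
  have [t Ht] : exists t : Hom X N, r ∘ t = idm X.
    by apply: (section_of_homotopy r (i ∘ k) Hr); rewrite comp_assoc -E.
  case: (po_ac_lift P i s (s ∘ (q ∘ r)) r Hi).
  - by rewrite -!comp_assoc -E qs comp_id_r.
  - by rewrite E.
  - by rewrite comp_assoc qs comp_id_l.
  - move=> m [m1 m2]; exists (m ∘ t).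
    by rewrite !comp_assoc m1 m2 -!comp_assoc Ht comp_id_r.
Qed.

End TTFCHomotopy.

(** * Cartesian morphisms *)

Section Cartesian.
Context {E B : Category} {p : Functor E B}.

Lemma cart_lift {X Y : E} {f : Hom X Y} : Cartesian p f ->
  forall {Z : E} (g : Hom Z Y) (s : Hom (p Z) (p X)), fmap p f ∘ s = fmap p g ->
  exists h : Hom Z X, f ∘ h = g /\ fmap p h = s.
Proof. by move=> H Z g s /H [h [e _]]; exists h. Qed.

Lemma cart_monic {X Y : E} {f : Hom X Y} : Cartesian p f ->
  forall {Z : E} (x y : Hom Z X), f ∘ x = f ∘ y -> fmap p x = fmap p y -> x = y.
Proof.
  move=> H Z x y e1 e2; have [h [_ Hh]] := H Z (f ∘ y) (fmap p y) (eq_sym (fmap_comp _ _ _ _ _ _ _ _)).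
  by rewrite (Hh x) // (Hh y).
Qed.

Lemma cart_intro {X Y : E} (f : Hom X Y) :
  (forall (Z : E) (x y : Hom Z X), f ∘ x = f ∘ y -> fmap p x = fmap p y -> x = y) ->
  (forall (Z : E) (g : Hom Z Y) (s : Hom (p Z) (p X)), fmap p f ∘ s = fmap p g ->
    exists h : Hom Z X, f ∘ h = g /\ fmap p h = s) ->
  Cartesian p f.
Proof.
  move=> H1 H2 Z g s /H2 [h [e1 e2]]; exists h; split=> // h' f1 f2.
  by apply: H1; [rewrite f1 e1 | rewrite f2 e2].
Qed.

Lemma cart_idm (X : E) : Cartesian p (idm X).
Proof.
  move=> Z g s; rewrite fmap_id comp_id_l => ->; exists g; rewrite comp_id_l; split=> //.
  by move=> h'; rewrite comp_id_l.
Qed.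

Lemma cart_comp {X Y Z : E} (g : Hom Y Z) (f : Hom X Y) :
  Cartesian p g -> Cartesian p f -> Cartesian p (g ∘ f).
Proof.
  move=> Hg Hf; apply: cart_intro.
  - move=> W x y e1 e2; apply: (cart_monic Hf) => //; apply: (cart_monic Hg).
    + by rewrite !comp_assoc.
    + by rewrite !fmap_comp e2.
  - move=> W k s e; rewrite fmap_comp -comp_assoc in e.
    have [l [l1 l2]] := cart_lift Hg k _ e.
    have [m [m1 m2]] := cart_lift Hf l s (eq_sym l2).
    by exists m; rewrite -comp_assoc m1.
Qed.

Lemma cart_cancel {X Y Z : E} (g : Hom Y Z) (f : Hom X Y) :
  Cartesian p g -> Cartesian p (g ∘ f) -> Cartesian p f.
Proof.
  move=> Hg Hgf; apply: cart_intro.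
  - by move=> W x y e1 e2; apply: (cart_monic Hgf) => //; rewrite -!comp_assoc e1.
  - move=> W k s e.
    have [m [m1 m2]] : exists m, (g ∘ f) ∘ m = g ∘ k /\ fmap p m = s.
      by apply: (cart_lift Hgf); rewrite !fmap_comp -e comp_assoc.
    exists m; split=> //; apply: (cart_monic Hg); first by rewrite comp_assoc.
    by rewrite fmap_comp m2.
Qed.

(** The gap map is found in the base and lifted through [cX]; the remaining equation is tested after
    the cartesian [cY]. *)
Lemma cart_pullback {X Y X0 Y0 : E} {f : Hom X Y} {f0 : Hom X0 Y0} {cX : Hom X X0}
    {cY : Hom Y Y0} :
  Cartesian p cX -> Cartesian p cY -> f0 ∘ cX = cY ∘ f ->
  IsPullback (fmap p f0) (fmap p cY) (fmap p cX) (fmap p f) ->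
  IsPullback f0 cY cX f.
Proof.
  move=> HX HY e HP; apply: pb_intro => //.
  - move=> Z m m' e1 e2; apply: (cart_monic HX) => //; apply: (pb_monic HP).
    + by rewrite -!fmap_comp e1.
    + by rewrite -!fmap_comp e2.
  - move=> Z y x exy.
    have [s [s1 s2]] := pb_lift HP (fmap p y) (fmap p x) (fmap_eq2 p exy).
    have [m [m1 m2]] := cart_lift HX y s s1.
    exists m; split=> //; apply: (cart_monic HY).
    + by rewrite comp_assoc -e -comp_assoc m1.
    + by rewrite fmap_comp m2.
Qed.

End Cartesian.

(** * Fibrations and acyclic cofibrations reindexed along cartesian morphisms *)

Section FibredTTFC.
Context {E B : TTFC} {p : Functor E B} (Hp : IsFibredTTFC p).

Lemma cart_ex {I : B} {Y : E} (s : Hom I (p Y)) :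
  exists (X : E) (c : Hom X Y) (r : Hom (p X) I) (r' : Hom I (p X)),
    Cartesian p c /\ r' ∘ r = idm _ /\ r ∘ r' = idm _ /\ fmap p c = s ∘ r.
Proof.
  have [X [e [c [H1 H2]]]] := fib_fibred _ Hp I Y s.
  exists X, c, (idto e), (idto (eq_sym e)).
  by rewrite idto_symK idto_Ksym.
Qed.

(** The axiom on induced morphisms with [t] taken to be the image of [c], so that no identification
    of objects remains. *)
Lemma fib_vertical_part {A C D : E} (c : Hom D C) (k : Hom A D) :
  Cartesian p c -> fib (c ∘ k) -> fib (fmap p k) -> fib k.
Proof.
  move=> Hc Hck Hk.
  apply: (fib_induced _ Hp A C (c ∘ k) (p D) (fmap p k) (fmap p c) Hck _ Hk D eq_refl c k) => //.
  - by rewrite fmap_comp.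
  - by split=> //=; rewrite comp_id_r.
  - by rewrite /= comp_id_l.
Qed.

Lemma p_fib {X Y : E} (f : Hom X Y) : fib f -> fib (fmap p f).
Proof. exact: (ttf_fib _ (fib_ttf _ Hp)). Qed.

Lemma p_ac {X Y : E} (f : Hom X Y) : AcyclicCofib f -> AcyclicCofib (fmap p f).
Proof. exact: (ttf_ac _ (fib_ttf _ Hp)). Qed.

Lemma p_pb {T U X S : E} {u : Hom T U} {a : Hom X U} {t : Hom S T} {b : Hom S X} :
  fib u -> IsPullback u a t b ->
  IsPullback (fmap p u) (fmap p a) (fmap p t) (fmap p b).
Proof.
  move=> Hu H.
  exact: (ttf_pb _ (fib_ttf _ Hp) _ _ _ u a (Build_PB _ _ _ _ _ _ S t b H)).
Qed.

(** Split [f0] and [f] into a vertical part followed by a cartesian one. The cartesian part [c] lies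
    over a fibration, and the vertical part [k] is a pullback of [k0], which is a fibration by
    [fib_vertical_part]. *)
Lemma cart_fib {X Y X0 Y0 : E} (f : Hom X Y) (f0 : Hom X0 Y0) (cX : Hom X X0)
    (cY : Hom Y Y0) :
  Cartesian p cX -> Cartesian p cY -> f0 ∘ cX = cY ∘ f -> fib f0 -> fib (fmap p f) ->
  fib f.
Proof.
  move=> HX HY e Hf0 Hpf.
  have [D0 [c0 [r0 [r0' [Hc0 [r01 [r02 ec0]]]]]]] := cart_ex (fmap p f0).
  have [k0 [k01 k02]] : exists k0, c0 ∘ k0 = f0 /\ fmap p k0 = r0'.
    by apply: (cart_lift Hc0); rewrite ec0 -comp_assoc r02 comp_id_r.
  have [D [c [r [r' [Hc [r1 [r2 ec]]]]]]] := cart_ex (fmap p f).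
  have [k [k1 k2]] : exists k, c ∘ k = f /\ fmap p k = r'.
    by apply: (cart_lift Hc); rewrite ec -comp_assoc r2 comp_id_r.
  have Ir0' : IsIso r0' by exists r0.
  have Ir' : IsIso r' by exists r.
  have Ir : IsIso r by exists r'.
  have fk0 : fib k0.
    by apply: (fib_vertical_part c0) => //; [rewrite k01 | rewrite k02; apply: fib_iso].
  have fc : fib c.
    by apply: (fib_cart_fib _ Hp) => //; rewrite ec; apply: fib_comp => //; apply: fib_iso.
  have [d [d1 d2]] : exists d, c0 ∘ d = cY ∘ c /\ fmap p d = r0' ∘ (fmap p cX ∘ r).
    apply: (cart_lift Hc0); rewrite ec0 fmap_comp ec -comp_assoc (comp_pre _ r02) comp_id_l.
    by rewrite !comp_assoc (fmap_eq2 p e).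
  have Hd : Cartesian p d.
    by apply: (cart_cancel c0) => //; rewrite d1; apply: cart_comp.
  rewrite -k1; apply: fib_comp => //; apply: (pb_fib (u := k0) (a := d) (t := cX)) => //.
  apply: (cart_pullback (p := p)) => //.
  - apply: (cart_monic Hc0); first by rewrite !comp_assoc k01 d1 -comp_assoc k1.
    by rewrite !fmap_comp k02 d2 k2 -!comp_assoc r2 comp_id_r.
  - apply: pb_of_isos; rewrite ?k02 ?k2 //.
    by rewrite d2 -!comp_assoc r2 comp_id_r.
Qed.

(* Factor the base of the comparison map into an acyclic cofibration and a fibration:
   along the latter acyclic cofibrations are stable under pullback, along the former the
   cartesian morphisms are acyclic cofibrations. *)
Lemma cart_ac {X Y X0 Y0 : E} (f : Hom X Y) (f0 : Hom X0 Y0) (cX : Hom X X0)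
    (cY : Hom Y Y0) :
  Cartesian p cX -> Cartesian p cY -> f0 ∘ cX = cY ∘ f -> AcyclicCofib f0 ->
  AcyclicCofib (fmap p f) -> AcyclicCofib f.
Proof.
  move=> HX HY e Hf0 Hpf.
  have [D0 [c0 [r0 [r0' [Hc0 [r01 [r02 ec0]]]]]]] := cart_ex (fmap p f0).
  have [k0 [k01 k02]] : exists k0, c0 ∘ k0 = f0 /\ fmap p k0 = r0'.
    by apply: (cart_lift Hc0); rewrite ec0 -comp_assoc r02 comp_id_r.
  have [D [c [r [r' [Hc [r1 [r2 ec]]]]]]] := cart_ex (fmap p f).
  have [k [k1 k2]] : exists k, c ∘ k = f /\ fmap p k = r'.
    by apply: (cart_lift Hc); rewrite ec -comp_assoc r2 comp_id_r.
  have Ir0 : IsIso r0 by exists r0'.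
  have Ir0' : IsIso r0' by exists r0.
  have Ir' : IsIso r' by exists r.
  have Ir : IsIso r by exists r'.
  have ack0 : AcyclicCofib k0.
    apply: (ac_cancel c0); last by rewrite k01.
    apply: (fib_cart_ac _ Hp) => //; rewrite ec0; apply: ac_comp; last exact: ac_iso.
    exact: p_ac.
  have acc : AcyclicCofib c.
    by apply: (fib_cart_ac _ Hp) => //; rewrite ec; apply: ac_comp => //; apply: ac_iso.
  have [d [d1 d2]] : exists d, c0 ∘ d = cY ∘ c /\ fmap p d = r0' ∘ (fmap p cX ∘ r).
    apply: (cart_lift Hc0); rewrite ec0 fmap_comp ec -comp_assoc (comp_pre _ r02) comp_id_l.
    by rewrite !comp_assoc (fmap_eq2 p e).
  have Hd : Cartesian p d.
    by apply: (cart_cancel c0) => //; rewrite d1; apply: cart_comp.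
  have edk : k0 ∘ cX = d ∘ k.
    apply: (cart_monic Hc0); first by rewrite !comp_assoc k01 d1 -comp_assoc k1.
    by rewrite !fmap_comp k02 d2 k2 -!comp_assoc r2 comp_id_r.
  have [J [j [q [Hj [Hq ejq]]]]] := factor_ex (fmap p d).
  have [D1 [dq [s [s' [Hdq [s1 [s2 edq]]]]]]] := cart_ex q.
  have Is : IsIso s by exists s'.
  have Is' : IsIso s' by exists s.
  have fdq : fib dq.
    by apply: (fib_cart_fib _ Hp) => //; rewrite edq; apply: fib_comp => //; apply: fib_iso.
  have [dj [dj1 dj2]] : exists dj, dq ∘ dj = d /\ fmap p dj = s' ∘ j.
    by apply: (cart_lift Hdq); rewrite edq -comp_assoc (comp_pre _ s2) comp_id_l.
  have Hdj : Cartesian p dj by apply: (cart_cancel dq) => //; rewrite dj1.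
  have acdj : AcyclicCofib dj.
    by apply: (fib_cart_ac _ Hp) => //; rewrite dj2; apply: ac_comp => //; apply: ac_iso.
  have [X1 [x1 [v [v' [Hx1 [v1 [v2 ex1]]]]]]] := cart_ex (r0 ∘ fmap p dq).
  have Iv : IsIso v by exists v'.
  have [k3 [k31 k32]] : exists k3, dq ∘ k3 = k0 ∘ x1 /\ fmap p k3 = v.
    by apply: (cart_lift Hdq); rewrite fmap_comp k02 ex1 -comp_assoc (comp_pre _ r01) comp_id_l.
  have PB1 : IsPullback k0 dq x1 k3.
    apply: (cart_pullback (p := p)) => //; apply: pb_of_isos; rewrite ?k02 ?k32 //.
    by rewrite ex1 -comp_assoc (comp_pre _ r01) comp_id_l.
  have ack3 : AcyclicCofib k3 by apply: (ac_pullback (pb_sym PB1)).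
  have [x2 [x21 x22]] : exists x2, x1 ∘ x2 = cX /\ k3 ∘ x2 = dj ∘ k.
    by apply: (pb_lift PB1); rewrite edk comp_assoc dj1.
  have Hx2 : Cartesian p x2 by apply: (cart_cancel x1) => //; rewrite x21.
  have acx2 : AcyclicCofib x2.
    apply: (fib_cart_ac _ Hp) => //.
    have -> : fmap p x2 = v' ∘ (fmap p dj ∘ fmap p k).
      by rewrite -(fmap_eq2 p x22) k32 comp_assoc v1 comp_id_l.
    apply: ac_comp; first by apply: ac_iso; exists v.
    by apply: ac_comp; [apply: p_ac | rewrite k2; apply: ac_iso].
  (* [dj ∘ k] equals [k3 ∘ x2], a composite of acyclic cofibrations, and [dj] is one, so it can be
     cancelled. *)
  rewrite -k1; apply: ac_comp => //; apply: (ac_cancel dj) => //.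
  by rewrite -x22; apply: ac_comp.
Qed.

End FibredTTFC.

(** * Change of base *)

Lemma cart_iso {E B : Category} {p : Functor E B} {X Y : E} (f : Hom X Y) :
  Cartesian p f -> IsIso (fmap p f) -> IsIso f.
Proof.
  move=> Hf [g [g1 g2]].
  have [h [h1 h2]] := cart_lift Hf (idm Y) g (eq_trans g2 (eq_sym (fmap_id _ _ _ _))).
  exists h; split=> //; apply: (cart_monic Hf).
  - by rewrite comp_assoc h1 comp_id_l comp_id_r.
  - by rewrite fmap_comp h2 g1 fmap_id.
Qed.

(* The morphism of [B] over which [y] lies, with domain [pX] replaced by [FI];
   locked, so that rewriting with laws of composition does not unfold it. *)
Definition chi {A E B : Category} {p : Functor E B} {F : Functor A B} {O : cb_ob p F}
    {Y : E} (y : Hom (cb_tot O) Y) : Hom (F (cb_base O)) (p Y) :=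
  locked (fmap p y ∘ idto (eq_sym (cb_eq O))).

Section ChangeOfBaseLemmas.
Context {A E B : TTFC} {p : Functor E B} (Hp : IsFibredTTFC p) {F : Functor A B}.

Local Notation D := (ChangeOfBase p F).

Lemma chiE {O : cb_ob p F} {Y : E} (y : Hom (cb_tot O) Y) :
  chi y = fmap p y ∘ idto (eq_sym (cb_eq O)).
Proof. by rewrite /chi -lock. Qed.

Lemma chi_post {O : cb_ob p F} {Y Y' : E} (g : Hom Y Y') (y : Hom (cb_tot O) Y) :
  chi (g ∘ y) = fmap p g ∘ chi y.
Proof. by rewrite !chiE fmap_comp comp_assoc. Qed.

Lemma chi_pre {O O' : D} {Y : E} (y : Hom (cb_tot O) Y) (m : Hom O' O) :
  chi (y ∘ cb_snd m) = chi y ∘ fmap F (cb_fst m).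
Proof.
  rewrite !chiE fmap_comp -!comp_assoc; congr (_ ∘ _).
  have H := cb_above _ _ _ _ m.
  have -> : fmap p (cb_snd m) = idto (eq_sym (cb_eq O)) ∘ (fmap F (cb_fst m) ∘ idto (cb_eq O')).
    by rewrite -H comp_assoc idto_symK comp_id_l.
  by rewrite -!comp_assoc idto_Ksym comp_id_r.
Qed.

Lemma fmap_chi {O : cb_ob p F} {Y : E} (y : Hom (cb_tot O) Y) :
  fmap p y = chi y ∘ idto (cb_eq O).
Proof. by rewrite !chiE -comp_assoc idto_symK comp_id_r. Qed.

Lemma chi_inj {O : cb_ob p F} {Y : E} (y y' : Hom (cb_tot O) Y) :
  chi y = chi y' -> fmap p y = fmap p y'.
Proof. by rewrite !fmap_chi => ->. Qed.

Lemma cb_mk {O O' : D} (s : Hom (cb_base O') (cb_base O)) (y : Hom (cb_tot O') (cb_tot O)) :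
  chi (idm _) ∘ fmap F s = chi y -> exists m : Hom O' O, cb_fst m = s /\ cb_snd m = y.
Proof.
  move=> H.
  have H' : idto (cb_eq O) ∘ fmap p y = fmap F s ∘ idto (cb_eq O').
    rewrite fmap_chi -H !chiE fmap_id comp_id_l -!comp_assoc (comp_pre _ (idto_Ksym _)).
    by rewrite comp_id_l.
  by exists (CbHom s y H').
Qed.

(** A cartesian [c] exhibits [O] as the reindexing of [Y] along [chi c]: a morphism into [O] amounts
    to one into its base and one into [Y] that agree in [B]. Together with [cb_monic] this is the
    working description of [F^*E]. *)
Lemma cb_lift {O O' : D} {Y : E} {c : Hom (cb_tot O) Y} (s : Hom (cb_base O') (cb_base O))
    (y : Hom (cb_tot O') Y) : Cartesian p c -> chi c ∘ fmap F s = chi y ->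
  exists m : Hom O' O, cb_fst m = s /\ c ∘ cb_snd m = y.
Proof.
  move=> Hc H.
  have [l [l1 l2]] : exists l, c ∘ l = y /\
      fmap p l = idto (eq_sym (cb_eq O)) ∘ (fmap F s ∘ idto (cb_eq O')).
    apply: (cart_lift Hc); rewrite fmap_chi.
    by rewrite -!comp_assoc (comp_pre _ (idto_Ksym _)) comp_id_l comp_assoc H -fmap_chi.
  have [m [m1 m2]] : exists m : Hom O' O, cb_fst m = s /\ cb_snd m = l.
    apply: cb_mk; rewrite !chiE l2 fmap_id comp_id_l -!comp_assoc.
    by rewrite idto_Ksym comp_id_r.
  by exists m; rewrite m2.
Qed.

Lemma cb_monic {O O' : D} {Y : E} {c : Hom (cb_tot O) Y} (m m' : Hom O' O) :
  Cartesian p c -> cb_fst m = cb_fst m' -> c ∘ cb_snd m = c ∘ cb_snd m' -> m = m'.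
Proof.
  move=> Hc e1 e2; apply: cb_hom_eq => //; apply: (cart_monic Hc) => //.
  apply: chi_inj; rewrite -(comp_id_l _ _ _ (cb_snd m)) -(comp_id_l _ _ _ (cb_snd m')).
  by rewrite !chi_pre e1.
Qed.

Lemma cb_ex (I : A) {Y : E} (s : Hom (F I) (p Y)) :
  exists (X : E) (e : p X = F I) (c : Hom X Y),
    Cartesian p c /\ chi (O := CbOb I X e) c = s.
Proof.
  have [X [e [c [H1 H2]]]] := fib_fibred _ Hp _ _ s; exists X, e, c; split=> //.
  by rewrite !chiE /= H2 -comp_assoc idto_Ksym comp_id_r.
Qed.

Lemma iso_chi {O : cb_ob p F} {Y : E} (y : Hom (cb_tot O) Y) :
  IsIso (chi y) -> IsIso (fmap p y).
Proof. by move=> H; rewrite fmap_chi; apply: iso_comp => //; apply: iso_idto. Qed.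

Lemma p_snd {O O' : D} (m : Hom O' O) :
  fmap p (cb_snd m) = idto (eq_sym (cb_eq O)) ∘ (fmap F (cb_fst m) ∘ idto (cb_eq O')).
Proof.
  by rewrite -(cb_above _ _ _ _ m) comp_assoc idto_symK comp_id_l.
Qed.

Lemma p_snd_fib {O O' : D} (m : Hom O' O) :
  fib (fmap F (cb_fst m)) -> fib (fmap p (cb_snd m)).
Proof.
  move=> H; rewrite p_snd; apply: fib_comp; first by apply: fib_iso; apply: iso_idto.
  by apply: fib_comp => //; apply: fib_iso; apply: iso_idto.
Qed.

Lemma p_snd_ac {O O' : D} (m : Hom O' O) :
  AcyclicCofib (fmap F (cb_fst m)) -> AcyclicCofib (fmap p (cb_snd m)).
Proof.
  move=> H; rewrite p_snd; apply: ac_comp; first by apply: ac_iso; apply: iso_idto.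
  by apply: ac_comp => //; apply: ac_iso; apply: iso_idto.
Qed.

(** The base filler [l1] is found independently, and the total filler must lie above it. This is
    forced by lifting against the vertical part [k] of [cb_snd q], with a bottom map [b] that
    already records [F l1]. *)
Lemma cb_ac {O O' : D} (m : Hom O' O) :
  AcyclicCofib (cb_fst m) -> AcyclicCofib (cb_snd m) -> AcyclicCofib m.
Proof.
  move=> H1 H2 X Y q [Hq1 Hq2] f g e.
  have e1 : cb_fst q ∘ cb_fst f = cb_fst g ∘ cb_fst m := f_equal cb_fst e.
  have e2 : cb_snd q ∘ cb_snd f = cb_snd g ∘ cb_snd m := f_equal cb_snd e.
  have [l1 [l11 l12]] := H1 _ _ _ Hq1 _ _ e1.
  have [Z [c [r [r' [Hc [r1 [r2 ec]]]]]]] := cart_ex Hp (fmap p (cb_snd q)).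
  have [k [k1 k2]] : exists k, c ∘ k = cb_snd q /\ fmap p k = r'.
    by apply: (cart_lift Hc); rewrite ec -comp_assoc r2 comp_id_r.
  have Ir' : IsIso r' by exists r.
  have Hk : fib k.
    by apply: (fib_vertical_part Hp c) => //; [rewrite k1 | rewrite k2; apply: fib_iso].
  set b' := idto (eq_sym (cb_eq X)) ∘ (fmap F l1 ∘ idto (cb_eq O)).
  have [b [b1 b2]] : exists b, c ∘ b = cb_snd g /\ fmap p b = r' ∘ b'.
    apply: (cart_lift Hc); rewrite ec -comp_assoc (comp_pre _ r2) comp_id_l /b' !p_snd.
    rewrite -!comp_assoc (comp_pre _ (idto_Ksym _)) comp_id_l.
    by rewrite (comp_pre _ (fmap_eq1 F l12)).
  have [l2 [l21 l22]] : exists l2, l2 ∘ cb_snd m = cb_snd f /\ k ∘ l2 = b.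
    apply: H2 => //; apply: (cart_monic Hc).
    - by rewrite !comp_assoc k1 b1.
    - rewrite !fmap_comp k2 b2 /b' !p_snd -!comp_assoc (comp_pre _ (idto_Ksym _)) comp_id_l.
      by rewrite (comp_pre _ (fmap_eq1 F l11)).
  have [l [f1 f2]] : exists l : Hom O X, cb_fst l = l1 /\ cb_snd l = l2.
    apply: cb_mk; rewrite !chiE.
    have -> : fmap p l2 = b'.
      by rewrite -(comp_id_l _ _ _ b') -r2 -comp_assoc -b2 -l22 fmap_comp k2 comp_assoc r2 comp_id_l.
    by rewrite /b' fmap_id comp_id_l -!comp_assoc idto_Ksym comp_id_r.
  exists l; split; apply: cb_hom_eq => /=; rewrite ?f1 ?f2 //.
  by rewrite -k1 -comp_assoc l22.
Qed.

(** [F] need not send a terminal object to one, so the total object is the terminal object of [E]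
    reindexed along [F 1 -> p 1]. *)
Lemma cb_terminal_ex (HFfib : PreservesFib F) :
  exists T : D, IsTerminal T /\ forall (X : D) (f : Hom X T), fib f.
Proof.
  have [T1 HT1] := @terminal_ex A; have [T2 HT2] := @terminal_ex E.
  have HpT := ttf_terminal _ (fib_ttf _ Hp) _ HT2.
  have [s _] := HpT (F T1).
  have [X [e [c [Hc ec]]]] := cb_ex T1 s.
  exists (CbOb T1 X e); split.
  - move=> O; have [m1 Hm1] := HT1 (cb_base O); have [m2 Hm2] := HT2 (cb_tot O).
    have [m [f1 f2]] : exists m : Hom O (CbOb T1 X e), cb_fst m = m1 /\ c ∘ cb_snd m = m2.
      apply: cb_lift => //.
      by have [t Ht] := HpT (F (cb_base O)); rewrite (Ht (chi m2)) (Ht (_ ∘ _)).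
    exists m => g; apply: (cb_monic (O := CbOb T1 X e) _ _ Hc); first by rewrite (Hm1 (cb_fst g)) f1.
    by rewrite f2 (Hm2 (_ ∘ _)).
  - move=> O f; split; first exact: fib_to_terminal.
    apply: (fib_vertical_part Hp c) => //; first exact: fib_to_terminal.
    by apply: (p_snd_fib f); apply: HFfib; apply: fib_to_terminal.
Qed.

(** * Pullbacks and path objects in the change of base *)

Section Pullbacks.
Context {X Y X' : D} (u : Hom X Y) (a : Hom X' Y) {X0 Y0 X0' : E} (u0 : Hom X0 Y0)
  (a0 : Hom X0' Y0) (cX : Hom (cb_tot X) X0) (cY : Hom (cb_tot Y) Y0)
  (cX' : Hom (cb_tot X') X0').
Context (HcX : Cartesian p cX) (HcY : Cartesian p cY) (HcX' : Cartesian p cX').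
Context (eu : u0 ∘ cX = cY ∘ cb_snd u) (ea : a0 ∘ cX' = cY ∘ cb_snd a).

(** A pullback in [A] and one in [E], linked by cartesian morphisms at the four corners, assemble to
    one in [F^*E]. That [p] preserves the second makes the two gap maps agree in [B]. *)
Lemma cb_pullback {S : D} {t : Hom S X} {b : Hom S X'} {S0 : E} {t0 : Hom S0 X0}
    {b0 : Hom S0 X0'} (cS : Hom (cb_tot S) S0) :
  Cartesian p cS -> t0 ∘ cS = cX ∘ cb_snd t -> b0 ∘ cS = cX' ∘ cb_snd b ->
  IsPullback (cb_fst u) (cb_fst a) (cb_fst t) (cb_fst b) ->
  IsPullback u0 a0 t0 b0 ->
  IsPullback (fmap p u0) (fmap p a0) (fmap p t0) (fmap p b0) ->
  IsPullback u a t b.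
Proof.
  move=> HcS et eb H1 H2 H3; apply: pb_intro.
  - apply: (cb_monic _ _ HcY); first exact: (pb_comm H1).
    rewrite /= !comp_assoc -eu -ea -!comp_assoc -et -eb !comp_assoc.
    by rewrite (pb_comm H2).
  - move=> Z m m' e1 e2; apply: (cb_monic _ _ HcS).
    + apply: (pb_monic H1); [exact: (f_equal cb_fst e1) | exact: (f_equal cb_fst e2)].
    + apply: (pb_monic H2).
      * by rewrite !comp_assoc et -!comp_assoc; congr (_ ∘ _); exact: (f_equal cb_snd e1).
      * by rewrite !comp_assoc eb -!comp_assoc; congr (_ ∘ _); exact: (f_equal cb_snd e2).
  - move=> Z y x e.
    have [m1 [m11 m12]] := pb_lift H1 _ _ (f_equal cb_fst e : cb_fst u ∘ _ = cb_fst a ∘ _).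
    have e2 : cb_snd u ∘ cb_snd y = cb_snd a ∘ cb_snd x := f_equal cb_snd e.
    have [m2 [m21 m22]] : exists m2, t0 ∘ m2 = cX ∘ cb_snd y /\ b0 ∘ m2 = cX' ∘ cb_snd x.
      by apply: (pb_lift H2); rewrite !comp_assoc eu ea -!comp_assoc e2.
    have [m [f1 f2]] : exists m : Hom Z S, cb_fst m = m1 /\ cS ∘ cb_snd m = m2.
      apply: cb_lift => //; apply: (pb_monic H3); rewrite !comp_assoc -!chi_post.
      + by rewrite et m21 !chi_pre -comp_assoc -fmap_comp m11.
      + by rewrite eb m22 !chi_pre -comp_assoc -fmap_comp m12.
    exists m; split.
    + apply: (cb_monic _ _ HcX); first by rewrite /= f1.
      by rewrite /= comp_assoc -et -comp_assoc f2.
    + apply: (cb_monic _ _ HcX'); first by rewrite /= f1.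
      by rewrite /= comp_assoc -eb -comp_assoc f2.
Qed.

Lemma cb_pullback_ex {S1 : A} {t1 : Hom S1 (cb_base X)} {b1 : Hom S1 (cb_base X')}
    {S0 : E} {t0 : Hom S0 X0} {b0 : Hom S0 X0'} :
  fib u0 ->
  IsPullback (cb_fst u) (cb_fst a) t1 b1 ->
  IsPullback u0 a0 t0 b0 ->
  exists (S2 : E) (e : p S2 = F S1) (t : Hom (c := D) (CbOb S1 S2 e) X)
    (b : Hom (c := D) (CbOb S1 S2 e) X') (cS : Hom S2 S0),
    (cb_fst t = t1 /\ cb_fst b = b1) /\
    (Cartesian p cS /\ t0 ∘ cS = cX ∘ cb_snd t /\ b0 ∘ cS = cX' ∘ cb_snd b) /\
    IsPullback u a t b.
Proof.
  move=> Hu0 H1 H2; have H3 := p_pb Hp Hu0 H2.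
  have [s [s1 s2]] : exists s, fmap p t0 ∘ s = chi cX ∘ fmap F t1 /\
      fmap p b0 ∘ s = chi cX' ∘ fmap F b1.
    apply: (pb_lift H3); rewrite !comp_assoc -!chi_post eu ea !chi_pre -!comp_assoc.
    by rewrite -!fmap_comp (pb_comm H1).
  have [S2 [e [cS [HcS ecS]]]] := cb_ex S1 s.
  have [t [et1 et2]] : exists t : Hom (c := D) (CbOb S1 S2 e) X,
      cb_fst t = t1 /\ cX ∘ cb_snd t = t0 ∘ cS.
    by apply: cb_lift => //; rewrite chi_post ecS s1.
  have [b [eb1 eb2]] : exists b : Hom (c := D) (CbOb S1 S2 e) X',
      cb_fst b = b1 /\ cX' ∘ cb_snd b = b0 ∘ cS.
    by apply: cb_lift => //; rewrite chi_post ecS s2.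
  exists S2, e, t, b, cS; do 2!split=> //.
  by apply: (cb_pullback (S := CbOb S1 S2 e) cS (t0 := t0) (b0 := b0)); rewrite ?et1 ?eb1.
Qed.

End Pullbacks.

(** By uniqueness of pullbacks it suffices to treat the one assembled from pullbacks in [A] and [E].
    Its total object is the reindexing of [S0] along a comparison of two pullbacks of the same
    cospan in [B], hence along an isomorphism. *)
Lemma cb_pullback_components (HFpb : PreservesPBofFib F) {X Y X' S : D} {u : Hom X Y}
    {a : Hom X' Y} {t : Hom S X} {b : Hom S X'} :
  fib u -> IsPullback u a t b ->
  IsPullback (cb_fst u) (cb_fst a) (cb_fst t) (cb_fst b) /\
  IsPullback (cb_snd u) (cb_snd a) (cb_snd t) (cb_snd b).
Proof.
  move=> [Hu1 Hu2] HS.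
  have [S1 [t1 [b1 [H1 _]]]] := pb_ex _ (cb_fst a) Hu1.
  have [S0 [t0 [b0 [H2 _]]]] := pb_ex _ (cb_snd a) Hu2.
  have [S2 [e [t' [b' [cS [[et' eb'] [[HcS [f1 f2]] HS']]]]]]] :=
    cb_pullback_ex u a (cb_snd u) (cb_snd a) (idm _) (idm _) (idm _)
      (cart_idm _) (cart_idm _) (cart_idm _)
      (eq_trans (comp_id_r _ _ _ _) (eq_sym (comp_id_l _ _ _ _)))
      (eq_trans (comp_id_r _ _ _ _) (eq_sym (comp_id_l _ _ _ _))) Hu2 H1 H2.
  rewrite !comp_id_l in f1 f2; set S' := CbOb S1 S2 e in t' b' et' eb' f1 f2 HS'.
  have H3 := p_pb Hp Hu2 H2.
  have H4 : IsPullback (fmap F (cb_fst u)) (fmap F (cb_fst a)) (fmap F t1) (fmap F b1).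
    exact: (HFpb _ _ _ _ _ (Build_PB _ _ _ _ _ _ S1 t1 b1 H1) Hu1).
  have Hiso : IsIso (chi (O := S') cS).
    have [l [l1 l2]] : exists l, fmap F t1 ∘ l = idto (cb_eq X) ∘ fmap p t0 /\
        fmap F b1 ∘ l = idto (cb_eq X') ∘ fmap p b0.
      apply: (pb_lift H4); rewrite !comp_assoc -!(cb_above _ _ _ _ _) -!comp_assoc.
      by rewrite (pb_comm H3).
    have g1 : fmap p t0 ∘ chi (O := S') cS = idto (eq_sym (cb_eq X)) ∘ fmap F t1.
      rewrite -chi_post f1 -(comp_id_l _ _ _ (cb_snd t')) chi_pre et' !chiE fmap_id comp_id_l //.
    have g2 : fmap p b0 ∘ chi (O := S') cS = idto (eq_sym (cb_eq X')) ∘ fmap F b1.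
      rewrite -chi_post f2 -(comp_id_l _ _ _ (cb_snd b')) chi_pre eb' !chiE fmap_id comp_id_l //.
    exists l; split.
    - apply: (pb_monic H4); rewrite comp_assoc ?l1 ?l2 -comp_assoc ?g1 ?g2.
      + by rewrite comp_assoc idto_Ksym comp_id_l comp_id_r.
      + by rewrite comp_assoc idto_Ksym comp_id_l comp_id_r.
    - apply: (pb_monic H3); rewrite comp_assoc ?g1 ?g2 -comp_assoc ?l1 ?l2.
      + by rewrite comp_assoc idto_symK comp_id_l comp_id_r.
      + by rewrite comp_assoc idto_symK comp_id_l comp_id_r.
  have Hc : IsIso cS := cart_iso cS HcS (iso_chi (O := S') cS Hiso).
  have [k [[k' [k1 k2]] [kt kb]]] := pb_unique_iso HS' HS.
  have Ik : IsIso (cb_fst k) by exists (cb_fst k'); split; [exact: (f_equal cb_fst k1) | exact: (f_equal cb_fst k2)].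
  have Ik2 : IsIso (cb_snd k) by exists (cb_snd k'); split; [exact: (f_equal cb_snd k1) | exact: (f_equal cb_snd k2)].
  split.
  - apply: (pb_transfer (cb_fst k) H1 Ik).
    + by rewrite -et'; exact: (f_equal cb_fst kt).
    + by rewrite -eb'; exact: (f_equal cb_fst kb).
  - apply: (pb_transfer (cS ∘ cb_snd k) H2); first exact: iso_comp.
    + by rewrite comp_assoc f1; exact: (f_equal cb_snd kt).
    + by rewrite comp_assoc f2; exact: (f_equal cb_snd kb).
Qed.

(* The total part of the path object is a reindexing of [PW] along a diagonal filler of
   [F(po_refl PV)] against the fibration [p(po_bd PW)]. *)
Lemma induced_path_ex (HFac : PreservesAcyclicCofib F) (HFfib : PreservesFib F)
    {V' : A} {X' : E} {eX : p X' = F V'} {Y : D}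
    (z : Hom (c := D) (CbOb V' X' eX) Y) (PV : PathObject (cb_fst z)) {W' W : E}
    {w : Hom W' W} (PW : PathObject w) (c0 : Hom X' W') (c1 : Hom (cb_tot Y) W) :
  Cartesian p c0 -> Cartesian p c1 -> w ∘ c0 = c1 ∘ cb_snd z ->
  fib (cb_fst z) -> fib w ->
  exists R : PathObject z, IsInducedPath R PV PW c0.
Proof.
  move=> H0 H1 ez Hv Hw; set X : D := CbOb V' X' eX in z PV ez Hv *.
  have [S2 [e [t [b [cS [[et eb] [[HcS [f1 f2]] HS]]]]]]] :=
    cb_pullback_ex z z w w c0 c1 c0 H0 H1 H0 ez ez Hw (pb_is (po_sq PV)) (pb_is (po_sq PW)).
  set S : D := CbOb _ S2 e in t b et eb f1 f2 HS.
  have H3 := p_pb Hp Hw (pb_is (po_sq PW)).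
  have [th [th1 th2]] : exists th : Hom (F (po_ob PV)) (p (po_ob PW)),
      th ∘ fmap F (po_refl PV) = fmap p (po_refl PW) ∘ chi (O := X) c0 /\
      fmap p (po_bd PW) ∘ th = chi (O := S) cS ∘ fmap F (po_bd PV).
    apply: (HFac _ _ _ (po_refl_ac _ PV)); first exact: (p_fib Hp _ (po_bd_fib _ PW)).
    apply: (pb_monic H3).
    - rewrite -comp_assoc !comp_assoc -chi_post f1 chi_pre et -!comp_assoc -!fmap_comp.
      rewrite (po_diag0 _ PV) fmap_id comp_id_r !comp_assoc -!fmap_comp -!comp_assoc.
      by rewrite (po_diag0 _ PW) fmap_id comp_id_l.
    - rewrite -comp_assoc !comp_assoc -chi_post f2 chi_pre eb -!comp_assoc -!fmap_comp.
      rewrite (po_diag1 _ PV) fmap_id comp_id_r !comp_assoc -!fmap_comp -!comp_assoc.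
      by rewrite (po_diag1 _ PW) fmap_id comp_id_l.
  have [R2 [eR [cR [HcR ecR]]]] := cb_ex (po_ob PV) th.
  set R : D := CbOb _ R2 eR in ecR.
  have [rf [rf1 rf2]] : exists rf : Hom X R,
      cb_fst rf = po_refl PV /\ cR ∘ cb_snd rf = po_refl PW ∘ c0.
    by apply: cb_lift => //; rewrite ecR th1 chi_post.
  have [bd [bd1 bd2]] : exists bd : Hom R S,
      cb_fst bd = po_bd PV /\ cS ∘ cb_snd bd = po_bd PW ∘ cR.
    by apply: cb_lift => //; rewrite chi_post ecR th2.
  have g1 : t ∘ (bd ∘ rf) = idm X.
    apply: (cb_monic (O := X) _ _ H0) => /=; first by rewrite et bd1 rf1 (po_diag0 _ PV).
    rewrite comp_assoc -f1 -!comp_assoc (comp_pre _ bd2) -comp_assoc rf2.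
    by rewrite (comp_pre3 _ (po_diag0 _ PW)) comp_id_l comp_id_r.
  have g2 : b ∘ (bd ∘ rf) = idm X.
    apply: (cb_monic (O := X) _ _ H0) => /=; first by rewrite eb bd1 rf1 (po_diag1 _ PV).
    rewrite comp_assoc -f2 -!comp_assoc (comp_pre _ bd2) -comp_assoc rf2.
    by rewrite (comp_pre3 _ (po_diag1 _ PW)) comp_id_l comp_id_r.
  have Hrf : AcyclicCofib rf.
    apply: cb_ac; first by rewrite rf1; exact: po_refl_ac.
    apply: (cart_ac Hp _ (po_refl PW) c0 cR) => //; first exact: po_refl_ac.
    by apply: (p_snd_ac rf); rewrite rf1; apply: HFac; exact: po_refl_ac.
  have Hbd : fib bd.
    split; first by rewrite bd1; exact: po_bd_fib.
    apply: (cart_fib Hp _ (po_bd PW) cR cS) => //; first exact: po_bd_fib.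
    by apply: (p_snd_fib bd); rewrite bd1; apply: HFfib; exact: po_bd_fib.
  exists {| po_sq := Build_PB _ _ _ _ _ _ S t b HS; po_ob := R; po_refl := rf; po_bd := bd;
            po_refl_ac := Hrf; po_bd_fib := Hbd; po_diag0 := g1; po_diag1 := g2 |}.
  rewrite /IsInducedPath /po_src /po_tgt /=; split.
  - exists (idm (po_ob PV)); rewrite rf1 bd1 et eb !comp_id_l !comp_id_r.
    by split; first exact: iso_idm.
  - exists cR; rewrite !comp_assoc -f1 -f2 -!comp_assoc bd2; split=> //.
Qed.

Lemma cb_path_ex (HFac : PreservesAcyclicCofib F) (HFfib : PreservesFib F) {X Y : D}
    (z : Hom X Y) : fib z -> inhabited (PathObject z).
Proof.
  case: X z => V' X' eX z [H1 H2].
  have [R _] := induced_path_ex HFac HFfib z (tt_paths A _ _ _ H1) (tt_paths E _ _ _ H2)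
    (idm _) (idm _) (cart_idm _) (cart_idm _)
    (eq_trans (comp_id_r _ _ _ _) (eq_sym (comp_id_l _ _ _ _))) H1 H2.
  by constructor.
Qed.

End ChangeOfBaseLemmas.

(** * Universal quintuples *)

Section Quintuples.
Context {C : Category} {T U Pt : C} (u : Hom T U) (src tgt : Hom Pt T).

(* [Quint] bundled with the morphisms [a], [b] and the pullbacks of [u] along them. *)
Record FQ (X : C) : Type := MkFQ {
  fq_a : Hom X U; fq_b : Hom X U;
  fq_Sa : C; fq_Sb : C;
  fq_ta : Hom fq_Sa T; fq_ba : Hom fq_Sa X;
  fq_tb : Hom fq_Sb T; fq_bb : Hom fq_Sb X;
  fq_f : Hom fq_Sa fq_Sb; fq_g : Hom fq_Sb fq_Sa; fq_s : Hom fq_Sa Pt;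
  fq_h : Hom fq_Sb fq_Sa; fq_t : Hom fq_Sb Pt;
  fq_pa : IsPullback u fq_a fq_ta fq_ba;
  fq_pb : IsPullback u fq_b fq_tb fq_bb;
  fq_fo : fq_bb ∘ fq_f = fq_ba;
  fq_go : fq_ba ∘ fq_g = fq_bb;
  fq_ho : fq_ba ∘ fq_h = fq_bb;
  fq_ss : src ∘ fq_s = fq_ta ∘ (fq_g ∘ fq_f);
  fq_st : tgt ∘ fq_s = fq_ta;
  fq_ts : src ∘ fq_t = fq_tb ∘ (fq_f ∘ fq_h);
  fq_tt : tgt ∘ fq_t = fq_tb
}.

End Quintuples.

Arguments fq_a {C T U Pt u src tgt X}. Arguments fq_b {C T U Pt u src tgt X}.
Arguments fq_Sa {C T U Pt u src tgt X}. Arguments fq_Sb {C T U Pt u src tgt X}.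
Arguments fq_ta {C T U Pt u src tgt X}. Arguments fq_tb {C T U Pt u src tgt X}.
Arguments fq_ba {C T U Pt u src tgt X}. Arguments fq_bb {C T U Pt u src tgt X}.
Arguments fq_f {C T U Pt u src tgt X}. Arguments fq_g {C T U Pt u src tgt X}.
Arguments fq_h {C T U Pt u src tgt X}. Arguments fq_s {C T U Pt u src tgt X}.
Arguments fq_t {C T U Pt u src tgt X}.
Arguments fq_pa {C T U Pt u src tgt X}. Arguments fq_pb {C T U Pt u src tgt X}.
Arguments fq_fo {C T U Pt u src tgt X}. Arguments fq_go {C T U Pt u src tgt X}.
Arguments fq_ho {C T U Pt u src tgt X}. Arguments fq_ss {C T U Pt u src tgt X}.
Arguments fq_st {C T U Pt u src tgt X}. Arguments fq_ts {C T U Pt u src tgt X}.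
Arguments fq_tt {C T U Pt u src tgt X}.

Section Restriction.
Context {C : Category} {T U Pt : C} {u : Hom T U} {src tgt : Hom Pt T}.
Local Notation FQ := (FQ u src tgt).

Record RestrAlong {X X' : C} (m : Hom X' X) (Q : FQ X) (Q' : FQ X')
    (ka : Hom (fq_Sa Q') (fq_Sa Q)) (kb : Hom (fq_Sb Q') (fq_Sb Q)) : Prop := MkRestr {
  r_ta : fq_ta Q ∘ ka = fq_ta Q';
  r_ba : fq_ba Q ∘ ka = m ∘ fq_ba Q';
  r_tb : fq_tb Q ∘ kb = fq_tb Q';
  r_bb : fq_bb Q ∘ kb = m ∘ fq_bb Q';
  r_f : kb ∘ fq_f Q' = fq_f Q ∘ ka;
  r_g : ka ∘ fq_g Q' = fq_g Q ∘ kb;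
  r_s : fq_s Q' = fq_s Q ∘ ka;
  r_h : ka ∘ fq_h Q' = fq_h Q ∘ kb;
  r_t : fq_t Q' = fq_t Q ∘ kb
}.

Definition Restricts {X X' : C} (m : Hom X' X) (Q : FQ X) (Q' : FQ X') : Prop :=
  fq_a Q ∘ m = fq_a Q' /\ fq_b Q ∘ m = fq_b Q' /\ exists ka kb, RestrAlong m Q Q' ka kb.

(** A representability statement: [X] is an equivalence object and [Q] the equivalence that it
    carries. *)
Definition Universal {X : C} (Q : FQ X) : Prop :=
  forall (X' : C) (Q' : FQ X'), exists m : Hom X' X,
    Restricts m Q Q' /\ forall m' : Hom X' X, Restricts m' Q Q' -> m' = m.

Lemma universal_inj {X X' : C} (Q : FQ X) (Q' : FQ X') (m m' : Hom X' X) :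
  Universal Q -> Restricts m Q Q' -> Restricts m' Q Q' -> m = m'.
Proof. by move=> H H1 H2; case: (H X' Q') => n [_ Hn]; rewrite (Hn m) // (Hn m'). Qed.

Lemma restricts_id {X : C} (Q : FQ X) : Restricts (idm X) Q Q.
Proof.
  split; [exact: comp_id_r | split; [exact: comp_id_r |]].
  by exists (idm _), (idm _); split; rewrite ?comp_id_l ?comp_id_r.
Qed.

Lemma restricts_comp {X X' X'' : C} (Q : FQ X) (Q' : FQ X') (Q'' : FQ X'') (m : Hom X' X)
    (n : Hom X'' X') :
  Restricts m Q Q' -> Restricts n Q' Q'' -> Restricts (m ∘ n) Q Q''.
Proof.
  move=> [a1 [b1 [ka [kb [e1 e2 e3 e4 e5 e6 e7 e8 e9]]]]].
  move=> [a2 [b2 [ka' [kb' [f1 f2 f3 f4 f5 f6 f7 f8 f9]]]]].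
  split; [by rewrite comp_assoc a1 | split; [by rewrite comp_assoc b1 |]].
  exists (ka ∘ ka'), (kb ∘ kb'); split.
  - by rewrite comp_assoc e1.
  - by rewrite comp_assoc e2 -!comp_assoc f2.
  - by rewrite comp_assoc e3.
  - by rewrite comp_assoc e4 -!comp_assoc f4.
  - by rewrite -comp_assoc f5 !comp_assoc e5.
  - by rewrite -comp_assoc f6 !comp_assoc e6.
  - by rewrite f7 e7 comp_assoc.
  - by rewrite -comp_assoc f8 !comp_assoc e8.
  - by rewrite f9 e9 comp_assoc.
Qed.

(** The pullback [fq_Sa Q'] is detected by [la] together with its projection to [X'], and likewise
    [fq_Sb Q'], so the equations of [Q''] against [Q'] follow from those against [Q]. For [n] an
    identity this gives uniqueness of restrictions; in general, their naturality. *)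
Lemma restr_cancel {X X' X'' : C} {Q : FQ X} {Q' : FQ X'} {Q'' : FQ X''} {m : Hom X' X}
    {n : Hom X'' X'} {la : Hom (fq_Sa Q') (fq_Sa Q)} {lb : Hom (fq_Sb Q') (fq_Sb Q)}
    {la' : Hom (fq_Sa Q'') (fq_Sa Q)} {lb' : Hom (fq_Sb Q'') (fq_Sb Q)}
    (ka : Hom (fq_Sa Q'') (fq_Sa Q')) (kb : Hom (fq_Sb Q'') (fq_Sb Q')) :
  RestrAlong m Q Q' la lb -> RestrAlong (m ∘ n) Q Q'' la' lb' ->
  fq_ta Q' ∘ ka = fq_ta Q'' -> fq_ba Q' ∘ ka = n ∘ fq_ba Q'' ->
  fq_tb Q' ∘ kb = fq_tb Q'' -> fq_bb Q' ∘ kb = n ∘ fq_bb Q'' ->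
  RestrAlong n Q' Q'' ka kb.
Proof.
  move=> [e1 e2 e3 e4 e5 e6 e7 e8 e9] [f1 f2 f3 f4 f5 f6 f7 f8 f9] ta ba tb bb.
  have ha : la ∘ ka = la'.
    apply: (pb_monic (fq_pa Q)); first by rewrite comp_assoc e1 ta f1.
    by rewrite comp_assoc e2 -comp_assoc ba f2 comp_assoc.
  have hb : lb ∘ kb = lb'.
    apply: (pb_monic (fq_pb Q)); first by rewrite comp_assoc e3 tb f3.
    by rewrite comp_assoc e4 -comp_assoc bb f4 comp_assoc.
  have mon_a (Z : C) (x y : Hom Z (fq_Sa Q')) :
      la ∘ x = la ∘ y -> fq_ba Q' ∘ x = fq_ba Q' ∘ y -> x = y.
    move=> g1 g2; apply: (pb_monic (fq_pa Q')) => //.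
    by rewrite -e1 -!comp_assoc g1.
  have mon_b (Z : C) (x y : Hom Z (fq_Sb Q')) :
      lb ∘ x = lb ∘ y -> fq_bb Q' ∘ x = fq_bb Q' ∘ y -> x = y.
    move=> g1 g2; apply: (pb_monic (fq_pb Q')) => //.
    by rewrite -e3 -!comp_assoc g1.
  split=> //.
  - apply: mon_b; first by rewrite comp_assoc hb f5 comp_assoc e5 -comp_assoc ha.
    by rewrite !comp_assoc bb fq_fo ba -comp_assoc fq_fo.
  - apply: mon_a; first by rewrite comp_assoc ha f6 comp_assoc e6 -comp_assoc hb.
    by rewrite !comp_assoc ba fq_go bb -comp_assoc fq_go.
  - by rewrite f7 e7 -comp_assoc ha.
  - apply: mon_a; first by rewrite comp_assoc ha f8 comp_assoc e8 -comp_assoc hb.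
    by rewrite !comp_assoc ba fq_ho bb -comp_assoc fq_ho.
  - by rewrite f9 e9 -comp_assoc hb.
Qed.

(** The pullbacks at the new object are prescribed, because a [Quint] is taken over given squares
    [Sa] and [Sb]. *)
Lemma restriction_ex {X X' : C} (Q : FQ X) (m : Hom X' X) {a b : Hom X' U} {Sa Sb : C}
    {ta : Hom Sa T} {ba : Hom Sa X'} {tb : Hom Sb T} {bb : Hom Sb X'} :
  fq_a Q ∘ m = a -> fq_b Q ∘ m = b ->
  forall (Ha : IsPullback u a ta ba) (Hb : IsPullback u b tb bb),
  exists (f : Hom Sa Sb) (g : Hom Sb Sa) (s : Hom Sa Pt) (h : Hom Sb Sa) (t : Hom Sb Pt)
    fo go ho ss st ts tt',
    Restricts m Q
      (MkFQ u src tgt X' a b Sa Sb ta ba tb bb f g s h t Ha Hb fo go ho ss st ts tt').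
Proof.
  move=> ea eb Ha Hb.
  have [ka [ka1 ka2]] : exists ka, fq_ta Q ∘ ka = ta /\ fq_ba Q ∘ ka = m ∘ ba.
    by apply: (pb_lift (fq_pa Q)); rewrite (pb_comm Ha) -ea comp_assoc.
  have [kb [kb1 kb2]] : exists kb, fq_tb Q ∘ kb = tb /\ fq_bb Q ∘ kb = m ∘ bb.
    by apply: (pb_lift (fq_pb Q)); rewrite (pb_comm Hb) -eb comp_assoc.
  have mk_a (Z : C) (x : Hom Z (fq_Sa Q)) (y : Hom Z X') : fq_ba Q ∘ x = m ∘ y ->
      exists n, ka ∘ n = x /\ ba ∘ n = y.
    move=> e; have [n [n1 n2]] : exists n, ta ∘ n = fq_ta Q ∘ x /\ ba ∘ n = y.
      by apply: (pb_lift Ha); rewrite comp_assoc (pb_comm (fq_pa Q)) -comp_assoc e comp_assoc ea.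
    exists n; split=> //; apply: (pb_monic (fq_pa Q)); first by rewrite comp_assoc ka1.
    by rewrite comp_assoc ka2 -comp_assoc n2.
  have mk_b (Z : C) (x : Hom Z (fq_Sb Q)) (y : Hom Z X') : fq_bb Q ∘ x = m ∘ y ->
      exists n, kb ∘ n = x /\ bb ∘ n = y.
    move=> e; have [n [n1 n2]] : exists n, tb ∘ n = fq_tb Q ∘ x /\ bb ∘ n = y.
      by apply: (pb_lift Hb); rewrite comp_assoc (pb_comm (fq_pb Q)) -comp_assoc e comp_assoc eb.
    exists n; split=> //; apply: (pb_monic (fq_pb Q)); first by rewrite comp_assoc kb1.
    by rewrite comp_assoc kb2 -comp_assoc n2.
  have [f [f1 f2]] : exists f, kb ∘ f = fq_f Q ∘ ka /\ bb ∘ f = ba.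
    by apply: mk_b; rewrite comp_assoc fq_fo.
  have [g [g1 g2]] : exists g, ka ∘ g = fq_g Q ∘ kb /\ ba ∘ g = bb.
    by apply: mk_a; rewrite comp_assoc fq_go.
  have [h [h1 h2]] : exists h, ka ∘ h = fq_h Q ∘ kb /\ ba ∘ h = bb.
    by apply: mk_a; rewrite comp_assoc fq_ho.
  have ss : src ∘ (fq_s Q ∘ ka) = ta ∘ (g ∘ f).
    by rewrite comp_assoc fq_ss -ka1 -!comp_assoc (comp_pre _ g1) -!comp_assoc f1.
  have st : tgt ∘ (fq_s Q ∘ ka) = ta by rewrite comp_assoc fq_st.
  have ts : src ∘ (fq_t Q ∘ kb) = tb ∘ (f ∘ h).
    by rewrite comp_assoc fq_ts -kb1 -!comp_assoc (comp_pre _ f1) -!comp_assoc h1.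
  have tt' : tgt ∘ (fq_t Q ∘ kb) = tb by rewrite comp_assoc fq_tt.
  exists f, g, (fq_s Q ∘ ka), h, (fq_t Q ∘ kb), f2, g2, h2, ss, st, ts, tt'.
  by do 2!split=> //; exists ka, kb; split.
Qed.

End Restriction.

(** * Moving quintuples along functors and along pullbacks of the fibration *)

Definition map_fq {C D : Category} (F : Functor C D) {T U Pt : C} {u : Hom T U}
    {src tgt : Hom Pt T} {X : C} (Q : FQ u src tgt X)
    (Ha : IsPullback (fmap F u) (fmap F (fq_a Q)) (fmap F (fq_ta Q)) (fmap F (fq_ba Q)))
    (Hb : IsPullback (fmap F u) (fmap F (fq_b Q)) (fmap F (fq_tb Q)) (fmap F (fq_bb Q))) :
    FQ (fmap F u) (fmap F src) (fmap F tgt) (F X).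
Proof.
  refine (MkFQ _ _ _ _ _ _ _ _ _ _ _ _ (fmap F (fq_f Q)) (fmap F (fq_g Q)) (fmap F (fq_s Q))
    (fmap F (fq_h Q)) (fmap F (fq_t Q)) Ha Hb _ _ _ _ _ _ _); rewrite -!fmap_comp;
  by rewrite ?fq_fo ?fq_go ?fq_ho ?fq_ss ?fq_st ?fq_ts ?fq_tt.
Defined.

Lemma restricts_map {C D : Category} (F : Functor C D) {T U Pt : C} {u : Hom T U}
    {src tgt : Hom Pt T} {X X' : C} {Q : FQ u src tgt X} {Q' : FQ u src tgt X'}
    (m : Hom X' X) Ha Hb Ha' Hb' :
  Restricts m Q Q' -> Restricts (fmap F m) (map_fq F Q Ha Hb) (map_fq F Q' Ha' Hb').
Proof.
  move=> [a1 [b1 [ka [kb [e1 e2 e3 e4 e5 e6 e7 e8 e9]]]]].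
  split; [by rewrite /= -fmap_comp a1 | split; [by rewrite /= -fmap_comp b1 |]].
  by exists (fmap F ka), (fmap F kb); split; rewrite /= -!fmap_comp ?e1 ?e2 ?e3 ?e4 ?e5 ?e6 ?e7 ?e8 ?e9.
Qed.

(* Universal quintuples are unique up to isomorphism, so preservation by [F] may be
   checked on any one of them. *)
Lemma universal_map {C D : Category} (F : Functor C D) {T U Pt : C} {u : Hom T U}
    {src tgt : Hom Pt T} {X X' : C} {Q : FQ u src tgt X} {Q' : FQ u src tgt X'}
    Ha Hb Ha' Hb' :
  Universal Q -> Universal Q' -> Universal (map_fq F Q Ha Hb) ->
  Universal (map_fq F Q' Ha' Hb').
Proof.
  move=> HQ HQ' HF Z R.
  have [m [Hm _]] := HQ X' Q'; have [n [Hn _]] := HQ' X Q.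
  have e : n ∘ m = idm X'.
    by apply: (universal_inj Q' Q') => //; [apply: restricts_comp Hn Hm | exact: restricts_id].
  have [k [Hk Uk]] := HF Z R; exists (fmap F n ∘ k); split.
  - by apply: restricts_comp Hk; apply: restricts_map.
  - move=> k' Hk'; rewrite -(Uk (fmap F m ∘ k')).
    + by apply: restricts_comp Hk'; apply: restricts_map.
    + by rewrite comp_assoc -fmap_comp e fmap_id comp_id_l.
Qed.

Section Push.
Context {C : Category} {T U Pt T0 U0 Pt0 : C} {u : Hom T U} {src tgt : Hom Pt T}
  {u0 : Hom T0 U0} {src0 tgt0 : Hom Pt0 T0} (h : Hom U U0) (k : Hom T T0)
  (th : Hom Pt Pt0) (Hhk : IsPullback u0 h k u) (Hs : src0 ∘ th = k ∘ src)
  (Ht : tgt0 ∘ th = k ∘ tgt).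

(** Pullbacks of [u] paste with [Hhk] to pullbacks of [u0], so a quintuple for [u] is one for [u0]
    once its paths are sent along [th]. In [B] this lets [p(E(w))] classify equivalences coming from
    [A]. *)
Definition push_fq {X : C} (Q : FQ u src tgt X) : FQ u0 src0 tgt0 X.
Proof.
  refine (MkFQ u0 src0 tgt0 X (h ∘ fq_a Q) (h ∘ fq_b Q) (fq_Sa Q) (fq_Sb Q)
    (k ∘ fq_ta Q) (fq_ba Q) (k ∘ fq_tb Q) (fq_bb Q) (fq_f Q) (fq_g Q) (th ∘ fq_s Q)
    (fq_h Q) (th ∘ fq_t Q) (pb_paste Hhk (fq_pa Q)) (pb_paste Hhk (fq_pb Q))
    (fq_fo Q) (fq_go Q) (fq_ho Q) _ _ _ _);
  by rewrite comp_assoc ?Hs ?Ht -?comp_assoc ?fq_ss ?fq_st ?fq_ts ?fq_tt.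
Defined.

Lemma restricts_push {X X' : C} {Q : FQ u src tgt X} {Q' : FQ u src tgt X'}
    (m : Hom X' X) : Restricts m Q Q' -> Restricts m (push_fq Q) (push_fq Q').
Proof.
  move=> [a1 [b1 [ka [kb [e1 e2 e3 e4 e5 e6 e7 e8 e9]]]]].
  split; [by rewrite /= -comp_assoc a1 | split; [by rewrite /= -comp_assoc b1 |]].
  by exists ka, kb; split=> //=; rewrite -?comp_assoc ?e1 ?e3 ?e7 ?e9.
Qed.

End Push.

(** * Equivalence objects compared with universal quintuples *)

Section EquivalenceObjects.
Context {C : FibCat} {T U : C} {u : Hom T U} (P : PathObject u).

Definition fq_of {X : C} {a b : Hom X U} {Sa : PB u a} {Sb : PB u b} (q : Quint P Sa Sb) :
    FQ u (po_src P) (po_tgt P) X :=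
  MkFQ u (po_src P) (po_tgt P) X a b Sa Sb (pb_top Sa) (pb_base Sa) (pb_top Sb) (pb_base Sb)
    (q_f _ _ _ q) (q_g _ _ _ q) (q_s _ _ _ q) (q_h _ _ _ q) (q_t _ _ _ q)
    (pb_is Sa) (pb_is Sb) (q_f_over _ _ _ q) (q_g_over _ _ _ q) (q_h_over _ _ _ q)
    (q_s_src _ _ _ q) (q_s_tgt _ _ _ q) (q_t_src _ _ _ q) (q_t_tgt _ _ _ q).

Lemma quint_eq {X : C} {a b : Hom X U} {Sa : PB u a} {Sb : PB u b} (q q' : Quint P Sa Sb) :
  q_f _ _ _ q = q_f _ _ _ q' -> q_g _ _ _ q = q_g _ _ _ q' ->
  q_s _ _ _ q = q_s _ _ _ q' -> q_h _ _ _ q = q_h _ _ _ q' ->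
  q_t _ _ _ q = q_t _ _ _ q' -> q = q'.
Proof.
  case: q => f g s h t e1 e2 e3 e4 e5 e6 e7; case: q' => f' g' s' h' t' e1' e2' e3' e4' e5' e6' e7' /=.
  move=> E1 E2 E3 E4 E5; subst f' g' s' h' t'.
  by f_equal; apply: proof_irrelevance.
Qed.

Lemma quint_unique {X X' : C} (Q : FQ u (po_src P) (po_tgt P) X) (m : Hom X' X)
    {a b : Hom X' U} {Sa : PB u a} {Sb : PB u b} (q q' : Quint P Sa Sb) :
  Restricts m Q (fq_of q) -> Restricts m Q (fq_of q') -> q = q'.
Proof.
  move=> [_ [_ [ka [kb R]]]] [_ [_ [ka' [kb' R']]]].
  have R2 : RestrAlong (m ∘ idm X') Q (fq_of q') ka' kb' by rewrite comp_id_r.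
  have [h1 h2 h3 h4 h5 h6 h7 h8 h9] :=
    restr_cancel (Q' := fq_of q) (Q'' := fq_of q') (idm Sa) (idm Sb) R R2
    (comp_id_r _ _ _ _) (eq_trans (comp_id_r _ _ _ _) (eq_sym (comp_id_l _ _ _ _)))
    (comp_id_r _ _ _ _) (eq_trans (comp_id_r _ _ _ _) (eq_sym (comp_id_l _ _ _ _))).
  rewrite /= ?comp_id_l ?comp_id_r in h5 h6 h7 h8 h9.
  by apply: quint_eq.
Qed.

Lemma eo_tr_eq (Eo : EquivObj P) {X : C} {a b : Hom X U} (Sa : PB u a) (Sb : PB u b)
    (m m' : Hom X (eo_ob P Eo)) e0 e1 e0' e1' :
  m = m' -> eo_tr P Eo Sa Sb m e0 e1 = eo_tr P Eo Sa Sb m' e0' e1'.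
Proof.
  by move=> E; subst m'; rewrite (proof_irrelevance _ e0 e0') (proof_irrelevance _ e1 e1').
Qed.

(** The generic quintuple is the transpose of an identity, and naturality makes every transpose a
    restriction of it. The last clause keeps the link with [eo_tr], by which the morphism [e(u)] is
    located. *)
Lemma universal_of_equivobj (Eo : EquivObj P)
    (Sa : PB u (eo_p0 P Eo ∘ eo_proj P Eo)) (Sb : PB u (eo_p1 P Eo ∘ eo_proj P Eo)) :
  exists Q : FQ u (po_src P) (po_tgt P) (eo_ob P Eo),
    fq_a Q = eo_p0 P Eo ∘ eo_proj P Eo /\ fq_b Q = eo_p1 P Eo ∘ eo_proj P Eo /\
    Universal Q /\
    forall (X : C) (a b : Hom X U) (Sa' : PB u a) (Sb' : PB u b) (m : Hom X (eo_ob P Eo))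
      e0 e1, Restricts m Q (fq_of (eo_tr P Eo Sa' Sb' m e0 e1)).
Proof.
  have e0 : eo_p0 P Eo ∘ (eo_proj P Eo ∘ idm _) = eo_p0 P Eo ∘ eo_proj P Eo by rewrite comp_id_r.
  have e1 : eo_p1 P Eo ∘ (eo_proj P Eo ∘ idm _) = eo_p1 P Eo ∘ eo_proj P Eo by rewrite comp_id_r.
  set q := eo_tr P Eo Sa Sb (idm _) e0 e1.
  have key (X : C) (a b : Hom X U) (Sa' : PB u a) (Sb' : PB u b) (m : Hom X (eo_ob P Eo))
      f0 f1 : Restricts m (fq_of q) (fq_of (eo_tr P Eo Sa' Sb' m f0 f1)).
    have E0 : (eo_p0 P Eo ∘ eo_proj P Eo) ∘ m = a by rewrite -comp_assoc.
    have E1 : (eo_p1 P Eo ∘ eo_proj P Eo) ∘ m = b by rewrite -comp_assoc.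
    (* Naturality speaks of pullbacks along composites, so [a] and [b] are replaced by the
       composites with [m]. *)
    do 2!split=> //; move: f0 f1; subst a b => f0 f1.
    have [ka [ka1 ka2]] : exists ka, pb_top Sa ∘ ka = pb_top Sa' /\
        pb_base Sa ∘ ka = m ∘ pb_base Sa'.
      by apply: (pb_lift (pb_is Sa)); rewrite (pb_comm (pb_is Sa')) comp_assoc.
    have [kb [kb1 kb2]] : exists kb, pb_top Sb ∘ kb = pb_top Sb' /\
        pb_base Sb ∘ kb = m ∘ pb_base Sb'.
      by apply: (pb_lift (pb_is Sb)); rewrite (pb_comm (pb_is Sb')) comp_assoc.
    exists ka, kb.
    have g0 : eo_p0 P Eo ∘ (eo_proj P Eo ∘ (idm _ ∘ m)) = eo_p0 P Eo ∘ eo_proj P Eo ∘ m.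
      by rewrite comp_id_l.
    have g1 : eo_p1 P Eo ∘ (eo_proj P Eo ∘ (idm _ ∘ m)) = eo_p1 P Eo ∘ eo_proj P Eo ∘ m.
      by rewrite comp_id_l.
    have [h1 [h2 [h3 [h4 h5]]]] := eo_nat P Eo _ X m _ _ Sa Sb Sa' Sb' ka kb (idm _) e0 e1 g0 g1
      (conj ka1 ka2) (conj kb1 kb2).
    rewrite (eo_tr_eq Eo Sa' Sb' m (idm _ ∘ m) f0 f1 g0 g1); first by rewrite comp_id_l.
    by split.
  set Q0 := fq_of q in key *; exists Q0; do 3!split=> //.
  move=> X' [a b Ta Tb ta ba tb bb f g s h t pa pb fo go ho ss st ts tt'].
  set Sa' := Build_PB _ _ _ _ _ _ Ta ta ba pa; set Sb' := Build_PB _ _ _ _ _ _ Tb tb bb pb.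
  set q' := MkQuint P X' a b Sa' Sb' f g s h t fo go ho ss st ts tt'.
  have [m [f0 [f1 E]]] := eo_surj P Eo X' a b Sa' Sb' q'.
  exists m; split.
  - by have := key X' a b Sa' Sb' m f0 f1; rewrite E.
  - move=> m' [E0 [E1 [ka [kb R]]]].
    have f0' : eo_p0 P Eo ∘ (eo_proj P Eo ∘ m') = a by rewrite comp_assoc.
    have f1' : eo_p1 P Eo ∘ (eo_proj P Eo ∘ m') = b by rewrite comp_assoc.
    apply: (eo_inj P Eo X' a b Sa' Sb' m' m f0' f1' f0 f1); rewrite E.
    by apply: (quint_unique Q0 m') => //; do 2!split=> //; exists ka, kb.
Qed.

Lemma univalent_of_universal {X0 U2 : C} (Q : FQ u (po_src P) (po_tgt P) X0)
    (p0 p1 : Hom U2 U) (pr : Hom X0 U2) (e : Hom U X0) :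
  IsProduct p0 p1 -> fib pr -> fq_a Q = p0 ∘ pr -> fq_b Q = p1 ∘ pr -> Universal Q ->
  Restricts e Q (fq_of (id_quint P)) -> HomotopyEquiv e -> UnivalentFor P.
Proof.
  move=> Hprod Hpr Ea Eb HQ He Hequiv.
  have ea (X : C) (m : Hom X X0) a : p0 ∘ (pr ∘ m) = a -> fq_a Q ∘ m = a.
    by rewrite Ea -comp_assoc.
  have eb (X : C) (m : Hom X X0) a : p1 ∘ (pr ∘ m) = a -> fq_b Q ∘ m = a.
    by rewrite Eb -comp_assoc.
  have ex (X : C) (a b : Hom X U) (Sa : PB u a) (Sb : PB u b) (m : Hom X X0) :
      p0 ∘ (pr ∘ m) = a -> p1 ∘ (pr ∘ m) = b ->
      exists q : Quint P Sa Sb, Restricts m Q (fq_of q).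
    move=> e0 e1.
    have [f [g [s [h [t [fo [go [ho [ss [st [ts [tt' R]]]]]]]]]]]] :=
      restriction_ex Q m (ea _ _ _ e0) (eb _ _ _ e1) (pb_is Sa) (pb_is Sb).
    by exists (MkQuint P X a b Sa Sb f g s h t fo go ho ss st ts tt').
  (* [eo_tr] has to be a function, whereas restrictions are only known to exist. The choice is
     harmless by [quint_unique]. *)
  pose tr (X : C) (a b : Hom X U) (Sa : PB u a) (Sb : PB u b) (m : Hom X X0)
      (e0 : p0 ∘ (pr ∘ m) = a) (e1 : p1 ∘ (pr ∘ m) = b) : Quint P Sa Sb :=
    proj1_sig (constructive_indefinite_description _ (ex X a b Sa Sb m e0 e1)).
  have trP (X : C) (a b : Hom X U) (Sa : PB u a) (Sb : PB u b) (m : Hom X X0) e0 e1 :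
      Restricts m Q (fq_of (tr X a b Sa Sb m e0 e1)).
    by rewrite /tr; case: constructive_indefinite_description.
  have inj (X : C) (a b : Hom X U) (Sa : PB u a) (Sb : PB u b) (m m' : Hom X X0)
      e0 e1 e0' e1' : tr X a b Sa Sb m e0 e1 = tr X a b Sa Sb m' e0' e1' -> m = m'.
    move=> E; apply: (universal_inj Q (fq_of (tr X a b Sa Sb m e0 e1))) => //.
    by rewrite E.
  have surj (X : C) (a b : Hom X U) (Sa : PB u a) (Sb : PB u b) (q : Quint P Sa Sb) :
      exists (m : Hom X X0) (e0 : p0 ∘ (pr ∘ m) = a) (e1 : p1 ∘ (pr ∘ m) = b),
        tr X a b Sa Sb m e0 e1 = q.
    have [m [Hm _]] := HQ X (fq_of q).
    have e0 : p0 ∘ (pr ∘ m) = a by case: Hm => E _; rewrite Ea -comp_assoc in E.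
    have e1 : p1 ∘ (pr ∘ m) = b by case: Hm => _ [E _]; rewrite Eb -comp_assoc in E.
    by exists m, e0, e1; apply: (quint_unique Q m).
  have nat (X X' : C) (y : Hom X' X) (a b : Hom X U) (Sa : PB u a) (Sb : PB u b)
      (Sa' : PB u (a ∘ y)) (Sb' : PB u (b ∘ y)) (ka : Hom Sa' Sa) (kb : Hom Sb' Sb)
      (m : Hom X X0) e0 e1 e0' e1' : IsPBMap y Sa Sa' ka -> IsPBMap y Sb Sb' kb ->
      IsRestriction P ka kb (tr X a b Sa Sb m e0 e1) (tr X' _ _ Sa' Sb' (m ∘ y) e0' e1').
    move=> [ka1 ka2] [kb1 kb2].
    have [_ [_ [la [lb R]]]] := trP X a b Sa Sb m e0 e1.
    have [_ [_ [la' [lb' R']]]] := trP X' _ _ Sa' Sb' (m ∘ y) e0' e1'.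
    by case: (restr_cancel (Q' := fq_of (tr X a b Sa Sb m e0 e1))
      (Q'' := fq_of (tr X' _ _ Sa' Sb' (m ∘ y) e0' e1')) ka kb R R').
  pose Eo : EquivObj P := {| eo_prod := U2; eo_p0 := p0; eo_p1 := p1; eo_is_prod := Hprod;
    eo_ob := X0; eo_proj := pr; eo_fib := Hpr; eo_tr := tr; eo_inj := inj; eo_surj := surj;
    eo_nat := nat |}.
  have e0 : p0 ∘ (pr ∘ e) = idm U by case: He => E _; rewrite comp_assoc -Ea E.
  have e1 : p1 ∘ (pr ∘ e) = idm U by case: He => _ [E _]; rewrite comp_assoc -Eb E.
  exists Eo, e, e0, e1; split=> //.
  exact: (quint_unique Q e).
Qed.

End EquivalenceObjects.

(* [E(u)] as an iterated dependent product: first [f], then [(g, h, τ)] in a single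
   product along [b^*T], and last [σ]. *)
Section Tower.
Context {C : Category} {T U Pt TT : C} {u : Hom T U} {s0 s1 : Hom TT T}
  {bd : Hom Pt TT} {src tgt : Hom Pt T}.
Context (HTT : IsPullback u u s0 s1) (Esrc : src = s0 ∘ bd) (Etgt : tgt = s1 ∘ bd).
Context {U2 : C} {π0 π1 : Hom U2 U} (HU2 : IsProduct π0 π1).
(** Over [U2], which is [U × U], [Y1] and [Y1'] are the two pullbacks of [T], and [H] is the object
    of maps from the one to the other. [SH] and [KH] are their restrictions to [H], and [fH] is the
    generic map. *)
Context {Y1 : C} {t1 : Hom Y1 T} {b1 : Hom Y1 U2} (HY1 : IsPullback u π0 t1 b1).
Context {Y1' : C} {t1' : Hom Y1' T} {b1' : Hom Y1' U2} (HY1' : IsPullback u π1 t1' b1').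
Context {A1 : C} {c1 : Hom A1 Y1'} {d1 : Hom A1 Y1} (HA1 : IsPullback b1' b1 c1 d1).
Context {H SH : C} {dpH : Hom H U2} {stH : Hom SH Y1} {sbH : Hom SH H} {nH : Hom SH A1}
  (HH : UDP d1 b1 dpH stH sbH nH).
Context {KH : C} {tK : Hom KH Y1'} {bK : Hom KH H} (HKH : IsPullback b1' dpH tK bK).
Context {fH : Hom SH KH} (fH1 : tK ∘ fH = c1 ∘ nH) (fH2 : bK ∘ fH = sbH).
(** [B2] consists of pairs [(h y, y)], [Q2] adds a path from [f (h y)] to [y], and [A2] adds [g y].
    So [G] classifies maps [f] equipped with [g], [h] and [τ]. *)
Context {B2 : C} {xB : Hom B2 SH} {yB : Hom B2 KH} (HB2 : IsPullback sbH bK xB yB).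
Context {wB : Hom B2 TT} (wB1 : s0 ∘ wB = t1' ∘ (tK ∘ (fH ∘ xB)))
  (wB2 : s1 ∘ wB = t1' ∘ (tK ∘ yB)).
Context {Q2 : C} {pQ : Hom Q2 Pt} {bQ : Hom Q2 B2} (HQ2 : IsPullback bd wB pQ bQ).
Context {A2 : C} {gA : Hom A2 SH} {qA : Hom A2 Q2}
  (HA2 : IsPullback sbH (bK ∘ (yB ∘ bQ)) gA qA).
Context {G SG : C} {dpG : Hom G H} {stG : Hom SG KH} {sbG : Hom SG G} {nG : Hom SG A2}
  (HG : UDP (yB ∘ (bQ ∘ qA)) bK dpG stG sbG nG).
(** [LG] and [SG] are the two pullbacks of [T] over [G], with generic maps [fG], [gG] and [hG]. [wL]
    is the pair [(g (f x), x)] and [A3] holds the paths between its entries, so [K] adds [σ]. *)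
Context {LG : C} {tL : Hom LG SH} {bL : Hom LG G} (HLG : IsPullback sbH dpG tL bL).
Context {gG : Hom SG LG} (gG1 : tL ∘ gG = gA ∘ nG) (gG2 : bL ∘ gG = sbG).
Context {hG : Hom SG LG} (hG1 : tL ∘ hG = xB ∘ (bQ ∘ (qA ∘ nG))) (hG2 : bL ∘ hG = sbG).
Context {fG : Hom LG SG} (fG1 : stG ∘ fG = fH ∘ tL) (fG2 : sbG ∘ fG = bL).
Context {wL : Hom LG TT} (wL1 : s0 ∘ wL = t1 ∘ (stH ∘ (tL ∘ (gG ∘ fG))))
  (wL2 : s1 ∘ wL = t1 ∘ (stH ∘ tL)).
Context {A3 : C} {pA : Hom A3 Pt} {bA : Hom A3 LG} (HA3 : IsPullback bd wL pA bA).
Context {K SK : C} {dpK : Hom K G} {stK : Hom SK LG} {sbK : Hom SK K} {nK : Hom SK A3}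
  (HK : UDP bA bL dpK stK sbK nK).
Context {MK : C} {tM : Hom MK SG} {bM : Hom MK K} (HMK : IsPullback sbG dpK tM bM).
Context {a b : Hom K U} (Ea : a = π0 ∘ (dpH ∘ (dpG ∘ dpK)))
  (Eb : b = π1 ∘ (dpH ∘ (dpG ∘ dpK))).
Context {ta : Hom SK T} {tb : Hom MK T} (Eta : ta = t1 ∘ (stH ∘ (tL ∘ stK)))
  (Etb : tb = t1' ∘ (tK ∘ (stG ∘ tM))).
Context {f : Hom SK MK} (f1 : tM ∘ f = fG ∘ stK) (f2 : bM ∘ f = sbK).
Context {g : Hom MK SK} (g1 : stK ∘ g = gG ∘ tM) (g2 : sbK ∘ g = bM).
Context {h : Hom MK SK} (h1 : stK ∘ h = hG ∘ tM) (h2 : sbK ∘ h = bM).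
Context {s : Hom SK Pt} (Es : s = pA ∘ nK).
Context {t : Hom MK Pt} (Et : t = pQ ∘ (qA ∘ (nG ∘ tM))).

Lemma tower_pa : IsPullback u a ta sbK.
Proof.
  rewrite Ea Eta.
  have [HSH _] := HH; have [HSK _] := HK.
  have := pb_paste (pb_paste (pb_paste HY1 HSH) HLG) HSK.
  by rewrite -!comp_assoc.
Qed.

Lemma tower_pb : IsPullback u b tb bM.
Proof.
  rewrite Eb Etb.
  have [HSG _] := HG.
  have := pb_paste (pb_paste (pb_paste HY1' HKH) HSG) HMK.
  by rewrite -!comp_assoc.
Qed.

Let HSH : IsPullback b1 dpH stH sbH. Proof. by case: HH. Qed.
Let nH1 : d1 ∘ nH = stH. Proof. by case: HH => _ []. Qed.
Let HSG : IsPullback bK dpG stG sbG. Proof. by case: HG. Qed.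
Let nG1 : yB ∘ (bQ ∘ (qA ∘ nG)) = stG.
Proof. by case: HG => _ [<- _]; rewrite -!comp_assoc. Qed.
Let HSK : IsPullback bL dpK stK sbK. Proof. by case: HK. Qed.
Let nK1 : bA ∘ nK = stK. Proof. by case: HK => _ []. Qed.

Lemma tower_st : tgt ∘ s = ta.
Proof.
  rewrite Etgt Es -comp_assoc (comp_pre _ (pb_comm HA3)) -comp_assoc nK1.
  by rewrite (comp_pre _ wL2) Eta -!comp_assoc.
Qed.

Lemma tower_tt : tgt ∘ t = tb.
Proof.
  rewrite Etgt Et -comp_assoc (comp_pre _ (pb_comm HQ2)) -comp_assoc.
  rewrite (comp_pre _ wB2) Etb -!comp_assoc.
  by rewrite -nG1 -!comp_assoc.
Qed.

Lemma tower_ss : src ∘ s = ta ∘ (g ∘ f).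
Proof.
  rewrite Esrc Es -comp_assoc (comp_pre _ (pb_comm HA3)) -comp_assoc nK1.
  rewrite (comp_pre _ wL1) Eta -!comp_assoc.
  by rewrite (comp_pre _ g1) -!comp_assoc f1.
Qed.

Lemma tower_ts : src ∘ t = tb ∘ (f ∘ h).
Proof.
  rewrite Esrc Et -comp_assoc (comp_pre _ (pb_comm HQ2)) -comp_assoc.
  rewrite (comp_pre _ wB1) Etb -!comp_assoc.
  rewrite (comp_pre _ f1) -!comp_assoc h1 (comp_pre _ fG1) -!comp_assoc (comp_pre _ hG1).
  by rewrite -!comp_assoc.
Qed.

(** The components of a quintuple are absorbed one stage at a time, into [m0], [mH], [mG] and [mK].
    Each stage also compares the pullbacks of [u] over [X] with those over the new object, and these
    comparisons enter the next stage. *)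
Lemma tower_universal Ha Hb fo go ho ss st ts tt' :
  Universal (MkFQ u src tgt K a b SK MK ta sbK tb bM f g s h t Ha Hb fo go ho ss st ts tt').
Proof.
  move=> X [a' b' Sa' Sb' ta' ba' tb' bb' f' g' s' h' t' pa' pb' fo' go' ho' ss' st' ts' tt''].
  have [m0 [[m01 m02] Um0]] := HU2 X a' b'.
  have [j1 [j11 j12]] : exists j, t1 ∘ j = ta' /\ b1 ∘ j = m0 ∘ ba'.
    by apply: (pb_lift HY1); rewrite (pb_comm pa') -m01 comp_assoc.
  have [j1' [j11' j12']] : exists j, t1' ∘ j = tb' /\ b1' ∘ j = m0 ∘ bb'.
    by apply: (pb_lift HY1'); rewrite (pb_comm pb') -m02 comp_assoc.
  have Pj1 : IsPullback b1 m0 j1 ba' by apply: (pb_unpaste HY1) => //; rewrite m01 j11.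
  have Pj1' : IsPullback b1' m0 j1' bb' by apply: (pb_unpaste HY1') => //; rewrite m02 j11'.
  have [n1 [n11 n12]] : exists n, c1 ∘ n = j1' ∘ f' /\ d1 ∘ n = j1.
    by apply: (pb_lift HA1); rewrite comp_assoc j12' -comp_assoc fo' j12.
  have [mH [[mH1 [kH [kH1 [kH2 kH3]]]] UmH]] := proj2 (proj2 HH) X Sa' m0 j1 ba' n1 Pj1 n12.
  have [lH [lH1 lH2]] : exists l, tK ∘ l = j1' /\ bK ∘ l = mH ∘ bb'.
    by apply: (pb_lift HKH); rewrite j12' -mH1 comp_assoc.
  have PlH : IsPullback bK mH lH bb' by apply: (pb_unpaste HKH) => //; rewrite mH1 lH1.
  have PkH : IsPullback sbH mH kH ba' by apply: (pb_unpaste HSH) => //; rewrite mH1 kH1.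
  have fkH : fH ∘ kH = lH ∘ f'.
    apply: (pb_monic HKH).
    - by rewrite (comp_pre _ fH1) -comp_assoc kH3 n11 comp_assoc lH1.
    - by rewrite comp_assoc fH2 kH2 comp_assoc lH2 -comp_assoc fo'.
  have [nB [nB1 nB2]] : exists n, xB ∘ n = kH ∘ h' /\ yB ∘ n = lH.
    by apply: (pb_lift HB2); rewrite comp_assoc kH2 -comp_assoc ho' lH2.
  have [nQ [nQ1 nQ2]] : exists n, pQ ∘ n = t' /\ bQ ∘ n = nB.
    apply: (pb_lift HQ2); apply: (pb_monic HTT).
    - rewrite !comp_assoc -Esrc ts' wB1 -!comp_assoc nB1 (comp_pre _ fkH) -!comp_assoc.
      by rewrite (comp_pre _ lH1) (comp_pre _ j11').
    - by rewrite !comp_assoc -Etgt tt'' wB2 -!comp_assoc nB2 lH1 j11'.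
  have [n2 [n21 n22]] : exists n, gA ∘ n = kH ∘ g' /\ qA ∘ n = nQ.
    by apply: (pb_lift HA2); rewrite comp_assoc kH2 -!comp_assoc go' nQ2 nB2 lH2.
  have n23 : yB ∘ (bQ ∘ qA) ∘ n2 = lH by rewrite -!comp_assoc n22 nQ2.
  have [mG [[mG1 [kG [kG1 [kG2 kG3]]]] UmG]] := proj2 (proj2 HG) X Sb' mH lH bb' n2 PlH n23.
  have [lG [lG1 lG2]] : exists l, tL ∘ l = kH /\ bL ∘ l = mG ∘ ba'.
    by apply: (pb_lift HLG); rewrite kH2 -mG1 comp_assoc.
  have PlG : IsPullback bL mG lG ba' by apply: (pb_unpaste HLG) => //; rewrite mG1 lG1.
  have gkG : gG ∘ kG = lG ∘ g'.
    apply: (pb_monic HLG).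
    - by rewrite (comp_pre _ gG1) -comp_assoc kG3 n21 comp_assoc lG1.
    - by rewrite comp_assoc gG2 kG2 comp_assoc lG2 -comp_assoc go'.
  have hkG : hG ∘ kG = lG ∘ h'.
    apply: (pb_monic HLG).
    - by rewrite (comp_pre _ hG1) -!comp_assoc kG3 n22 nQ2 nB1 comp_assoc lG1.
    - by rewrite comp_assoc hG2 kG2 comp_assoc lG2 -comp_assoc ho'.
  have fkG : fG ∘ lG = kG ∘ f'.
    apply: (pb_monic HSG).
    - by rewrite (comp_pre _ fG1) -comp_assoc lG1 fkH comp_assoc kG1.
    - by rewrite comp_assoc fG2 lG2 comp_assoc kG2 -comp_assoc fo'.
  have [n3 [n31 n32]] : exists n, pA ∘ n = s' /\ bA ∘ n = lG.
    apply: (pb_lift HA3); apply: (pb_monic HTT).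
    - rewrite !comp_assoc -Esrc ss' wL1 -!comp_assoc fkG (comp_pre _ gkG) -!comp_assoc.
      by rewrite (comp_pre _ lG1) (comp_pre _ kH1) (comp_pre _ j11).
    - by rewrite !comp_assoc -Etgt st' wL2 -!comp_assoc lG1 kH1 j11.
  have [mK [[mK1 [kK [kK1 [kK2 kK3]]]] UmK]] := proj2 (proj2 HK) X Sa' mG lG ba' n3 PlG n32.
  have [lK [lK1 lK2]] : exists l, tM ∘ l = kG /\ bM ∘ l = mK ∘ bb'.
    by apply: (pb_lift HMK); rewrite kG2 -mK1 comp_assoc.
  exists mK; split.
  - split; first by rewrite /= Ea -!comp_assoc mK1 mG1 mH1.
    split; first by rewrite /= Eb -!comp_assoc mK1 mG1 mH1.
    exists kK, lK; split=> //=.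
    + by rewrite Eta -!comp_assoc kK1 lG1 kH1.
    + by rewrite Etb -!comp_assoc lK1 kG1 lH1.
    + apply: (pb_monic HMK).
      * by rewrite (comp_pre _ lK1) (comp_pre _ f1) -comp_assoc kK1 fkG.
      * by rewrite comp_assoc lK2 -comp_assoc fo' comp_assoc f2 kK2.
    + apply: (pb_monic HSK).
      * by rewrite (comp_pre _ kK1) (comp_pre _ g1) -comp_assoc lK1 gkG.
      * by rewrite comp_assoc kK2 -comp_assoc go' comp_assoc g2 lK2.
    + by rewrite Es -comp_assoc kK3 n31.
    + apply: (pb_monic HSK).
      * by rewrite (comp_pre _ kK1) (comp_pre _ h1) -comp_assoc lK1 hkG.
      * by rewrite comp_assoc kK2 -comp_assoc ho' comp_assoc h2 lK2.
    + by rewrite Et -!comp_assoc lK1 kG3 n22 nQ1.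
  (* Uniqueness follows the same stages: once the map into one object of the tower is determined, so
     are the comparison maps into its pullbacks, which the next stage requires. *)
  - move=> m' [/= ea' [/= eb' [ka [kb [/= r1 r2 r3 r4 r5 r6 r7 r8 r9]]]]].
    have em0 : dpH ∘ (dpG ∘ (dpK ∘ m')) = m0.
      apply: Um0; [rewrite -ea' /= Ea | rewrite -eb' /= Eb]; by rewrite -!comp_assoc.
    have q1 : bL ∘ (stK ∘ ka) = dpK ∘ (m' ∘ ba').
      by rewrite (comp_pre _ (pb_comm HSK)) -comp_assoc r2.
    have q2 : sbG ∘ (tM ∘ kb) = dpK ∘ (m' ∘ bb').
      by rewrite (comp_pre _ (pb_comm HMK)) -comp_assoc r4.
    have q3 : sbH ∘ (tL ∘ (stK ∘ ka)) = dpG ∘ (dpK ∘ (m' ∘ ba')).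
      by rewrite (comp_pre _ (pb_comm HLG)) -comp_assoc q1.
    have q4 : bK ∘ (stG ∘ (tM ∘ kb)) = dpG ∘ (dpK ∘ (m' ∘ bb')).
      by rewrite (comp_pre _ (pb_comm HSG)) -comp_assoc q2.
    have ej1' : tK ∘ (stG ∘ (tM ∘ kb)) = j1'.
      apply: (pb_monic HY1'); first by rewrite j11' -r3 Etb -!comp_assoc.
      by rewrite (comp_pre _ (pb_comm HKH)) -comp_assoc q4 j12' -em0 -!comp_assoc.
    have ej1 : stH ∘ (tL ∘ (stK ∘ ka)) = j1.
      apply: (pb_monic HY1); first by rewrite j11 -r1 Eta -!comp_assoc.
      by rewrite (comp_pre _ (pb_comm HSH)) -comp_assoc q3 j12 -em0 -!comp_assoc.
    have emH : dpG ∘ (dpK ∘ m') = mH.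
      apply: UmH => //; exists (tL ∘ (stK ∘ ka)); split=> //.
      split; first by rewrite q3 -!comp_assoc.
      apply: (pb_monic HA1); last by rewrite comp_assoc nH1 ej1 n12.
      rewrite (comp_pre _ (eq_sym fH1)) -comp_assoc (comp_pre _ (eq_sym fG1)) -!comp_assoc.
      rewrite (comp_pre _ (eq_sym f1)) -!comp_assoc -r5 n11 -ej1'.
      by rewrite -!comp_assoc.
    have ekH : tL ∘ (stK ∘ ka) = kH.
      apply: (pb_monic HSH); first by rewrite ej1 kH1.
      by rewrite q3 kH2 -emH -!comp_assoc.
    have elH : stG ∘ (tM ∘ kb) = lH.
      apply: (pb_monic HKH); first by rewrite ej1' lH1.
      by rewrite q4 lH2 -emH -!comp_assoc.
    have emG : dpK ∘ m' = mG.
      apply: UmG => //; exists (tM ∘ kb); split=> //.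
      split; first by rewrite q2 -!comp_assoc.
      apply: (pb_monic HA2).
      + rewrite (comp_pre _ (eq_sym gG1)) -comp_assoc (comp_pre _ (eq_sym g1)) -comp_assoc -r6.
        by rewrite n21 -ekH -!comp_assoc.
      + rewrite n22; apply: (pb_monic HQ2); first by rewrite nQ1 r9 Et -!comp_assoc.
        rewrite nQ2; apply: (pb_monic HB2).
        * have -> : xB ∘ (bQ ∘ (qA ∘ (nG ∘ (tM ∘ kb)))) = tL ∘ (hG ∘ (tM ∘ kb)).
            by rewrite (comp_pre _ hG1) -!comp_assoc.
          by rewrite (comp_pre _ (eq_sym h1)) -comp_assoc -r8 nB1 -ekH -!comp_assoc.
        * rewrite nB2 -elH.
          have -> : yB ∘ (bQ ∘ (qA ∘ (nG ∘ (tM ∘ kb)))) = stG ∘ (tM ∘ kb).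
            by rewrite -nG1 -!comp_assoc.
          by [].
    apply: UmK => //; exists ka.
    have elG : stK ∘ ka = lG.
      apply: (pb_monic HLG); first by rewrite ekH lG1.
      by rewrite q1 lG2 -emG -!comp_assoc.
    do 2!split=> //; apply: (pb_monic HA3); first by rewrite n31 r7 Es -comp_assoc.
    by rewrite comp_assoc nK1 elG n32.
Qed.

End Tower.

(** * Universal quintuples from dependent products, and their preservation *)

Lemma product_of_pullback {C : Category} {A B Z S : C} {a : Hom A Z} {b : Hom B Z}
    {p0 : Hom S A} {p1 : Hom S B} :
  IsTerminal Z -> IsPullback a b p0 p1 -> IsProduct p0 p1.
Proof.
  move=> HZ [_ H] X x y; apply: H.
  by have [t Ht] := HZ X; rewrite (Ht (a ∘ x)) (Ht (b ∘ y)).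
Qed.

Lemma universal_fq_ex {C : TTFC} {T U : C} (u : Hom T U) (Hu : fib u) (P : PathObject u) :
  exists (X0 : C) (Q : FQ u (po_src P) (po_tgt P) X0), Universal Q /\
    forall (D : FibCat) (F : Functor C D), IsTTFunctor F ->
      forall Ha Hb, Universal (map_fq F Q Ha Hb).
Proof.
  have [Z HZ] := @terminal_ex C; have [tU _] := HZ U.
  have HtU : fib tU by apply: fib_to_terminal.
  have [U2 [π0 [π1 [HU2 _]]]] := pb_ex tU tU HtU.
  have HTT := pb_is (po_sq P).
  have [Y1 [t1 [b1 [HY1 fb1]]]] := pb_ex u π0 Hu.
  have [Y1' [t1' [b1' [HY1' fb1']]]] := pb_ex u π1 Hu.
  have [A1 [c1 [d1 [HA1 fd1]]]] := pb_ex b1' b1 fb1'.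
  have [H [SH [dpH [stH [sbH [nH [fdpH [HH HHF]]]]]]]] := udp_ex d1 b1 fd1 fb1.
  have [HSH [nH1 _]] := HH.
  have [KH [tK [bK [HKH fbK]]]] := pb_ex b1' dpH fb1'.
  have [fH [fH1 fH2]] : exists fH, tK ∘ fH = c1 ∘ nH /\ bK ∘ fH = sbH.
    by apply: (pb_lift HKH); rewrite comp_assoc (pb_comm HA1) -comp_assoc nH1 (pb_comm HSH).
  have fsbH : fib sbH := pb_fib HSH fb1.
  have [B2 [xB [yB [HB2 fyB]]]] := pb_ex sbH bK fsbH.
  have [wB [wB1 wB2]] : exists wB, pb_top (po_sq P) ∘ wB = t1' ∘ (tK ∘ (fH ∘ xB)) /\
      pb_base (po_sq P) ∘ wB = t1' ∘ (tK ∘ yB).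
    apply: (pb_lift HTT); rewrite !(comp_pre _ (pb_comm HY1')) -!comp_assoc.
    rewrite !(comp_pre _ (pb_comm HKH)) -!comp_assoc (comp_pre _ fH2).
    by rewrite (pb_comm HB2).
  have [Q2 [pQ [bQ [HQ2 fbQ]]]] := pb_ex (po_bd P) wB (po_bd_fib _ P).
  have [A2 [gA [qA [HA2 fqA]]]] := pb_ex sbH (bK ∘ (yB ∘ bQ)) fsbH.
  have fA2 : fib (yB ∘ (bQ ∘ qA)) by do 2!apply: fib_comp => //.
  have [G [SG [dpG [stG [sbG [nG [fdpG [HG HGF]]]]]]]] := udp_ex _ bK fA2 fbK.
  have [HSG [nG1 _]] := HG; rewrite -!comp_assoc in nG1.
  have [LG [tL [bL [HLG fbL]]]] := pb_ex sbH dpG fsbH.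
  have [gG [gG1 gG2]] : exists g, tL ∘ g = gA ∘ nG /\ bL ∘ g = sbG.
    apply: (pb_lift HLG).
    by rewrite (comp_pre _ (pb_comm HA2)) -!comp_assoc nG1 (pb_comm HSG).
  have [hG [hG1 hG2]] : exists g, tL ∘ g = xB ∘ (bQ ∘ (qA ∘ nG)) /\ bL ∘ g = sbG.
    apply: (pb_lift HLG).
    by rewrite (comp_pre _ (pb_comm HB2)) -!comp_assoc nG1 (pb_comm HSG).
  have [fG [fG1 fG2]] : exists g, stG ∘ g = fH ∘ tL /\ sbG ∘ g = bL.
    by apply: (pb_lift HSG); rewrite comp_assoc fH2 (pb_comm HLG).
  have [wL [wL1 wL2]] : exists w, pb_top (po_sq P) ∘ w = t1 ∘ (stH ∘ (tL ∘ (gG ∘ fG))) /\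
      pb_base (po_sq P) ∘ w = t1 ∘ (stH ∘ tL).
    apply: (pb_lift HTT); rewrite !(comp_pre _ (pb_comm HY1)) -!comp_assoc.
    rewrite !(comp_pre _ (pb_comm HSH)) -!comp_assoc !(comp_pre _ (pb_comm HLG)) -!comp_assoc.
    by rewrite (comp_pre _ gG2) fG2 (pb_comm HLG).
  have [A3 [pA [bA [HA3 fbA]]]] := pb_ex (po_bd P) wL (po_bd_fib _ P).
  have [K [SK [dpK [stK [sbK [nK [fdpK [HK HKF]]]]]]]] := udp_ex bA bL fbA fbL.
  have [HSK [nK1 _]] := HK.
  have fsbG : fib sbG := pb_fib HSG fbK.
  have [MK [tM [bM [HMK fbM]]]] := pb_ex sbG dpK fsbG.
  have [f [f1 f2]] : exists f, tM ∘ f = fG ∘ stK /\ bM ∘ f = sbK.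
    by apply: (pb_lift HMK); rewrite comp_assoc fG2 (pb_comm HSK).
  have [g [g1 g2]] : exists g, stK ∘ g = gG ∘ tM /\ sbK ∘ g = bM.
    by apply: (pb_lift HSK); rewrite comp_assoc gG2 (pb_comm HMK).
  have [h [h1 h2]] : exists h, stK ∘ h = hG ∘ tM /\ sbK ∘ h = bM.
    by apply: (pb_lift HSK); rewrite comp_assoc hG2 (pb_comm HMK).
  set a := π0 ∘ (dpH ∘ (dpG ∘ dpK)); set b := π1 ∘ (dpH ∘ (dpG ∘ dpK)).
  set ta := t1 ∘ (stH ∘ (tL ∘ stK)); set tb := t1' ∘ (tK ∘ (stG ∘ tM)).
  set s := pA ∘ nK; set t := pQ ∘ (qA ∘ (nG ∘ tM)).
  have go : sbK ∘ g = bM by []. have ho : sbK ∘ h = bM by [].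
  have Pa := tower_pa HY1 HH HLG HK (eq_refl a) (eq_refl ta).
  have Pb := tower_pb HY1' HKH HG HMK (eq_refl b) (eq_refl tb).
  have ss := tower_ss (eq_refl (po_src P)) wL1 HA3 HK (eq_refl ta) f1 g1 (eq_refl s).
  have st := tower_st (eq_refl (po_tgt P)) wL2 HA3 HK (eq_refl ta) (eq_refl s).
  have ts := tower_ts (eq_refl (po_src P)) wB1 HQ2 hG1 fG1 (eq_refl tb) f1 h1 (eq_refl t).
  have tt' := tower_tt (eq_refl (po_tgt P)) wB2 HQ2 HG (eq_refl tb) (eq_refl t).
  exists K, (MkFQ u (po_src P) (po_tgt P) K a b SK MK ta sbK tb bM f g s h t Pa Pb f2 go ho
    ss st ts tt'); split.
  - exact: (tower_universal HTT (eq_refl _) (eq_refl _) (product_of_pullback HZ HU2) HY1 HY1' HA1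
      HH HKH fH1 fH2 HB2 wB1 wB2 HQ2 HA2 HG HLG gG1 gG2 hG1 hG2 fG1 fG2 wL1 wL2 HA3 HK HMK
      (eq_refl a) (eq_refl b) (eq_refl ta) (eq_refl tb) f1 f2 g1 g2 h1 h2 (eq_refl s) (eq_refl t)).
  (* Each stage is a pullback of a fibration or a dependent product, so the images satisfy the
     hypotheses of [tower_universal] in [D]. The tower is stated for a plain category for this
     purpose. *)
  - move=> D F HF.
    have FPB (W1 W2 W3 W4 : C) (q : Hom W1 W2) (c : Hom W3 W2) (k : Hom W4 W1) (l : Hom W4 W3) :
        fib q -> IsPullback q c k l ->
        IsPullback (fmap F q) (fmap F c) (fmap F k) (fmap F l).
      by move=> Hq R; apply: (ttf_pb _ HF _ _ _ _ _ (Build_PB _ _ _ _ _ _ W4 k l R)).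
    have F2 (W1 W2 W3 W4 : C) (q : Hom W1 W2) (c : Hom W3 W2) (k : Hom W4 W1) (l : Hom W4 W3) :
        q ∘ k = c ∘ l -> fmap F q ∘ fmap F k = fmap F c ∘ fmap F l.
      exact: fmap_eq2.
    have GA2 := FPB _ _ _ _ _ _ _ _ fsbH HA2; rewrite !fmap_comp in GA2.
    have GG := HGF D F HF; rewrite !fmap_comp in GG.
    have GU := FPB _ _ _ _ _ _ _ _ HtU HU2.
    rewrite /map_fq => Ha Hb.
    apply: (tower_universal (FPB _ _ _ _ _ _ _ _ Hu HTT) _ _
      (product_of_pullback (ttf_terminal _ HF _ HZ) GU)
      (FPB _ _ _ _ _ _ _ _ Hu HY1) (FPB _ _ _ _ _ _ _ _ Hu HY1')
      (FPB _ _ _ _ _ _ _ _ fb1' HA1) (HHF D F HF) (FPB _ _ _ _ _ _ _ _ fb1' HKH)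
      (fmap_eq2 F fH1) (fmap_eq1 F fH2) (FPB _ _ _ _ _ _ _ _ fsbH HB2)
      (wB := fmap F wB) _ _ (FPB _ _ _ _ _ _ _ _ (po_bd_fib _ P) HQ2) GA2 GG
      (FPB _ _ _ _ _ _ _ _ fsbH HLG) (fmap_eq2 F gG1) (fmap_eq1 F gG2) (hG := fmap F hG) _ (fmap_eq1 F hG2)
      (fmap_eq2 F fG1) (fmap_eq1 F fG2) (wL := fmap F wL) _ _
      (FPB _ _ _ _ _ _ _ _ (po_bd_fib _ P) HA3) (HKF D F HF)
      (FPB _ _ _ _ _ _ _ _ fsbG HMK) _ _ _ _ (fmap_eq2 F f1) (fmap_eq1 F f2)
      (fmap_eq2 F g1) (fmap_eq1 F g2) (fmap_eq2 F h1) (fmap_eq1 F h2) _ _);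
      rewrite -!fmap_comp //.
    + by rewrite wB1.
    + by rewrite wB2.
    + by rewrite hG1.
    + by rewrite wL1.
    + by rewrite wL2.
Qed.

(** Preservation is known for the quintuple built by the tower; the isomorphism with it carries this
    over to an arbitrary [Q]. *)
Lemma universal_preserved {C : TTFC} {D : FibCat} (F : Functor C D) {T U X : C}
    {u : Hom T U} (P : PathObject u) (Q : FQ u (po_src P) (po_tgt P) X) Ha Hb :
  fib u -> IsTTFunctor F -> Universal Q -> Universal (map_fq F Q Ha Hb).
Proof.
  move=> Hu HF HQ; have [X0 [Q0 [U0 UF]]] := universal_fq_ex u Hu P.
  have FPB (a : Hom X0 U) (S : C) (t : Hom S T) (b : Hom S X0) : IsPullback u a t b ->
      IsPullback (fmap F u) (fmap F a) (fmap F t) (fmap F b).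
    by move=> R; apply: (ttf_pb _ HF _ _ _ _ _ (Build_PB _ _ _ _ _ _ S t b R)).
  exact: (universal_map F (FPB _ _ _ _ (fq_pa Q0)) (FPB _ _ _ _ (fq_pb Q0)) Ha Hb U0 HQ
    (UF D F HF _ _)).
Qed.

(** * The equivalence object of the induced fibration *)

Section ChangeOfBaseEquiv.
Context {A E B : TTFC} {p : Functor E B} (Hp : IsFibredTTFC p) {F : Functor A B}
  (HFpb : PreservesPBofFib F).
Local Notation D := (ChangeOfBase p F).
Context {X Y : D} {z : Hom X Y} {W' W : E} {w : Hom W' W} {cX : Hom (cb_tot X) W'}
  {cY : Hom (cb_tot Y) W} (HcX : Cartesian p cX) (HcY : Cartesian p cY)
  (ez : w ∘ cX = cY ∘ cb_snd z) (Hz : fib z) (Hw : fib w)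
  (HP : IsPullback (fmap p w) (chi cY) (chi cX) (fmap F (cb_fst z))).
Context {PV : PathObject (cb_fst z)} {PW : PathObject w} {R : PathObject z}.
Context {i : Hom (cb_base (po_ob R)) (po_ob PV)} {j : Hom (po_ob PV) (cb_base (po_ob R))}
  (ji : j ∘ i = idm _) (ij : i ∘ j = idm _)
  (i_src : po_src PV ∘ i = cb_fst (po_src R)) (i_tgt : po_tgt PV ∘ i = cb_fst (po_tgt R)).
Context {c : Hom (cb_tot (po_ob R)) (po_ob PW)} (Hc : Cartesian p c)
  (c_src : po_src PW ∘ c = cX ∘ cb_snd (po_src R))
  (c_tgt : po_tgt PW ∘ c = cX ∘ cb_snd (po_tgt R)).

Lemma total_pullback : IsPullback w cY cX (cb_snd z).
Proof.
  apply: (cart_pullback (p := p)) => //; rewrite (fmap_chi cX) (fmap_chi cY); apply: pb_paste HP _.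
  apply: pb_sym; apply: pb_of_isos; [exact: iso_idto | exact: iso_idto |].
  exact: (cb_above _ _ _ _ z).
Qed.

Definition fst_fq {O : D} (Q : FQ z (po_src R) (po_tgt R) O) :
    FQ (cb_fst z) (po_src PV) (po_tgt PV) (cb_base O).
Proof.
  refine (MkFQ (cb_fst z) (po_src PV) (po_tgt PV) (cb_base O) (cb_fst (fq_a Q))
    (cb_fst (fq_b Q)) _ _ (cb_fst (fq_ta Q)) (cb_fst (fq_ba Q)) (cb_fst (fq_tb Q))
    (cb_fst (fq_bb Q)) (cb_fst (fq_f Q)) (cb_fst (fq_g Q)) (i ∘ cb_fst (fq_s Q))
    (cb_fst (fq_h Q)) (i ∘ cb_fst (fq_t Q))
    (proj1 (cb_pullback_components Hp HFpb Hz (fq_pa Q)))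
    (proj1 (cb_pullback_components Hp HFpb Hz (fq_pb Q)))
    (f_equal cb_fst (fq_fo Q)) (f_equal cb_fst (fq_go Q)) (f_equal cb_fst (fq_ho Q))
    _ _ _ _); rewrite comp_assoc ?i_src ?i_tgt.
  - exact: (f_equal cb_fst (fq_ss Q)).
  - exact: (f_equal cb_fst (fq_st Q)).
  - exact: (f_equal cb_fst (fq_ts Q)).
  - exact: (f_equal cb_fst (fq_tt Q)).
Defined.

(** The result is a quintuple for [w] and not for [cb_snd z]: the latter is a pullback of [w], and
    [QW] classifies quintuples for [w]. *)
Definition snd_fq {O : D} (Q : FQ z (po_src R) (po_tgt R) O) :
    FQ w (po_src PW) (po_tgt PW) (cb_tot O).
Proof.
  refine (MkFQ w (po_src PW) (po_tgt PW) (cb_tot O) (cY ∘ cb_snd (fq_a Q))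
    (cY ∘ cb_snd (fq_b Q)) _ _ (cX ∘ cb_snd (fq_ta Q)) (cb_snd (fq_ba Q))
    (cX ∘ cb_snd (fq_tb Q)) (cb_snd (fq_bb Q)) (cb_snd (fq_f Q)) (cb_snd (fq_g Q))
    (c ∘ cb_snd (fq_s Q)) (cb_snd (fq_h Q)) (c ∘ cb_snd (fq_t Q))
    (pb_paste total_pullback (proj2 (cb_pullback_components Hp HFpb Hz (fq_pa Q))))
    (pb_paste total_pullback (proj2 (cb_pullback_components Hp HFpb Hz (fq_pb Q))))
    (f_equal cb_snd (fq_fo Q)) (f_equal cb_snd (fq_go Q)) (f_equal cb_snd (fq_ho Q))
    _ _ _ _); rewrite comp_assoc ?c_src ?c_tgt;
    refine (eq_trans (eq_sym (comp_assoc _ _ _ _ _ _ _ _)) _).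
  - exact: (eq_trans (f_equal (comp cX) (f_equal cb_snd (fq_ss Q))) (comp_assoc _ _ _ _ _ _ _ _)).
  - exact: (f_equal (comp cX) (f_equal cb_snd (fq_st Q))).
  - exact: (eq_trans (f_equal (comp cX) (f_equal cb_snd (fq_ts Q))) (comp_assoc _ _ _ _ _ _ _ _)).
  - exact: (f_equal (comp cX) (f_equal cb_snd (fq_tt Q))).
Defined.

(** The map along which [PW] is reindexed to give the total part of [R], read on [PV] in place of
    the base of [R]. *)
Let th : Hom (F (po_ob PV)) (p (po_ob PW)) := chi c ∘ fmap F j.

Let th_src : fmap p (po_src PW) ∘ th = chi cX ∘ fmap F (po_src PV).
Proof.
  by rewrite /th comp_assoc -chi_post c_src chi_pre -comp_assoc -fmap_comp -i_src -comp_assoc ij comp_id_r.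
Qed.

Let th_tgt : fmap p (po_tgt PW) ∘ th = chi cX ∘ fmap F (po_tgt PV).
Proof.
  by rewrite /th comp_assoc -chi_post c_tgt chi_pre -comp_assoc -fmap_comp -i_tgt -comp_assoc ij comp_id_r.
Qed.

Let th_i : th ∘ fmap F i = chi c.
Proof. by rewrite /th -comp_assoc -fmap_comp ji fmap_id comp_id_r. Qed.

Context {EV : A} (QV : FQ (cb_fst z) (po_src PV) (po_tgt PV) EV) (UV : Universal QV).
Context {EW : E} (QW : FQ w (po_src PW) (po_tgt PW) EW) (UW : Universal QW).

Let FPB {S I : A} (a : Hom I (cb_base Y)) (t : Hom S (cb_base X)) (b : Hom S I) :
  IsPullback (cb_fst z) a t b ->
  IsPullback (fmap F (cb_fst z)) (fmap F a) (fmap F t) (fmap F b).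
Proof.
  by move=> H; apply: (HFpb _ _ _ _ _ (Build_PB _ _ _ _ _ _ S t b H)); case: Hz.
Qed.

Lemma cb_universal_ex :
  exists (EZ2 : E) (e : p EZ2 = F EV) (cE : Hom EZ2 EW)
    (QZ : FQ z (po_src R) (po_tgt R) (CbOb EV EZ2 e : D)),
    Cartesian p cE /\
    (cb_fst (fq_a QZ) = fq_a QV /\ cY ∘ cb_snd (fq_a QZ) = fq_a QW ∘ cE) /\
    (cb_fst (fq_b QZ) = fq_b QV /\ cY ∘ cb_snd (fq_b QZ) = fq_b QW ∘ cE) /\
    Universal QZ /\
    forall (O : D) (Q : FQ z (po_src R) (po_tgt R) O) (m : Hom O (CbOb EV EZ2 e : D)),
      Restricts m QZ Q ->
      Restricts (cb_fst m) QV (fst_fq Q) /\ Restricts (cE ∘ cb_snd m) QW (snd_fq Q).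
Proof.
  have pPB (S I : E) (a : Hom I W) (t : Hom S W') (b : Hom S I) (H : IsPullback w a t b) :=
    p_pb Hp Hw H.
  set FQV := map_fq F QV (FPB _ _ _ (fq_pa QV)) (FPB _ _ _ (fq_pb QV)).
  set pQW := map_fq p QW (pPB _ _ _ _ _ (fq_pa QW)) (pPB _ _ _ _ _ (fq_pb QW)).
  have UpW : Universal pQW := universal_preserved p PW QW _ _ Hw (fib_ttf _ Hp) UW.
  set PQV := push_fq (chi cY) (chi cX) th HP th_src th_tgt FQV.
  have [χ [RχA _]] := UpW _ PQV.
  (* [ka] and [kb] compare the two pullbacks carried by [PQV] with those over [p(E(w))]. The total
     parts of the pullbacks over [EZ] are reindexed along them. *)
  have [/= xa [/= xb [ka [kb [/= ka1 ka2 kb1 kb2 kf kg ks kh kt]]]]] := RχA.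
  have [EZ2 [e [cE [HcE ecE]]]] := cb_ex Hp EV χ.
  have [Sa2 [ea [cSa [HcSa ecSa]]]] := cb_ex Hp _ ka.
  have [Sb2 [eb [cSb [HcSb ecSb]]]] := cb_ex Hp _ kb.
  set EZ : D := CbOb EV EZ2 e in ecE.
  set SaZ : D := CbOb _ Sa2 ea in ecSa; set SbZ : D := CbOb _ Sb2 eb in ecSb.
  have [aZ [aZ1 aZ2]] : exists a : Hom EZ Y, cb_fst a = fq_a QV /\ cY ∘ cb_snd a = fq_a QW ∘ cE.
    by apply: cb_lift => //; rewrite chi_post ecE.
  have [bZ [bZ1 bZ2]] : exists a : Hom EZ Y, cb_fst a = fq_b QV /\ cY ∘ cb_snd a = fq_b QW ∘ cE.
    by apply: cb_lift => //; rewrite chi_post ecE.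
  have [taZ [taZ1 taZ2]] : exists a : Hom SaZ X,
      cb_fst a = fq_ta QV /\ cX ∘ cb_snd a = fq_ta QW ∘ cSa.
    by apply: cb_lift => //; rewrite chi_post ecSa.
  have [tbZ [tbZ1 tbZ2]] : exists a : Hom SbZ X,
      cb_fst a = fq_tb QV /\ cX ∘ cb_snd a = fq_tb QW ∘ cSb.
    by apply: cb_lift => //; rewrite chi_post ecSb.
  have [baZ [baZ1 baZ2]] : exists a : Hom SaZ EZ,
      cb_fst a = fq_ba QV /\ cE ∘ cb_snd a = fq_ba QW ∘ cSa.
    by apply: cb_lift => //; rewrite chi_post ecE ecSa.
  have [bbZ [bbZ1 bbZ2]] : exists a : Hom SbZ EZ,
      cb_fst a = fq_bb QV /\ cE ∘ cb_snd a = fq_bb QW ∘ cSb.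
    by apply: cb_lift => //; rewrite chi_post ecE ecSb.
  have [fZ [fZ1 fZ2]] : exists a : Hom SaZ SbZ,
      cb_fst a = fq_f QV /\ cSb ∘ cb_snd a = fq_f QW ∘ cSa.
    by apply: cb_lift => //; rewrite chi_post ecSb ecSa.
  have [gZ [gZ1 gZ2]] : exists a : Hom SbZ SaZ,
      cb_fst a = fq_g QV /\ cSa ∘ cb_snd a = fq_g QW ∘ cSb.
    by apply: cb_lift => //; rewrite chi_post ecSb ecSa.
  have [hZ [hZ1 hZ2]] : exists a : Hom SbZ SaZ,
      cb_fst a = fq_h QV /\ cSa ∘ cb_snd a = fq_h QW ∘ cSb.
    by apply: cb_lift => //; rewrite chi_post ecSb ecSa.
  have [sZ [sZ1 sZ2]] : exists a : Hom SaZ (po_ob R),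
      cb_fst a = j ∘ fq_s QV /\ c ∘ cb_snd a = fq_s QW ∘ cSa.
    by apply: cb_lift => //; rewrite chi_post ecSa fmap_comp comp_assoc ks.
  have [tZ [tZ1 tZ2]] : exists a : Hom SbZ (po_ob R),
      cb_fst a = j ∘ fq_t QV /\ c ∘ cb_snd a = fq_t QW ∘ cSb.
    by apply: cb_lift => //; rewrite chi_post ecSb fmap_comp comp_assoc kt.
  have Pa : IsPullback z aZ taZ baZ.
    apply: (cb_pullback z aZ w (fq_a QW) cX cY cE HcX HcY HcE ez (eq_sym aZ2) (S := SaZ) cSa
      (t0 := fq_ta QW) (b0 := fq_ba QW)) => //.
    + by rewrite aZ1 taZ1 baZ1; exact: fq_pa.
    + exact: fq_pa.
    + exact: (pPB _ _ _ _ _ (fq_pa QW)).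
  have Pb : IsPullback z bZ tbZ bbZ.
    apply: (cb_pullback z bZ w (fq_b QW) cX cY cE HcX HcY HcE ez (eq_sym bZ2) (S := SbZ) cSb
      (t0 := fq_tb QW) (b0 := fq_bb QW)) => //.
    + by rewrite bZ1 tbZ1 bbZ1; exact: fq_pb.
    + exact: fq_pb.
    + exact: (pPB _ _ _ _ _ (fq_pb QW)).
  have fo : bbZ ∘ fZ = baZ.
    apply: (cb_monic (O := EZ) _ _ HcE) => /=; first by rewrite bbZ1 fZ1 baZ1 fq_fo.
    by rewrite comp_assoc bbZ2 -comp_assoc fZ2 comp_assoc fq_fo baZ2.
  have go : baZ ∘ gZ = bbZ.
    apply: (cb_monic (O := EZ) _ _ HcE) => /=; first by rewrite bbZ1 gZ1 baZ1 fq_go.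
    by rewrite comp_assoc baZ2 -comp_assoc gZ2 comp_assoc fq_go bbZ2.
  have ho : baZ ∘ hZ = bbZ.
    apply: (cb_monic (O := EZ) _ _ HcE) => /=; first by rewrite bbZ1 hZ1 baZ1 fq_ho.
    by rewrite comp_assoc baZ2 -comp_assoc hZ2 comp_assoc fq_ho bbZ2.
  have ss : po_src R ∘ sZ = taZ ∘ (gZ ∘ fZ).
    apply: (cb_monic _ _ HcX).
    - change (cb_fst (po_src R) ∘ cb_fst sZ = cb_fst taZ ∘ (cb_fst gZ ∘ cb_fst fZ)).
      by rewrite -i_src sZ1 taZ1 gZ1 fZ1 -comp_assoc (comp_pre _ ij) comp_id_l fq_ss.
    - change (cX ∘ (cb_snd (po_src R) ∘ cb_snd sZ)
        = cX ∘ (cb_snd taZ ∘ (cb_snd gZ ∘ cb_snd fZ))).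
      rewrite (comp_pre _ (eq_sym c_src)) -comp_assoc sZ2 (comp_pre _ (fq_ss QW)).
      by rewrite (comp_pre _ taZ2) -!comp_assoc (comp_pre _ gZ2) -!comp_assoc fZ2.
  have st : po_tgt R ∘ sZ = taZ.
    apply: (cb_monic _ _ HcX).
    - change (cb_fst (po_tgt R) ∘ cb_fst sZ = cb_fst taZ).
      by rewrite -i_tgt sZ1 taZ1 -comp_assoc (comp_pre _ ij) comp_id_l fq_st.
    - change (cX ∘ (cb_snd (po_tgt R) ∘ cb_snd sZ) = cX ∘ cb_snd taZ).
      by rewrite (comp_pre _ (eq_sym c_tgt)) -comp_assoc sZ2 (comp_pre _ (fq_st QW)) taZ2.
  have ts : po_src R ∘ tZ = tbZ ∘ (fZ ∘ hZ).
    apply: (cb_monic _ _ HcX).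
    - change (cb_fst (po_src R) ∘ cb_fst tZ = cb_fst tbZ ∘ (cb_fst fZ ∘ cb_fst hZ)).
      by rewrite -i_src tZ1 tbZ1 hZ1 fZ1 -comp_assoc (comp_pre _ ij) comp_id_l fq_ts.
    - change (cX ∘ (cb_snd (po_src R) ∘ cb_snd tZ)
        = cX ∘ (cb_snd tbZ ∘ (cb_snd fZ ∘ cb_snd hZ))).
      rewrite (comp_pre _ (eq_sym c_src)) -comp_assoc tZ2 (comp_pre _ (fq_ts QW)).
      by rewrite (comp_pre _ tbZ2) -!comp_assoc (comp_pre _ fZ2) -!comp_assoc hZ2.
  have tt' : po_tgt R ∘ tZ = tbZ.
    apply: (cb_monic _ _ HcX).
    - change (cb_fst (po_tgt R) ∘ cb_fst tZ = cb_fst tbZ).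
      by rewrite -i_tgt tZ1 tbZ1 -comp_assoc (comp_pre _ ij) comp_id_l fq_tt.
    - change (cX ∘ (cb_snd (po_tgt R) ∘ cb_snd tZ) = cX ∘ cb_snd tbZ).
      by rewrite (comp_pre _ (eq_sym c_tgt)) -comp_assoc tZ2 (comp_pre _ (fq_tt QW)) tbZ2.
  set QZ := MkFQ z (po_src R) (po_tgt R) EZ aZ bZ SaZ SbZ taZ baZ tbZ bbZ fZ gZ sZ hZ tZ Pa Pb
    fo go ho ss st ts tt'.
  have split_restr (O : D) (Q : FQ z (po_src R) (po_tgt R) O) (m : Hom O EZ) :
      Restricts m QZ Q ->
      Restricts (cb_fst m) QV (fst_fq Q) /\ Restricts (cE ∘ cb_snd m) QW (snd_fq Q).
    move=> [ma [mb [la [lb [l1 l2 l3 l4 l5 l6 l7 l8 l9]]]]].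
    split.
    - split; first by rewrite -aZ1; exact: (f_equal cb_fst ma).
      split; first by rewrite -bZ1; exact: (f_equal cb_fst mb).
      exists (cb_fst la), (cb_fst lb); split.
      + by rewrite -taZ1; exact: (f_equal cb_fst l1).
      + by rewrite -baZ1; exact: (f_equal cb_fst l2).
      + by rewrite -tbZ1; exact: (f_equal cb_fst l3).
      + by rewrite -bbZ1; exact: (f_equal cb_fst l4).
      + by rewrite -fZ1; exact: (f_equal cb_fst l5).
      + by rewrite -gZ1; exact: (f_equal cb_fst l6).
      + have e7 : cb_fst (fq_s Q) = cb_fst sZ ∘ cb_fst la := f_equal cb_fst l7.
        by rewrite /= e7 sZ1 -comp_assoc (comp_pre _ ij) comp_id_l.
      + by rewrite -hZ1; exact: (f_equal cb_fst l8).
      + have e9 : cb_fst (fq_t Q) = cb_fst tZ ∘ cb_fst lb := f_equal cb_fst l9.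
        by rewrite /= e9 tZ1 -comp_assoc (comp_pre _ ij) comp_id_l.
    - have ea' : cb_snd aZ ∘ cb_snd m = cb_snd (fq_a Q) := f_equal cb_snd ma.
      have eb' : cb_snd bZ ∘ cb_snd m = cb_snd (fq_b Q) := f_equal cb_snd mb.
      have e1 : cb_snd taZ ∘ cb_snd la = cb_snd (fq_ta Q) := f_equal cb_snd l1.
      have e2 : cb_snd baZ ∘ cb_snd la = cb_snd m ∘ cb_snd (fq_ba Q) := f_equal cb_snd l2.
      have e3 : cb_snd tbZ ∘ cb_snd lb = cb_snd (fq_tb Q) := f_equal cb_snd l3.
      have e4 : cb_snd bbZ ∘ cb_snd lb = cb_snd m ∘ cb_snd (fq_bb Q) := f_equal cb_snd l4.
      have e5 : cb_snd lb ∘ cb_snd (fq_f Q) = cb_snd fZ ∘ cb_snd la := f_equal cb_snd l5.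
      have e6 : cb_snd la ∘ cb_snd (fq_g Q) = cb_snd gZ ∘ cb_snd lb := f_equal cb_snd l6.
      have e7 : cb_snd (fq_s Q) = cb_snd sZ ∘ cb_snd la := f_equal cb_snd l7.
      have e8 : cb_snd la ∘ cb_snd (fq_h Q) = cb_snd hZ ∘ cb_snd lb := f_equal cb_snd l8.
      have e9 : cb_snd (fq_t Q) = cb_snd tZ ∘ cb_snd lb := f_equal cb_snd l9.
      split; first by rewrite /= -ea' comp_assoc -aZ2 -comp_assoc.
      split; first by rewrite /= -eb' comp_assoc -bZ2 -comp_assoc.
      exists (cSa ∘ cb_snd la), (cSb ∘ cb_snd lb); split=> /=.
      + by rewrite comp_assoc -taZ2 -comp_assoc e1.
      + by rewrite (comp_pre _ (eq_sym baZ2)) -!comp_assoc e2.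
      + by rewrite comp_assoc -tbZ2 -comp_assoc e3.
      + by rewrite (comp_pre _ (eq_sym bbZ2)) -!comp_assoc e4.
      + by rewrite -comp_assoc e5 !comp_assoc fZ2.
      + by rewrite -comp_assoc e6 !comp_assoc gZ2.
      + by rewrite e7 !comp_assoc sZ2.
      + by rewrite -comp_assoc e8 !comp_assoc hZ2.
      + by rewrite e9 !comp_assoc tZ2.
  exists EZ2, e, cE, QZ; do 4!split=> //.
  move=> O Q.
  have [m1 [R1 U1]] := UV _ (fst_fq Q); have [m2 [R2 U2]] := UW _ (snd_fq Q).
  have [/= ra1 [/= rb1 [la1 [lb1 [/= l11 l12 l13 l14 l15 l16 l17 l18 l19]]]]] := R1.
  have [/= ra2 [/= rb2 [la2 [lb2 [/= l21 l22 l23 l24 l25 l26 l27 l28 l29]]]]] := R2.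
  (* Both sides classify the same quintuple in [B], given as [M] through base parts and as [N]
     through total parts. Their underlying objects are only propositionally equal, so the
     identification [idto] is itself treated as a restriction from [M] to [N]. *)
  have compat : chi (O := EZ) cE ∘ fmap F m1 = chi m2.
    set N := map_fq p (snd_fq Q) (pPB _ _ _ _ _ (fq_pa (snd_fq Q)))
      (pPB _ _ _ _ _ (fq_pb (snd_fq Q))).
    set M := push_fq (chi cY) (chi cX) th HP th_src th_tgt
      (map_fq F (fst_fq Q) (FPB _ _ _ (fq_pa (fst_fq Q))) (FPB _ _ _ (fq_pb (fst_fq Q)))).
    have RM : Restricts (χ ∘ fmap F m1) pQW M.
      by apply: restricts_comp RχA _; apply: restricts_push; apply: restricts_map.
    have RN : Restricts (fmap p m2) pQW N by apply: restricts_map.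
    have RNM : Restricts (idto (cb_eq O)) M N.
      split; first by rewrite /= fmap_chi chi_pre.
      split; first by rewrite /= fmap_chi chi_pre.
      exists (idto (cb_eq _)), (idto (cb_eq _)); split=> /=.
      + by rewrite fmap_chi chi_pre.
      + by rewrite (cb_above _ _ _ _ (fq_ba Q)).
      + by rewrite fmap_chi chi_pre.
      + by rewrite (cb_above _ _ _ _ (fq_bb Q)).
      + by rewrite (cb_above _ _ _ _ (fq_f Q)).
      + by rewrite (cb_above _ _ _ _ (fq_g Q)).
      + by rewrite fmap_chi chi_pre -th_i fmap_comp -!comp_assoc.
      + by rewrite (cb_above _ _ _ _ (fq_h Q)).
      + by rewrite fmap_chi chi_pre -th_i fmap_comp -!comp_assoc.
    have E1 := universal_inj pQW N _ _ UpW RN (restricts_comp _ _ _ _ _ RM RNM).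
    by rewrite ecE chiE E1 -!comp_assoc idto_Ksym comp_id_r.
  have [m [mf ms]] := cb_lift (O := EZ) m1 m2 HcE compat.
  exists m; split.
  - have [la [la1' la2']] : exists la : Hom (fq_Sa Q) SaZ,
        cb_fst la = la1 /\ cSa ∘ cb_snd la = la2.
      apply: cb_lift => //; rewrite ecSa; apply: (pb_monic (fq_pa pQW)) => /=.
      + by rewrite comp_assoc ka1 -comp_assoc -fmap_comp l11 -chi_post l21 chi_pre.
      + rewrite comp_assoc ka2 -comp_assoc -fmap_comp l12 -chi_post l22 fmap_comp comp_assoc.
        by rewrite -ecE compat chi_pre.
    have [lb [lb1' lb2']] : exists lb : Hom (fq_Sb Q) SbZ,
        cb_fst lb = lb1 /\ cSb ∘ cb_snd lb = lb2.
      apply: cb_lift => //; rewrite ecSb; apply: (pb_monic (fq_pb pQW)) => /=.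
      + by rewrite comp_assoc kb1 -comp_assoc -fmap_comp l13 -chi_post l23 chi_pre.
      + rewrite comp_assoc kb2 -comp_assoc -fmap_comp l14 -chi_post l24 fmap_comp comp_assoc.
        by rewrite -ecE compat chi_pre.
    split.
      apply: (cb_monic _ _ HcY) => /=; first by rewrite aZ1 mf ra1.
      by rewrite comp_assoc aZ2 -comp_assoc ms ra2.
    split.
      apply: (cb_monic _ _ HcY) => /=; first by rewrite bZ1 mf rb1.
      by rewrite comp_assoc bZ2 -comp_assoc ms rb2.
    exists la, lb; split.
    + apply: (cb_monic _ _ HcX) => /=; first by rewrite taZ1 la1' l11.
      by rewrite comp_assoc taZ2 -comp_assoc la2' l21.
    + apply: (cb_monic (O := EZ) _ _ HcE) => /=; first by rewrite baZ1 la1' mf l12.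
      by rewrite comp_assoc baZ2 -comp_assoc la2' l22 comp_assoc ms.
    + apply: (cb_monic _ _ HcX) => /=; first by rewrite tbZ1 lb1' l13.
      by rewrite comp_assoc tbZ2 -comp_assoc lb2' l23.
    + apply: (cb_monic (O := EZ) _ _ HcE) => /=; first by rewrite bbZ1 lb1' mf l14.
      by rewrite comp_assoc bbZ2 -comp_assoc lb2' l24 comp_assoc ms.
    + apply: (cb_monic (O := SbZ) _ _ HcSb) => /=; first by rewrite fZ1 la1' lb1' l15.
      by rewrite !comp_assoc fZ2 lb2' -comp_assoc la2' l25.
    + apply: (cb_monic (O := SaZ) _ _ HcSa) => /=; first by rewrite gZ1 la1' lb1' l16.
      by rewrite !comp_assoc gZ2 la2' -comp_assoc lb2' l26.
    + apply: (cb_monic _ _ Hc) => /=.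
        by rewrite sZ1 la1' -comp_assoc -l17 comp_assoc ji comp_id_l.
      by rewrite comp_assoc sZ2 -comp_assoc la2' l27.
    + apply: (cb_monic (O := SaZ) _ _ HcSa) => /=; first by rewrite hZ1 la1' lb1' l18.
      by rewrite !comp_assoc hZ2 la2' -comp_assoc lb2' l28.
    + apply: (cb_monic _ _ Hc) => /=.
        by rewrite tZ1 lb1' -comp_assoc -l19 comp_assoc ji comp_id_l.
      by rewrite comp_assoc tZ2 -comp_assoc lb2' l29.
  - move=> m' /split_restr [S1 S2].
    apply: (cb_monic (O := EZ) _ _ HcE).
    + by rewrite mf; apply: U1.
    + by rewrite ms; apply: U2.
Qed.

End ChangeOfBaseEquiv.

(** * Dependent paths *)

Section DependentPaths.
Context {E B : TTFC} {p : Functor E B} (Hp : IsFibredTTFC p).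
Context {Y W : E} (q : Hom Y W) (s : Hom W Y) (Hq : fib q) (qs : q ∘ s = idm W)
  (P : PathObject q) (src tgt : Hom (po_ob P) Y) (Esrc : src = po_src P)
  (Etgt : tgt = po_tgt P) (K : Hom Y (po_ob P)) (K0 : src ∘ K = s ∘ q)
  (K1 : tgt ∘ K = idm Y).
(** [Dq] is the reindexing of [W] along [p(q)]: a point is a point of [W] with a point of [p(Y)]
    over the same base. [α] is the vertical part of [q]. *)
Context {Dq : E} (cD : Hom Dq W) (r : Hom (p Dq) (p Y)) (r' : Hom (p Y) (p Dq))
  (HcD : Cartesian p cD) (r'r : r' ∘ r = idm _) (rr' : r ∘ r' = idm _)
  (ecD : fmap p cD = fmap p q ∘ r).
Context (α : Hom Y Dq) (cα : cD ∘ α = q) (pα : fmap p α = r').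

Let src_r : src ∘ po_refl P = idm Y. Proof. by rewrite Esrc po_src_refl. Qed.
Let tgt_r : tgt ∘ po_refl P = idm Y. Proof. by rewrite Etgt po_tgt_refl. Qed.
Let q_st : q ∘ src = q ∘ tgt. Proof. by rewrite Esrc Etgt po_src_tgt. Qed.

Let src_refl : fmap p src ∘ fmap p (po_refl P) = idm _.
Proof. by rewrite -fmap_comp src_r fmap_id. Qed.

Let tgt_refl : fmap p tgt ∘ fmap p (po_refl P) = idm _.
Proof. by rewrite -fmap_comp tgt_r fmap_id. Qed.

Let q_src_tgt : fmap p q ∘ fmap p src = fmap p q ∘ fmap p tgt.
Proof. by rewrite -!fmap_comp q_st. Qed.

Let src_K : fmap p src ∘ fmap p K = fmap p s ∘ fmap p q.
Proof. by rewrite -!fmap_comp K0. Qed.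

Let tgt_K : fmap p tgt ∘ fmap p K = idm _.
Proof. by rewrite -!fmap_comp K1 fmap_id. Qed.

Let p_qs : fmap p q ∘ fmap p s = idm _.
Proof. by rewrite -!fmap_comp qs fmap_id. Qed.

Let fα : fib α.
Proof.
  apply: (fib_vertical_part Hp cD) => //; first by rewrite cα.
  by rewrite pα; apply: fib_iso; exists r.
Qed.

(* The fibre of [α] over [(x, y)] consists of the points over [x] and [y]; its centre is
   [s x] transported along the image under [p] of the path [K]. *)
Lemma vertical_contraction (Q : PathObject α) :
  exists t : Hom Dq Y, α ∘ t = idm Dq /\
    (exists L : Hom Y (po_ob Q), po_src Q ∘ L = t ∘ α /\ po_tgt Q ∘ L = idm Y) /\
    (exists L : Hom Y (po_ob Q), po_src Q ∘ L = idm Y /\ po_tgt Q ∘ L = t ∘ α).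
Proof.
  (* Transport in [α] moves the [p(Y)] coordinate. [PD] adjoins to a point of [W] a path in the
     image of [P]; [sP] and [tP] are its endpoints and [rho] is the constant path. *)
  have [PD [cP [v [v' [HcP [v'v [vv' ecP]]]]]]] := cart_ex Hp (fmap p q ∘ fmap p src).
  have [rho [rho1 rho2]] : exists x, cP ∘ x = cD /\ fmap p x = v' ∘ (fmap p (po_refl P) ∘ r).
    apply: (cart_lift HcP); rewrite ecP ecD -!comp_assoc (comp_pre _ vv') comp_id_l.
    by rewrite (comp_pre _ src_refl) comp_id_l.
  have acr : AcyclicCofib rho.
    apply: (fib_cart_ac _ Hp).
    - by apply: (cart_cancel cP) => //; rewrite rho1.
    - rewrite rho2; apply: ac_comp; first by apply: ac_iso; exists v.
      apply: ac_comp; last by apply: ac_iso; exists r'.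
      by apply: (p_ac Hp); exact: po_refl_ac.
  have [sP [sP1 sP2]] : exists x, cD ∘ x = cP /\ fmap p x = r' ∘ (fmap p src ∘ v).
    by apply: (cart_lift HcD); rewrite ecD ecP -!comp_assoc (comp_pre _ rr') comp_id_l.
  have [tP [tP1 tP2]] : exists x, cD ∘ x = cP /\ fmap p x = r' ∘ (fmap p tgt ∘ v).
    apply: (cart_lift HcD); rewrite ecD ecP -!comp_assoc (comp_pre _ rr') comp_id_l.
    by rewrite !comp_assoc q_src_tgt.
  have sr : sP ∘ rho = idm _.
    apply: (cart_monic HcD); first by rewrite comp_assoc sP1 rho1 comp_id_r.
    rewrite fmap_comp sP2 rho2 -!comp_assoc (comp_pre _ vv') comp_id_l.
    by rewrite (comp_pre _ src_refl) comp_id_l r'r fmap_id.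
  have tr : tP ∘ rho = idm _.
    apply: (cart_monic HcD); first by rewrite comp_assoc tP1 rho1 comp_id_r.
    rewrite fmap_comp tP2 rho2 -!comp_assoc (comp_pre _ vv') comp_id_l.
    by rewrite (comp_pre _ tgt_refl) comp_id_l r'r fmap_id.
  have [NP [top [base [HNP _]]]] := pb_ex α sP fα.
  have [L [L1 L2]] := transport_ex α rho sP tP top base fα acr sr tr HNP.
  (* [m] is the image of the contraction [K], a base path from the image of [s x] to [y]; [j1] puts
     [s x] at its start. *)
  have [m [m1 m2]] : exists x, cP ∘ x = cD /\ fmap p x = v' ∘ (fmap p K ∘ r).
    apply: (cart_lift HcP); rewrite ecP ecD -!comp_assoc (comp_pre _ vv') comp_id_l.
    by rewrite (comp_pre _ src_K) -!comp_assoc (comp_pre _ p_qs) comp_id_l.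
  have [j1 [j11 j12]] : exists x, top ∘ x = s ∘ cD /\ base ∘ x = m.
    apply: (pb_lift HNP); apply: (cart_monic HcD).
    - by rewrite (comp_pre _ cα) (comp_pre _ qs) (comp_pre _ sP1) m1 comp_id_l.
    - rewrite !fmap_comp pα sP2 m2 ecD -!comp_assoc (comp_pre _ vv') comp_id_l.
      by rewrite (comp_pre _ src_K) -!comp_assoc.
  (* [mu] sends a path in [P] to its own image under [p], so [L ∘ j2] transports the source of a
     path along that image. On constant paths it agrees with the target, and [po_ac_lift] then
     connects the two. *)
  have [mu [mu1 mu2]] : exists x, cP ∘ x = q ∘ src /\ fmap p x = v'.
    by apply: (cart_lift HcP); rewrite ecP -!comp_assoc vv' comp_id_r fmap_comp.
  have [j2 [j21 j22]] : exists x, top ∘ x = src /\ base ∘ x = mu.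
    apply: (pb_lift HNP); apply: (cart_monic HcD).
    - by rewrite (comp_pre _ cα) (comp_pre _ sP1) mu1.
    - by rewrite !fmap_comp pα sP2 mu2 -!comp_assoc vv' comp_id_r.
  have j2r : L ∘ j2 ∘ po_refl P = idm Y.
    rewrite -comp_assoc; apply: L2; first by rewrite (comp_pre _ j21) src_r.
    rewrite (comp_pre _ j22) comp_id_r; apply: (cart_monic HcP).
    - by rewrite (comp_pre _ mu1) -comp_assoc src_r comp_id_r (comp_pre _ rho1) cα.
    - by rewrite !fmap_comp mu2 rho2 pα -!comp_assoc rr' comp_id_r.
  have ej : j2 ∘ K = j1 ∘ α.
    apply: (pb_monic HNP).
    - by rewrite (comp_pre _ j21) K0 (comp_pre _ j11) -comp_assoc cα.
    - rewrite (comp_pre _ j22) (comp_pre _ j12); apply: (cart_monic HcP).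
      + rewrite (comp_pre _ mu1) (comp_pre _ m1) cα -comp_assoc K0 comp_assoc qs comp_id_l //.
      + by rewrite !fmap_comp mu2 m2 pα -!comp_assoc rr' comp_id_r.
  have aj : α ∘ (L ∘ j2) = α ∘ tgt.
    rewrite (comp_pre _ L1) -comp_assoc j22; apply: (cart_monic HcD).
    - by rewrite (comp_pre _ tP1) mu1 (comp_pre _ cα) q_st.
    - by rewrite !fmap_comp tP2 mu2 pα -!comp_assoc vv' comp_id_r.
  exists (L ∘ j1); split.
    rewrite (comp_pre _ L1) -comp_assoc j12; apply: (cart_monic HcD).
    - by rewrite (comp_pre _ tP1) m1 comp_id_r.
    - rewrite fmap_comp tP2 m2 -!comp_assoc (comp_pre _ vv') comp_id_l.
      by rewrite (comp_pre _ tgt_K) comp_id_l r'r fmap_id.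
  (* Both directions are provided at once, so that no path has to be inverted. *)
  split.
  - have [M [M1 M2]] := po_ac_lift Q (po_refl P) (idm Y) _ _ (po_refl_ac _ P) j2r
      tgt_r aj.
    exists (M ∘ K); rewrite !comp_assoc M1 M2 K1; split=> //.
    by rewrite -!comp_assoc ej.
  - have [M [M1 M2]] := po_ac_lift Q (po_refl P) (idm Y) _ _ (po_refl_ac _ P)
      tgt_r j2r (eq_sym aj).
    exists (M ∘ K); rewrite !comp_assoc M1 M2 K1; split=> //.
    by rewrite -!comp_assoc ej.
Qed.

Let sq_top := pb_top (po_sq P).
Let sq_base := pb_base (po_sq P).
(** A point of [G] is a pair of points of [Y] over the same point of [W], with a path in the image
    of [P] between their images. A section of [δ] lifts all such paths at once. *)
Context {G : E} (cG : Hom G (po_sq P)) (x : Hom (p G) (p (po_ob P)))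
  (x' : Hom (p (po_ob P)) (p G)) (HcG : Cartesian p cG) (x'x : x' ∘ x = idm _)
  (xx' : x ∘ x' = idm _) (ecG : fmap p cG = fmap p (po_bd P) ∘ x).
Context (δ : Hom (po_ob P) G) (cδ : cG ∘ δ = po_bd P) (pδ : fmap p δ = x').

Let p_src : fmap p (sq_top ∘ cG) = fmap p src ∘ x.
Proof. by rewrite fmap_comp ecG comp_assoc -fmap_comp Esrc. Qed.

Let p_tgt : fmap p (sq_base ∘ cG) = fmap p tgt ∘ x.
Proof. by rewrite fmap_comp ecG comp_assoc -fmap_comp Etgt. Qed.

(* [G] is the pullback of [α] along a fibration [D' -> Dq], where [D'] is the reindexing of
   [Y] along the target map.  Since [Y -> D'] is an acyclic cofibration, the section is built
   over [D'] and then transported along the contraction of [α]. *)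
Lemma dependent_path_section : exists σ : Hom G (po_ob P), δ ∘ σ = idm G.
Proof.
  set Q := tt_paths E _ _ α fα.
  have [t [αt [[L [L1 L2]] [L' [L1' L2']]]]] := vertical_contraction Q.
  have fδ : fib δ.
    apply: (fib_vertical_part Hp cG) => //; first by rewrite cδ; exact: po_bd_fib.
    by rewrite pδ; apply: fib_iso; exists x.
  have fsrc : fib src.
    by rewrite Esrc; apply: fib_comp (po_bd_fib _ P); apply: (pb_fib' (pb_is (po_sq P))).
  have ftgt : fib tgt.
    by rewrite Etgt; apply: fib_comp (po_bd_fib _ P); apply: (pb_fib (pb_is (po_sq P))).
  have [D' [c' [y [y' [Hc' [y'y [yy' ec']]]]]]] := cart_ex Hp (fmap p tgt).
  have fc' : fib c'.
    apply: (fib_cart_fib _ Hp) => //; rewrite ec'; apply: fib_comp; first exact: (p_fib Hp).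
    by apply: fib_iso; exists y'.
  have [a [a1 a2]] : exists a, c' ∘ a = idm Y /\ fmap p a = y' ∘ fmap p (po_refl P).
    by apply: (cart_lift Hc'); rewrite ec' -comp_assoc (comp_pre _ yy') comp_id_l tgt_refl fmap_id.
  have aca : AcyclicCofib a.
    apply: (fib_cart_ac _ Hp).
    - by apply: (cart_cancel c') => //; rewrite a1; exact: cart_idm.
    - rewrite a2; apply: ac_comp; first by apply: ac_iso; exists y.
      by apply: (p_ac Hp); exact: po_refl_ac.
  have [ν [ν1 ν2]] : exists ν, c' ∘ ν = sq_base ∘ cG /\ fmap p ν = y' ∘ x.
    by apply: (cart_lift Hc'); rewrite p_tgt ec' -comp_assoc (comp_pre _ yy') comp_id_l.
  set γ := sq_top ∘ cG.
  have [d' [d1 d2]] : exists d, cD ∘ d = q ∘ c' /\ fmap p d = r' ∘ (fmap p src ∘ y).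
    apply: (cart_lift HcD); rewrite ecD fmap_comp ec' -!comp_assoc (comp_pre _ rr') comp_id_l.
    by rewrite !comp_assoc q_src_tgt.
  have fd' : fib d'.
    apply: (fib_vertical_part Hp cD) => //; first by rewrite d1; apply: fib_comp.
    rewrite d2; apply: fib_comp; first by apply: fib_iso; exists r.
    by apply: fib_comp; [exact: (p_fib Hp) | apply: fib_iso; exists y'].
  have HG : IsPullback α d' γ ν.
    apply: pb_intro.
    - apply: (cart_monic HcD).
      + rewrite (comp_pre _ cα) (comp_pre _ d1) -comp_assoc ν1 /γ !comp_assoc.
        by rewrite (pb_comm (pb_is (po_sq P))).
      + rewrite !fmap_comp pα d2 ν2 -fmap_comp p_src -!comp_assoc (comp_pre _ yy').
        by rewrite comp_id_l.
    - move=> Z m m' e1 e2; apply: (cart_monic HcG).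
      + apply: (pb_monic (pb_is (po_sq P))).
        * by rewrite !comp_assoc.
        * have := f_equal (comp c') e2.
          by rewrite !(comp_pre _ ν1) -!comp_assoc.
      + have := f_equal (fmap p) e2; rewrite !fmap_comp ν2 => e3.
        have := f_equal (comp (x' ∘ y)) e3.
        rewrite -!comp_assoc !(comp_pre _ yy') !comp_id_l !(comp_pre _ x'x) !comp_id_l //.
    - move=> Z k l e.
      have e1 : q ∘ k = q ∘ (c' ∘ l).
        by rewrite -cα -comp_assoc e (comp_pre _ d1) -!comp_assoc (comp_pre _ cα).
      have e2 : fmap p k = fmap p src ∘ (y ∘ fmap p l).
        have := f_equal (comp r) (f_equal (fmap p) e).
        by rewrite !fmap_comp pα d2 -!comp_assoc !(comp_pre _ rr') !comp_id_l.
      have [b [b1 b2]] := pb_lift (pb_is (po_sq P)) k (c' ∘ l) e1.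
      have [m [m1 m2]] : exists m, cG ∘ m = b /\ fmap p m = x' ∘ (y ∘ fmap p l).
        apply: (cart_lift HcG); rewrite ecG -comp_assoc (comp_pre _ xx') comp_id_l.
        apply: (pb_monic (p_pb Hp Hq (pb_is (po_sq P)))).
        * by rewrite -fmap_comp b1 e2 Esrc comp_assoc -fmap_comp.
        * by rewrite -fmap_comp b2 [fmap p (c' ∘ l)]fmap_comp ec' -comp_assoc Etgt comp_assoc -fmap_comp.
      exists m; rewrite /γ -comp_assoc m1; split=> //; apply: (cart_monic Hc').
      + by rewrite (comp_pre _ ν1) -comp_assoc m1.
      + by rewrite fmap_comp ν2 m2 -comp_assoc (comp_pre _ xx') comp_id_l (comp_pre _ y'y) comp_id_l.
  have fγ : fib γ := pb_fib' HG fd'.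
  (* [tG] moves the first endpoint of a point of [G] along a path in its fibre of [α], and
     [transport] lifts this move to [P]. *)
  have [GP [gs [gp [HGP fgp]]]] := pb_ex γ (po_src Q) fγ.
  have [iG [iG1 iG2]] : exists i, gs ∘ i = idm G /\ gp ∘ i = po_refl Q ∘ γ.
    by apply: (pb_lift HGP); rewrite (comp_pre _ (po_src_refl Q)) comp_id_l comp_id_r.
  have aci : AcyclicCofib iG.
    apply: (ac_pullback (g := gp) (i := po_refl Q) (g' := γ)) => //; last exact: po_refl_ac.
    by apply: (pb_unpaste HGP) => //; rewrite iG1 po_src_refl; apply: id_square_pullback.
  have [tG [tG1 tG2]] : exists tG, γ ∘ tG = po_tgt Q ∘ gp /\ ν ∘ tG = ν ∘ gs.
    apply: (pb_lift HG).
    rewrite (comp_pre _ (eq_sym (po_src_tgt Q))) -comp_assoc -(pb_comm HGP).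
    by rewrite (comp_pre _ (pb_comm HG)) -comp_assoc.
  have ti : tG ∘ iG = idm G.
    apply: (pb_monic HG).
    - by rewrite (comp_pre _ tG1) -comp_assoc iG2 (comp_pre _ (po_tgt_refl Q)) comp_id_l comp_id_r.
    - by rewrite (comp_pre _ tG2) -comp_assoc iG1.
  have [NP [top [base [HNP _]]]] := pb_ex δ gs fδ.
  have [M [M1 _]] := transport_ex δ iG gs tG top base fδ aci iG1 ti HNP.
  have transport (O : E) (n : Hom O (po_ob P)) (m : Hom O (po_ob Q)) :
      po_src Q ∘ m = γ ∘ (δ ∘ n) ->
      exists n', ν ∘ (δ ∘ n') = ν ∘ (δ ∘ n) /\ γ ∘ (δ ∘ n') = po_tgt Q ∘ m.
    move=> e; have [k [k1 k2]] := pb_lift HGP (δ ∘ n) m (eq_sym e).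
    have [l [l1 l2]] := pb_lift HNP n k (eq_sym k1).
    exists (M ∘ l); rewrite (comp_pre _ M1) -comp_assoc l2; split.
    - by rewrite (comp_pre _ tG2) -comp_assoc k1.
    - by rewrite (comp_pre _ tG1) -comp_assoc k2.
  have γδr : γ ∘ (δ ∘ po_refl P) = idm Y.
    by rewrite /γ -comp_assoc (comp_pre _ cδ) (po_diag0 _ P).
  have νδr : ν ∘ (δ ∘ po_refl P) = a.
    apply: (cart_monic Hc').
    - by rewrite (comp_pre _ ν1) -comp_assoc (comp_pre _ cδ) (po_diag1 _ P) a1.
    - by rewrite !fmap_comp ν2 pδ a2 -comp_assoc (comp_pre _ xx') comp_id_l.
  have [n1 [n11 n12]] := transport Y (po_refl P) L' (eq_trans L1' (eq_sym γδr)).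
  have [τ [τ1 τ2]] : exists τ, γ ∘ τ = t ∘ d' /\ ν ∘ τ = idm D'.
    by apply: (pb_lift HG); rewrite (comp_pre _ αt) comp_id_l comp_id_r.
  have d'a : d' ∘ a = α.
    apply: (cart_monic HcD).
    - by rewrite (comp_pre _ d1) -comp_assoc a1 comp_id_r cα.
    - by rewrite fmap_comp d2 a2 -!comp_assoc (comp_pre _ yy') comp_id_l src_refl comp_id_r pα.
  have [S [_ S2]] : exists S, S ∘ a = n1 /\ δ ∘ S = τ.
    apply: aca => //; apply: (pb_monic HG).
    - by rewrite n12 L2' (comp_pre _ τ1) -comp_assoc d'a.
    - by rewrite n11 νδr (comp_pre _ τ2) comp_id_l.
  (* [S] covers the case where the first endpoint is the centre of its fibre; an arbitrary first
     endpoint is reached from the centre along [L]. *)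
  have e2 : po_src Q ∘ (L ∘ γ) = γ ∘ (δ ∘ (S ∘ ν)).
    rewrite (comp_pre _ L1) (comp_pre _ S2) (comp_pre _ τ1) -!comp_assoc.
    by rewrite (pb_comm HG).
  have [σ [σ1 σ2]] := transport G (S ∘ ν) (L ∘ γ) e2.
  exists σ; apply: (pb_monic HG).
  - by rewrite σ2 (comp_pre _ L2) comp_id_l comp_id_r.
  - by rewrite σ1 (comp_pre _ S2) (comp_pre _ τ2) comp_id_l comp_id_r.
Qed.

End DependentPaths.

Lemma dependent_path {E B : TTFC} {p : Functor E B} (Hp : IsFibredTTFC p) {Y W Z : E}
    (q : Hom Y W) (s : Hom W Y) (P : PathObject q) (K : Hom Y (po_ob P)) :
  fib q -> q ∘ s = idm W -> po_src P ∘ K = s ∘ q -> po_tgt P ∘ K = idm Y ->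
  forall (y0 y1 : Hom Z Y) (l : Hom (p Z) (p (po_ob P))), q ∘ y0 = q ∘ y1 ->
    fmap p (po_src P) ∘ l = fmap p y0 -> fmap p (po_tgt P) ∘ l = fmap p y1 ->
  exists m : Hom Z (po_ob P), po_src P ∘ m = y0 /\ po_tgt P ∘ m = y1 /\ fmap p m = l.
Proof.
  move=> Hq qs K0 K1 y0 y1 l e l0 l1.
  have [Dq [cD [r [r' [HcD [r'r [rr' ecD]]]]]]] := cart_ex Hp (fmap p q).
  have [α [α1 α2]] : exists a, cD ∘ a = q /\ fmap p a = r'.
    by apply: (cart_lift HcD); rewrite ecD -comp_assoc rr' comp_id_r.
  have [G [cG [x [x' [HcG [x'x [xx' ecG]]]]]]] := cart_ex Hp (fmap p (po_bd P)).
  have [δ [δ1 δ2]] : exists a, cG ∘ a = po_bd P /\ fmap p a = x'.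
    by apply: (cart_lift HcG); rewrite ecG -comp_assoc xx' comp_id_r.
  have [σ Hσ] := dependent_path_section Hp q s Hq qs P _ _ eq_refl eq_refl K K0 K1 cD r r' HcD r'r rr' ecD α α1 α2
    cG x x' HcG x'x xx' ecG δ δ1 δ2.
  have [b [b1 b2]] := pb_lift (pb_is (po_sq P)) y0 y1 e.
  have [g [g1 g2]] : exists g, cG ∘ g = b /\ fmap p g = x' ∘ l.
    apply: (cart_lift HcG); rewrite ecG -comp_assoc (comp_pre _ xx') comp_id_l.
    apply: (pb_monic (p_pb Hp Hq (pb_is (po_sq P)))).
    - by rewrite -fmap_comp b1 comp_assoc -fmap_comp.
    - by rewrite -fmap_comp b2 comp_assoc -fmap_comp.
  have eb : po_bd P ∘ (σ ∘ g) = b.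
    by rewrite -δ1 -comp_assoc (comp_pre _ Hσ) comp_id_l g1.
  exists (σ ∘ g); split; first by rewrite -b1 -eb /po_src -!comp_assoc.
  split; first by rewrite -b2 -eb /po_tgt -!comp_assoc.
  (* The image of [δ] is invertible, so the base component of [σ ∘ g] can be read off from that of
     [g]. *)
  have := f_equal (comp x) (f_equal (fmap p) (f_equal (fun k => k ∘ g) Hσ)).
  rewrite comp_id_l !fmap_comp δ2 g2 !comp_assoc xx' !comp_id_l //.
Qed.

(** * Univalence *)

Lemma pullback_of_product {C : Category} {U S T : C} {p0 p1 : Hom S U} (t : Hom U T) :
  IsTerminal T -> IsProduct p0 p1 -> IsPullback t t p0 p1.
Proof.
  move=> HT H; split; last by move=> X y x _; apply: H.
  by have [k Hk] := HT S; rewrite (Hk (t ∘ p0)) (Hk (t ∘ p1)).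
Qed.

Lemma product_lift {C : Category} {U V S : C} {p0 : Hom S U} {p1 : Hom S V} :
  IsProduct p0 p1 -> forall {X : C} (a : Hom X U) (b : Hom X V),
  exists m : Hom X S, p0 ∘ m = a /\ p1 ∘ m = b.
Proof. by move=> H X a b; have [m [e _]] := H X a b; exists m. Qed.

Lemma product_monic {C : Category} {U V S : C} {p0 : Hom S U} {p1 : Hom S V} :
  IsProduct p0 p1 -> forall {X : C} (m m' : Hom X S),
  p0 ∘ m = p0 ∘ m' -> p1 ∘ m = p1 ∘ m' -> m = m'.
Proof.
  move=> H X m m' e0 e1; have [n [_ Hn]] := H X (p0 ∘ m') (p1 ∘ m').
  by rewrite (Hn m) // (Hn m').
Qed.

Lemma product_proj_fib {C : TTFC} {U S : C} {p0 p1 : Hom S U} :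
  IsProduct p0 p1 -> fib p0 /\ fib p1.
Proof.
  move=> H; have [T HT] := @terminal_ex C; have [t _] := HT U.
  have Ht : fib t by apply: fib_to_terminal.
  have HP := pullback_of_product t HT H.
  by split; [exact: (pb_fib' HP) | exact: (pb_fib HP)].
Qed.

Section Univalence.
Context {A E B : TTFC} {p : Functor E B} (Hp : IsFibredTTFC p) {F : Functor A B}
  (HFpb : PreservesPBofFib F) (HFfib : PreservesFib F) (HFac : PreservesAcyclicCofib F).
Local Notation D := (ChangeOfBase p F).

Lemma cb_section_equiv {Y : D} {EV : A} {EW W EZ2 : E} (e : p EZ2 = F EV)
    (q : Hom (c := D) (CbOb EV EZ2 e) Y) (s : Hom (c := D) Y (CbOb EV EZ2 e))
    (qW : Hom EW W) (sW : Hom W EW) (cE : Hom EZ2 EW) (cY : Hom (cb_tot Y) W) :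
  Cartesian p cE -> Cartesian p cY -> qW ∘ cE = cY ∘ cb_snd q -> sW ∘ cY = cE ∘ cb_snd s ->
  q ∘ s = idm Y -> qW ∘ sW = idm W -> fib (cb_fst q) -> fib qW ->
  HomotopyEquiv (cb_fst s) -> HomotopyEquiv sW -> HomotopyEquiv s.
Proof.
  move=> HcE HcY eq es qs qsW fq fqW [gV [_ hV]] [gW [_ hW]].
  have qsV : cb_fst q ∘ cb_fst s = idm _ := f_equal cb_fst qs.
  set PA := tt_paths A _ _ _ fq; set PE := tt_paths E _ _ _ fqW.
  have [KA [KA0 KA1]] := fibrewise_contraction _ _ gV PA qsV hV.
  have [KE [KE0 KE1]] := fibrewise_contraction _ _ gW PE qsW hW.
  have [R [[i [[j [ji ij]] [_ [i_src i_tgt]]]] [c [Hc [_ [c_src c_tgt]]]]]] :=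
    induced_path_ex Hp HFac HFfib q PA PE cE cY HcE HcY eq fq fqW.
  set Z : D := CbOb EV EZ2 e in q s eq es qs fq qsV PA KA KA0 KA1 R i i_src i_tgt j ji ij c c_src c_tgt Hc hV *.
  (* [l] is the contraction of the base, carried to the image of [PE] by the structure map of the
     induced path object [R]. The contraction [KE] serves only as input to [dependent_path]. *)
  set l := chi c ∘ (fmap F (j ∘ KA) ∘ idto e).
  have x0 : fmap p (po_src PE) ∘ chi c = chi (O := Z) cE ∘ fmap F (cb_fst (po_src R)).
    by rewrite -chi_post c_src (chi_pre (O := Z)).
  have x1 : fmap p (po_tgt PE) ∘ chi c = chi (O := Z) cE ∘ fmap F (cb_fst (po_tgt R)).
    by rewrite -chi_post c_tgt (chi_pre (O := Z)).
  have f0 : fmap F (cb_fst (po_src R)) ∘ fmap F (j ∘ KA) = fmap F (cb_fst s ∘ cb_fst q).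
    by rewrite -fmap_comp -i_src -comp_assoc (comp_pre _ ij) comp_id_l KA0.
  have f1 : fmap F (cb_fst (po_tgt R)) ∘ fmap F (j ∘ KA) = idm _.
    by rewrite -fmap_comp -i_tgt -comp_assoc (comp_pre _ ij) comp_id_l KA1 fmap_id.
  have l0 : fmap p (po_src PE) ∘ l = fmap p (sW ∘ (qW ∘ cE)).
    rewrite /l (comp_pre _ x0) -comp_assoc (comp_pre _ f0) eq (comp_pre _ es) -comp_assoc.
    change (fmap p (cE ∘ (cb_snd s ∘ cb_snd q))) with (fmap p (cE ∘ cb_snd (s ∘ q))).
    by rewrite (fmap_chi (O := Z)) (chi_pre (O := Z) (O' := Z)) -comp_assoc.
  have l1 : fmap p (po_tgt PE) ∘ l = fmap p cE.
    by rewrite /l (comp_pre _ x1) -comp_assoc (comp_pre _ f1) comp_id_l (fmap_chi (O := Z)).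
  have e01 : qW ∘ (sW ∘ (qW ∘ cE)) = qW ∘ cE by rewrite (comp_pre _ qsW) comp_id_l.
  have [m [m0 [m1 m2]]] := dependent_path Hp qW sW PE KE fqW qsW KE0 KE1 _ cE l e01 l0 l1.
  have [H [H1 H2]] : exists H : Hom (c := D) Z (po_ob R), cb_fst H = j ∘ KA /\ c ∘ cb_snd H = m.
    apply: cb_lift => //; rewrite (chiE (O := Z) m) m2 /l -!comp_assoc.
    by rewrite (idto_Ksym e) comp_id_r.
  have h0 : po_src R ∘ H = s ∘ q.
    apply: (cb_monic (O := Z) _ _ HcE).
    - change (cb_fst (po_src R) ∘ cb_fst H = cb_fst s ∘ cb_fst q).
      by rewrite -i_src H1 -comp_assoc (comp_pre _ ij) comp_id_l KA0.
    - change (cE ∘ (cb_snd (po_src R) ∘ cb_snd H) = cE ∘ (cb_snd s ∘ cb_snd q)).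
      rewrite (comp_pre _ (eq_sym c_src)) -comp_assoc H2 m0 eq (comp_pre _ es).
      by rewrite -comp_assoc.
  have h1 : po_tgt R ∘ H = idm Z.
    apply: (cb_monic (O := Z) _ _ HcE).
    - change (cb_fst (po_tgt R) ∘ cb_fst H = idm EV).
      by rewrite -i_tgt H1 -comp_assoc (comp_pre _ ij) comp_id_l KA1.
    - change (cE ∘ (cb_snd (po_tgt R) ∘ cb_snd H) = cE ∘ idm EZ2).
      by rewrite (comp_pre _ (eq_sym c_tgt)) -comp_assoc H2 m1 comp_id_r.
  have [T [HT fT]] := cb_terminal_ex (F := F) Hp HFfib.
  exists q; split.
  - have [t _] := HT Y; have [P] := cb_path_ex Hp HFac HFfib t (fT _ _).
    exists T, t, P, (po_refl P); rewrite qs; split=> //.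
    by split; [exact: po_src_refl | exact: po_tgt_refl].
  - have [t Ht] := HT Z; have [P] := cb_path_ex Hp HFac HFfib t (fT _ _).
    (* [R] is a path object over [Y], while homotopies refer to one over the terminal object;
       extending along [po_refl R] maps the former to the latter. *)
    have [n [n0 n1]] : exists n, po_src P ∘ n = po_src R /\ po_tgt P ∘ n = po_tgt R.
      apply: (po_ac_lift P (po_refl R) (idm Z) _ _ (po_refl_ac _ R) (po_src_refl R) (po_tgt_refl R)).
      have [t' Ht'] := HT (po_ob R).
      by rewrite (Ht' (t ∘ po_src R)) (Ht' (t ∘ po_tgt R)).
    exists T, t, P, (n ∘ H); split=> //.
    by rewrite !comp_assoc n0 n1.
Qed.

Context {X Y : D} {z : Hom X Y} {W' W : E} {w : Hom W' W} {cX : Hom (cb_tot X) W'}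
  {cY : Hom (cb_tot Y) W} (HcX : Cartesian p cX) (HcY : Cartesian p cY)
  (ez : w ∘ cX = cY ∘ cb_snd z) (Hz : fib z) (Hw : fib w)
  (HP : IsPullback (fmap p w) (chi cY) (chi cX) (fmap F (cb_fst z))).
Context {PV : PathObject (cb_fst z)} {PW : PathObject w} {R : PathObject z}.
Context {i : Hom (cb_base (po_ob R)) (po_ob PV)} {j : Hom (po_ob PV) (cb_base (po_ob R))}
  (ji : j ∘ i = idm _) (ij : i ∘ j = idm _)
  (i_refl : i ∘ cb_fst (po_refl R) = po_refl PV)
  (i_src : po_src PV ∘ i = cb_fst (po_src R)) (i_tgt : po_tgt PV ∘ i = cb_fst (po_tgt R)).
Context {c : Hom (cb_tot (po_ob R)) (po_ob PW)} (Hc : Cartesian p c)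
  (c_refl : c ∘ cb_snd (po_refl R) = po_refl PW ∘ cX)
  (c_src : po_src PW ∘ c = cX ∘ cb_snd (po_src R))
  (c_tgt : po_tgt PW ∘ c = cX ∘ cb_snd (po_tgt R)).

Lemma cb_univalent : UnivalentFor PV -> UnivalentFor PW -> UnivalentFor R.
Proof.
  have Hv : fib (cb_fst z) by case: Hz.
  move=> [EVo [eV [eV0 [eV1 [eVid eVh]]]]] [EWo [eW [eW0 [eW1 [eWid eWh]]]]].
  have [SVa] := tt_pb_exists _ (tt_ax A) _ _ _ _ (eo_p0 _ EVo ∘ eo_proj _ EVo) Hv.
  have [SVb] := tt_pb_exists _ (tt_ax A) _ _ _ _ (eo_p1 _ EVo ∘ eo_proj _ EVo) Hv.
  have [SWa] := tt_pb_exists _ (tt_ax E) _ _ _ _ (eo_p0 _ EWo ∘ eo_proj _ EWo) Hw.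
  have [SWb] := tt_pb_exists _ (tt_ax E) _ _ _ _ (eo_p1 _ EWo ∘ eo_proj _ EWo) Hw.
  have [QV [aV [bV [UV kV]]]] := universal_of_equivobj PV EVo SVa SVb.
  have [QW [aW [bW [UW kW]]]] := universal_of_equivobj PW EWo SWa SWb.
  have RV := kV _ _ _ (id_square _) (id_square _) eV eV0 eV1; rewrite eVid in RV.
  have RW := kW _ _ _ (id_square _) (id_square _) eW eW0 eW1; rewrite eWid in RW.
  have [EZ2 [e [cE [QZ [HcE [[aZ1 aZ2] [[bZ1 bZ2] [UZ splitZ]]]]]]]] :=
    cb_universal_ex Hp HFpb HcX HcY ez Hz Hw HP ji ij i_src i_tgt Hc c_src c_tgt QV UV QW UW.
  set EZ : D := CbOb _ EZ2 e in QZ aZ1 aZ2 bZ1 bZ2 UZ splitZ.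
  set idR := fq_of R (id_quint R).
  have [m [Rm _]] := UZ Y idR.
  have [Rm1 Rm2] := splitZ Y idR m Rm.
  (* The identity quintuple of [z] has those of its base part and of [w] underlying it, so its
     classifying map restricts to [eV] and [eW]. *)
  have mf : cb_fst m = eV.
    apply: (universal_inj QV _ _ _ UV Rm1); rewrite -(comp_id_r _ _ _ eV).
    apply: (restricts_comp _ _ _ _ _ RV); split; first by rewrite /= comp_id_l.
    split; first by rewrite /= comp_id_l.
    by exists (idm _), (idm _); split; rewrite /= ?comp_id_l ?comp_id_r.
  have ms : cE ∘ cb_snd m = eW ∘ cY.
    apply: (universal_inj QW _ _ _ UW Rm2); apply: (restricts_comp _ _ _ _ _ RW).
    split; first by rewrite /= comp_id_l comp_id_r.
    split; first by rewrite /= comp_id_l comp_id_r.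
    by exists cX, cX; split; rewrite /= ?comp_id_l ?comp_id_r.
  have fprV := eo_fib _ EVo; have fprW := eo_fib _ EWo.
  have [T HT] := @terminal_ex E; have [t _] := HT W.
  (* [F] is not assumed to preserve products, so [Y × Y] is obtained by reindexing [W × W] along the
     comparison [eta], which exists because [p] preserves the latter product. *)
  have HWp : IsProduct (fmap p (eo_p0 _ EWo)) (fmap p (eo_p1 _ EWo)).
    apply: (product_of_pullback (ttf_terminal _ (fib_ttf _ Hp) _ HT)).
    apply: (p_pb Hp); last exact: (pullback_of_product t HT (eo_is_prod _ EWo)).
    exact: fib_to_terminal.
  have [eta [eta0 eta1]] := product_lift HWp (chi cY ∘ fmap F (eo_p0 _ EVo))
    (chi cY ∘ fmap F (eo_p1 _ EVo)).
  have [P2 [eP [cP [HcP ecP]]]] := cb_ex Hp _ eta.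
  set PZ : D := CbOb _ P2 eP in ecP.
  have [p0 [p01 p02]] : exists p0 : Hom PZ Y, cb_fst p0 = eo_p0 _ EVo /\
      cY ∘ cb_snd p0 = eo_p0 _ EWo ∘ cP.
    by apply: cb_lift => //; rewrite chi_post ecP.
  have [p1 [p11 p12]] : exists p1 : Hom PZ Y, cb_fst p1 = eo_p1 _ EVo /\
      cY ∘ cb_snd p1 = eo_p1 _ EWo ∘ cP.
    by apply: cb_lift => //; rewrite chi_post ecP.
  have HPZ : IsProduct p0 p1.
    move=> O a b.
    have [k1 [k10 k11]] := product_lift (eo_is_prod _ EVo) (cb_fst a) (cb_fst b).
    have [k2 [k20 k21]] := product_lift (eo_is_prod _ EWo) (cY ∘ cb_snd a) (cY ∘ cb_snd b).
    have [k [kf ks]] : exists k : Hom O PZ, cb_fst k = k1 /\ cP ∘ cb_snd k = k2.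
      apply: cb_lift => //; rewrite ecP; apply: (product_monic HWp).
      - by rewrite comp_assoc eta0 -comp_assoc -fmap_comp k10 -chi_post k20 chi_pre.
      - by rewrite comp_assoc eta1 -comp_assoc -fmap_comp k11 -chi_post k21 chi_pre.
    exists k; split; first split.
    - apply: (cb_monic _ _ HcY) => /=; first by rewrite p01 kf.
      by rewrite comp_assoc p02 -comp_assoc ks.
    - apply: (cb_monic _ _ HcY) => /=; first by rewrite p11 kf.
      by rewrite comp_assoc p12 -comp_assoc ks.
    - move=> k' e0 e1; apply: (cb_monic (O := PZ) _ _ HcP).
      + apply: (product_monic (eo_is_prod _ EVo)); rewrite kf ?k10 ?k11 -?p01 -?p11.
        * exact: (f_equal cb_fst e0).
        * exact: (f_equal cb_fst e1).
      + apply: (product_monic (eo_is_prod _ EWo)); rewrite ks ?k20 ?k21 comp_assoc -?p02 -?p12 -comp_assoc.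
        * exact: (f_equal (fun x => cY ∘ cb_snd x) e0).
        * exact: (f_equal (fun x => cY ∘ cb_snd x) e1).
  have [pr [pr1 pr2]] : exists pr : Hom EZ PZ, cb_fst pr = eo_proj _ EVo /\
      cP ∘ cb_snd pr = eo_proj _ EWo ∘ cE.
    apply: cb_lift => //; rewrite ecP; apply: (product_monic HWp).
    - rewrite comp_assoc eta0 -comp_assoc -fmap_comp -aV -aZ1 -chi_pre aZ2 aW.
      by rewrite -chi_post -comp_assoc.
    - rewrite comp_assoc eta1 -comp_assoc -fmap_comp -bV -bZ1 -chi_pre bZ2 bW.
      by rewrite -chi_post -comp_assoc.
  have fpr : fib pr.
    split; first by rewrite pr1.
    apply: (cart_fib Hp _ (eo_proj _ EWo) cE cP) => //.
    by apply: (p_snd_fib pr); rewrite pr1; apply: HFfib.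
  have aZ : fq_a QZ = p0 ∘ pr.
    apply: (cb_monic _ _ HcY) => /=; first by rewrite aZ1 p01 pr1.
    by rewrite aZ2 aW comp_assoc p02 -!comp_assoc pr2.
  have bZ : fq_b QZ = p1 ∘ pr.
    apply: (cb_monic _ _ HcY) => /=; first by rewrite bZ1 p11 pr1.
    by rewrite bZ2 bW comp_assoc p12 -!comp_assoc pr2.
  apply: (univalent_of_universal R QZ p0 p1 pr m HPZ fpr aZ bZ UZ Rm).
  have qs : fq_a QZ ∘ m = idm Y by case: Rm.
  have qsW : fq_a QW ∘ eW = idm W by rewrite aW -comp_assoc.
  apply: (cb_section_equiv e (fq_a QZ) m (fq_a QW) eW cE cY) => //.
  - rewrite aZ1 aV; apply: fib_comp => //.
    by case: (product_proj_fib (eo_is_prod _ EVo)).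
  - rewrite aW; apply: fib_comp => //.
    by case: (product_proj_fib (eo_is_prod _ EWo)).
  - by rewrite mf.
Qed.

End Univalence.

(** Univalence is claimed for every choice of path objects that is the induced one at [z]; the
    second conjunct shows that such choices exist. *)
Theorem mainTheorem9
  (E B A : TTFC) (p : Functor E B) (Hp : IsFibredTTFC p)
  (W' W : E) (w : Hom W' W) (Hw : UnivalentFibration (tt_paths E) w)
  (V' V : A) (v : Hom V' V) (Hv : UnivalentFibration (tt_paths A) v)
  (F : Functor A B)
  (HFfib : PreservesFib F) (HFpb : PreservesPBofFib F) (HFac : PreservesAcyclicCofib F)
  (h : Hom (F V) (p W)) (k : Hom (F V') (p W'))
  (Hhk : IsPullback (fmap p w) h k (fmap F v))
  (hW : E) (ehW : p hW = F V) (cW : Hom hW W) (HcW : IsCartLift p h ehW cW)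
  (kW' : E) (ekW' : p kW' = F V') (cW' : Hom kW' W') (HcW' : IsCartLift p k ekW' cW')
  (hw : Hom kW' hW) (Hhw : cW ∘ hw = w ∘ cW')
  (hw_above : idto ehW ∘ fmap p hw = fmap F v ∘ idto ekW') :
  let z : Hom (c := ChangeOfBase p F) (CbOb V' kW' ekW') (CbOb V hW ehW) :=
    CbHom (X := CbOb V' kW' ekW') (Y := CbOb V hW ehW) v hw hw_above in
  let Induced (Q : FixedPaths (ChangeOfBase p F)) : Prop :=
    forall (Hz : fib z) (Hv' : fib v) (Hw' : fib w),
      IsInducedPath (Q _ _ z Hz) (tt_paths A _ _ v Hv') (tt_paths E _ _ w Hw') cW' in
  fib z /\
  (exists Q : FixedPaths (ChangeOfBase p F), Induced Q) /\
  (forall Q : FixedPaths (ChangeOfBase p F), Induced Q -> UnivalentFibration Q z).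
Proof.
  move=> z Induced; case: Hv => fv UVv; case: Hw => fw UWw.
  set X : ChangeOfBase p F := CbOb V' kW' ekW' in z Induced *.
  set Y : ChangeOfBase p F := CbOb V hW ehW in z Induced *.
  case: HcW => HcW1 HcW2; case: HcW' => HcW'1 HcW'2.
  have fz : fib z.
    split=> //; apply: (cart_fib Hp hw w cW' cW) => //.
    by apply: (p_snd_fib z); apply: HFfib.
  split=> //; split.
  (* A [FixedPaths] has a value at every fibration, so [z] must be singled out among all of them.
     Fibrations are compared as triples in [T3], classically, and [Good] constrains only the value
     at [z3]. *)
  - pose T3 := {X : ChangeOfBase p F & {Y : ChangeOfBase p F & Hom X Y}}.
    pose z3 : T3 := existT _ X (existT _ Y z).
    pose IndP (R : PathObject z) : Prop := forall (Hv' : fib v) (Hw' : fib w),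
      IsInducedPath R (tt_paths A _ _ v Hv') (tt_paths E _ _ w Hw') cW'.
    pose Good (t : T3) (P : PathObject (projT2 (projT2 t))) : Prop := forall e : z3 = t,
      match e in _ = t' return PathObject (projT2 (projT2 t')) -> Prop with
      | eq_refl => IndP
      end P.
    have ex (t : T3) : fib (projT2 (projT2 t)) ->
        exists P : PathObject (projT2 (projT2 t)), Good t P.
      move=> Ht; case: (classic (z3 = t)) => [e | ne].
      + case: _ / e Ht => Ht.
        have [R HR] := induced_path_ex Hp HFac HFfib z (tt_paths A _ _ v fv)
          (tt_paths E _ _ w fw) cW' cW HcW'1 HcW1 (eq_sym Hhw) fv fw.
        (* The loop [e] on [z3] is [eq_refl] by proof irrelevance, so the dependent match in [Good]
           reduces. *)
        exists R => e; rewrite (proof_irrelevance _ e eq_refl) => Hv' Hw'.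
        by rewrite (proof_irrelevance _ Hv' fv) (proof_irrelevance _ Hw' fw).
      + have [P] := cb_path_ex Hp HFac HFfib _ Ht.
        by exists P => e; case: (ne e).
    pose Q : FixedPaths (ChangeOfBase p F) := fun X' Y' u Hu =>
      proj1_sig (constructive_indefinite_description _ (ex (existT _ X' (existT _ Y' u)) Hu)).
    exists Q => Hz Hv' Hw'; rewrite /Q; case: constructive_indefinite_description => P HP /=.
    exact: (HP eq_refl).
  - move=> Q HQ; exists fz.
    have [[i [[j [ji ij]] [i_refl [i_src i_tgt]]]] [c [Hc [c_refl [c_src c_tgt]]]]] :=
      HQ fz fv fw.
    have HP : IsPullback (fmap p w) (chi (O := Y) cW) (chi (O := X) cW') (fmap F v).
      by rewrite !chiE HcW2 HcW'2 -!comp_assoc !idto_Ksym !comp_id_r.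
    exact: (cb_univalent Hp HFpb HFfib HFac (X := X) (Y := Y) (z := z) HcW'1 HcW1
      (eq_sym Hhw) fz fw HP ji ij i_refl i_src i_tgt Hc c_refl c_src c_tgt UVv UWw).
Qed.
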